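(* Let $C\subset\mathbb{R}^d$ be a fixed nonempty closed convex cone with $\{\mathbf 0\}\neq C\neq\mathbb{R}^d$, and let $F\in\mathbb{L}^2_{C,\mathbb{F}}([0,T]\times\Omega;\mathbb{R}^d)$. Then $\int_0^tF_s\,ds\in\mathbb{L}^2_C(\Omega,\mathcal{F}_t)$ for $t\in[0,T]$. Furthermore, the process $\{\int_0^tF_s\,ds\}_{0\le t\le T}$ has Hausdorff continuous paths, $\mathbb{P}$-a.s.
   Context: A cone is a set $C\subseteq\mathbb{R}^d$ with $\alpha x\in C$ for all $\alpha>0$, $x\in C$. $(\Omega,\mathcal{F},\mathbb{P})$ is a complete probability space carrying a standard $m$-dimensional Brownian motion $B$ on $[0,T]$, and $\mathbb{F}=\{\mathcal{F}_t\}_{t\in[0,T]}$ is the natural filtration of $B$ augmented by the $\mathbb{P}$-null sets. $h$ is the Hausdorff distance, $h(A,B)=\max\{\sup_{a\in A}\inf_{b\in B}|a-b|,\ \sup_{b\in B}\inf_{a\in A}|a-b|\}$. $L_C$ is the family of nonempty closed $A\subseteq\mathbb{R}^d$ with $A=\overline{A+C}$ and $h(A,C)<\infty$. A closed-set-valued map $F$ is measurable if $\{F\cap E\ne\emptyset\}$ is measurable for every closed $E$. $\mathbb{L}^2_C(\Omega,\mathcal{F}_t)$ is the set of $\mathcal{F}_t$-measurable closed-set-valued random variables $G$ with $G\in L_C$ $\mathbb{P}$-a.s. and $\mathbb{E}[h^2(G,C)]<\infty$. A (set-valued or single-valued) process is $\mathbb{F}$-non-anticipative if it is $\mathscr{B}([0,T])\otimes\mathcal{F}$-measurable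 and $\mathbb{F}$-adapted. For a non-anticipative closed-set-valued process $F$, $S^2_{\mathbb{F}}(F)$ is the set of $\mathbb{F}$-non-anticipative $f\in\mathbb{L}^2([0,T]\times\Omega,\mathbb{R}^d)$ with $f\in F$ $dt\otimes d\mathbb{P}$-a.e. $\mathbb{L}^2_{C,\mathbb{F}}([0,T]\times\Omega;\mathbb{R}^d)$ is the set of non-anticipative closed-set-valued processes $F$ with $S^2_{\mathbb{F}}(F)\ne\emptyset$, $F_t\in L_C$ $\mathbb{P}$-a.s. for $t\in[0,T]$, and $\mathbb{E}[\int_0^Th^2(F_s,C)\,ds]<\infty$. Set-valued Lebesgue integral: for a $\sigma$-algebra $\mathcal{G}$, a set $V\subseteq\mathbb{L}^2_{\mathcal G}(\Omega,\mathbb{R}^d)$ is $\mathcal{G}$-decomposable if $\mathbf 1_Af+\mathbf 1_{A^c}g\in V$ for all $f,g\in V$, $A\in\mathcal{G}$; $\overline{\mathrm{dec}}_{\mathcal G}(V)$ is the $\mathbb{L}^2$-closure of the smallest $\mathcal{G}$-decomposable set containing $V$. $\int_0^TF_s\,ds$ is the ($\mathbb{P}$-a.s. unique) $\mathcal{F}_T$-measurable closed-set-valued random variable whose set of square-integrable $\mathcal{F}_T$-measurable selectors equals $\overline{\mathrm{dec}}_{\mathcal{F}_T}\{\int_0^Tf_s\,ds: f\in S^2_{\mathbb{F}}(F)\}$. For $t\in[0,T]$, $\int_0^tF_s\,ds:=\int_0^T\mathbf 1_{(0,t]}F_s\,ds$; equivalently, it is the $\mathcal{F}_t$-measurable closed-set-valued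 random variable whose set of square-integrable $\mathcal{F}_t$-measurable selectors equals $\overline{\mathrm{dec}}_{\mathcal{F}_t}\{\int_0^tf_s\,ds: f\in S^2_{\mathbb{F}}(F)\}$. The integral is defined almost surely for each $t$.
   Formalization: At t=0 the integral as defined is {0}, which is not in L_C and is at infinite Hausdorff distance from the integrals at t>0, so both claims fail there; the formal statement sets the integral over [0,0] equal to C a.s. and keeps the given definition for t in (0,T]. *)

(* Defs.v *)
From HB Require Import structures.
From mathcomp Require Import all_boot all_order all_algebra.
From mathcomp Require Import all_classical all_reals all_analysis.

Set Implicit Arguments.
Unset Strict Implicit.
Unset Printing Implicit Defensive.

Import Order.TTheory GRing.Theory Num.Theory.
Import numFieldNormedType.Exports.

Local Open Scope classical_set_scope.
Local Open Scope ring_scope.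

Section sets_in_Rd.
Context {R : realType} {d : nat}.
Implicit Types (A B C : set 'rV[R]_d) (x : 'rV[R]_d).

(* The norm [`|x|] of 'rV[R]_d is the sup norm, hence this definition. *)
Definition enorm x : R := Num.sqrt (\sum_(i < d) x 0 i ^+ 2).

Definition is_cone C := forall (a : R) x, 0 < a -> C x -> C (a *: x).

(* Infima and suprema are taken in \bar R; in particular the distance between
   the empty set and a nonempty set is +oo. *)
Definition hausdorff A B : \bar R :=
  maxe (ereal_sup [set ereal_inf [set (enorm (a - b))%:E | b in B] | a in A])
       (ereal_sup [set ereal_inf [set (enorm (a - b))%:E | a in A] | b in B]).

Definition set_sum A B : set 'rV[R]_d := [set a + b | a in A & b in B].

Definition L_ C : set (set 'rV[R]_d) := [set A |
  [/\ A !=set0, closed A, A = closure (set_sum A C) &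
      (hausdorff A C < +oo)%E]].

End sets_in_Rd.

Section random_vectors_and_sets.
Context {R : realType} {dsp : measure_display} {Omega : measurableType dsp}.
Context (P : probability Omega R) {d : nat}.
(* [G] stands for a sub-sigma-algebra of the sigma-algebra of Omega. *)
Implicit Types (G : set (set Omega)) (C : set 'rV[R]_d).
Implicit Types (f g : Omega -> 'rV[R]_d) (X : Omega -> set 'rV[R]_d).

Definition rv_measurable G f :=
  forall (i : 'I_d) (U : set R), measurable U -> G [set w | U (f w 0 i)].

Definition L2 G : set (Omega -> 'rV[R]_d) := [set f |
  rv_measurable G f /\ (\int[P]_w ((enorm (f w)) ^+ 2)%:E < +oo)%E].

Definition closed_random_set G X :=
  (forall w, closed (X w)) /\
  (forall E : set 'rV[R]_d, closed E -> G [set w | X w `&` E !=set0]).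

Definition L2_C C G : set (Omega -> set 'rV[R]_d) := [set X |
  [/\ closed_random_set G X,
      {ae P, forall w, L_ C (X w)} &
      (\int[P]_w (hausdorff (X w) C) ^+ 2 < +oo)%E]].

Definition L2_selectors G X : set (Omega -> 'rV[R]_d) := [set g |
  L2 G g /\ {ae P, forall w, X w (g w)}].

Definition decomposable G (V : set (Omega -> 'rV[R]_d)) :=
  V `<=` L2 G /\
  (forall f g A, V f -> V g -> G A ->
     V (fun w => \1_A w *: f w + \1_(~` A) w *: g w)).

Definition dec_hull G (V : set (Omega -> 'rV[R]_d)) :
    set (Omega -> 'rV[R]_d) :=
  smallest (decomposable G) V.

Definition closed_dec_hull G (V : set (Omega -> 'rV[R]_d)) :
    set (Omega -> 'rV[R]_d) := [set g |
  L2 G g /\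
  (forall e : R, 0 < e -> exists2 v, dec_hull G V v &
     (\int[P]_w ((enorm (g w - v w)) ^+ 2)%:E < e%:E)%E)].

End random_vectors_and_sets.

Section brownian_motion.
Context {R : realType} {dsp : measure_display} {Omega : measurableType dsp}.
Context (P : probability Omega R) (T : R) {m : nat}.
Variable W : R -> Omega -> 'rV[R]_m.

Definition past_events (t : R) : set (set Omega) := [set A |
  exists (s : R) (i : 'I_m) (U : set R),
    [/\ 0 <= s <= t, measurable U & A = [set w | U (W s w 0 i)]]].

Definition increment_in (s t : R) (U : 'I_m -> set R) : set Omega :=
  [set w | forall i, U i ((W t w - W s w) 0 i)].

(* [normal_prob mu sigma] is parametrised by the standard deviation; the
   product form of the law says that the components of an increment are
   independent centred Gaussian variables with variance t - s. *)
Definition is_brownian_motion :=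
  [/\ (forall t, 0 <= t <= T -> forall i : 'I_m,
         measurable_fun setT (fun w => W t w 0 i)),
      {ae P, forall w, W 0 w = 0 /\ {within `[0, T], continuous (W ^~ w)}},
      (forall s t (A : set Omega) (U : 'I_m -> set R),
         0 <= s -> s < t -> t <= T -> <<s past_events s >> A ->
         (forall i, measurable (U i)) ->
         P (A `&` increment_in s t U) = (P A * P (increment_in s t U))%E) &
      (forall s t (U : 'I_m -> set R),
         0 <= s -> s < t -> t <= T -> (forall i, measurable (U i)) ->
         P (increment_in s t U) =
         (\prod_(i < m) normal_prob 0 (Num.sqrt (t - s)) (U i))%E)].

Definition augmented_filtration (t : R) : set (set Omega) :=
  <<s past_events t `|` [set N | P.-negligible N] >>.

End brownian_motion.

(* Processes on [0, T] are represented by functions of a time in R, of which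
   only the values at times in [0, T] are relevant; B([0,T]) (x) F is the trace
   on [0, T] x Omega of the product sigma-algebra on R x Omega.  The filtration
   is an arbitrary family [Ft] of sub-sigma-algebras. *)
Section set_valued_lebesgue_integral.
Context {R : realType} {dsp : measure_display} {Omega : measurableType dsp}.
Context (P : probability Omega R) (T : R) (Ft : R -> set (set Omega)).
Context {d : nat}.
Implicit Types (F : R -> Omega -> set 'rV[R]_d) (C : set 'rV[R]_d).

Let mu : {measure set (measurableTypeR R) -> \bar R} := @lebesgue_measure R.

Let times : set R := `[0, T].

Let horizon : set (R * Omega) := times `*` setT.

Definition nonanticipative (f : R -> Omega -> 'rV[R]_d) :=
  (forall i : 'I_d,
     measurable_fun horizon (fun z : R * Omega => f z.1 z.2 0 i)) /\
  (forall t, 0 <= t <= T -> rv_measurable (Ft t) (f t)).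

Definition set_nonanticipative F :=
  (forall E : set 'rV[R]_d, closed E ->
     measurable [set z : R * Omega |
       0 <= z.1 <= T /\ F z.1 z.2 `&` E !=set0]) /\
  (forall t, 0 <= t <= T -> closed_random_set (Ft t) (F t)).

Definition S2 F : set (R -> Omega -> 'rV[R]_d) := [set f |
  [/\ nonanticipative f,
      (\int[(mu \x P)%E]_(z in horizon) ((enorm (f z.1 z.2)) ^+ 2)%:E < +oo)%E &
      {ae (mu \x P)%E, forall z, 0 <= z.1 <= T -> F z.1 z.2 (f z.1 z.2)}]].

Definition L2_CF C : set (R -> Omega -> set 'rV[R]_d) := [set F |
  [/\ set_nonanticipative F,
      S2 F !=set0,
      (forall t, 0 <= t <= T -> {ae P, forall w, L_ C (F t w)}) &
      (\int[P]_w \int[mu]_(s in times) (hausdorff (F s w) C) ^+ 2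
         < +oo)%E]].

Definition path_integral (f : R -> Omega -> 'rV[R]_d) (w : Omega) :
    'rV[R]_d :=
  \row_(i < d) Rintegral mu times (fun s => f s w 0 i).

(* "X is (a version of) the integral of F over [0, T]". *)
Definition is_set_integral F (X : Omega -> set 'rV[R]_d) :=
  closed_random_set (Ft T) X /\
  L2_selectors P (Ft T) X = closed_dec_hull P (Ft T) (path_integral @` S2 F).

Definition indicator_process (t : R) F : R -> Omega -> set 'rV[R]_d :=
  fun s w => [set \1_(`]0, t]%classic : set R) s *: x | x in F s w].

(* "X is (a version of) the integral of F over [0, t]".  Taken literally, the
   integral at t = 0 would be the singleton {0}, which is not an element of
   [L_ C] as C <> {0} and is at infinite Hausdorff distance from [L_ C].  The
   integral over the degenerate interval is therefore C, the neutral element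
   of [L_ C] for the closed Minkowski sum (and the value of 0 * A there). *)
Definition is_indefinite_set_integral C F (t : R)
    (X : Omega -> set 'rV[R]_d) :=
  if t == 0 then closed_random_set (Ft T) X /\ {ae P, forall w, X w = C}
  else is_set_integral (indicator_process t F) X.

Definition hausdorff_continuous (Y : R -> set 'rV[R]_d) :=
  forall t, 0 <= t <= T ->
    (fun s => hausdorff (Y s) (Y t)) @ within times (nbhs t) --> 0%E.

End set_valued_lebesgue_integral.

(* Main.v *)
(* Hiai-Umegaki duality: a nonempty closed decomposable set of square-integrable
   vectors is the set of selectors of a closed random set.  Its proof minimises
   the L^2 distance to each rational point; the resulting countable family is
   pointwise dense.  Applied to the closed decomposable hull of the path
   integrals, it produces the integrals of [F].  As [F + C = F], adding the
   constant process [c / t] to a selection translates its integral by [c], so the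
   integral over [0, t], t > 0, is a.s. the smallest closed random set containing
   all [int_0^t f + c] with [f] a selection and [c] in [C]; at t = 0 this set is
   [C].  That description does not mention the sigma-algebra, which gives
   F_t-measurability.

   Let [e] bound the distance to [C] on [F] and let [f0] be a selection.  For
   s <= t, splitting [f] at time s shows that [int_0^t f] is within [int_s^t e] of
   [int_0^s f + C], and conversely a selection on [0, s] is extended to [0, t] by
   [f0].  So the integrals at times s and t are a.s. at Hausdorff distance at most
   [g t - g s], where [g t = int_0^t (e + |f0|_1)].  With s = 0 this is the L^2
   bound.  On a countable dense set of times these bounds hold simultaneously off a
   null set, and compactness of closed balls extends them to all times. *)
Require Import Defs.
From HB Require Import structures.
From mathcomp Require Import all_boot all_order all_algebra.
From mathcomp Require Import all_classical all_reals all_analysis.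
From mathcomp Require Import measurable_realfun ring lra.

Set Implicit Arguments.
Unset Strict Implicit.
Unset Printing Implicit Defensive.

Import Order.TTheory GRing.Theory Num.Theory.
Import numFieldNormedType.Exports.

Local Open Scope classical_set_scope.
Local Open Scope ring_scope.


(** * Euclidean norm, distance to a set, and closed convex cones *)

Section euclidean.
Context {R : realType} {d : nat}.
Implicit Types (x y z p : 'rV[R]_d) (A B C : set 'rV[R]_d).

(** Three obstacles shape the proof. Processes are jointly measurable only for the full
    sigma-algebra, so Fubini says nothing about the F_t-measurability of [int_0^t f]; it is
    recovered, up to null sets, by conditioning the level sets of the integral on F_t. Next, the
    identity between F and the closure of F + C holds at each time off a null set depending on that
    time. Such a statement passes to almost every point of time x Omega only once its exceptional
    set is known to be measurable, hence the study of the event that a process belongs to a closed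
    random set. Finally, the measurable bound [e] is only the excess of F over C, one half of h(F,
    C); it is a countable matter of F hitting closed sets. The opposite inclusion is paid for by the
    selection [f0], which explains the asymmetric sum in [g].

    That the integral of a path close to C is close to C rests on duality: the distance to a closed
    convex cone is governed by the linear functionals of its polar cone, and these commute with the
    integral. *)

Definition dotp x y : R := \sum_(i < d) x 0 i * y 0 i.

Lemma dotpC x y : dotp x y = dotp y x.
Proof. by apply: eq_bigr => i _; rewrite mulrC. Qed.

Lemma dotpDr p x y : dotp p (x + y) = dotp p x + dotp p y.
Proof. by rewrite -big_split; apply: eq_bigr => i _; rewrite mxE mulrDr. Qed.

Lemma dotpZr p a x : dotp p (a *: x) = a * dotp p x.
Proof. by rewrite mulr_sumr; apply: eq_bigr => i _; rewrite mxE mulrCA. Qed.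

Lemma dotpBr p x y : dotp p (x - y) = dotp p x - dotp p y.
Proof. by rewrite dotpDr -scaleN1r dotpZr mulN1r. Qed.

Lemma dotpBl p x y : dotp (x - y) p = dotp x p - dotp y p.
Proof. by rewrite dotpC dotpBr !(dotpC p). Qed.

Lemma dotpDl p x y : dotp (x + y) p = dotp x p + dotp y p.
Proof. by rewrite dotpC dotpDr !(dotpC p). Qed.

Lemma dotpZl p a x : dotp (a *: x) p = a * dotp x p.
Proof. by rewrite dotpC dotpZr (dotpC p). Qed.

Lemma dotpp_ge0 x : 0 <= dotp x x.
Proof. by apply: sumr_ge0 => i _; rewrite -expr2 sqr_ge0. Qed.

Lemma enorm_ge0 x : 0 <= enorm x.
Proof. exact: sqrtr_ge0. Qed.

Lemma enorm_sqr x : enorm x ^+ 2 = dotp x x.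
Proof.
rewrite /enorm sqr_sqrtr; first by apply: eq_bigr => i _; rewrite expr2.
by apply: sumr_ge0 => i _; exact: sqr_ge0.
Qed.

Lemma ler_abs_coord_enorm x i : `|x 0 i| <= enorm x.
Proof.
rewrite -[leLHS]sqrtr_sqr ler_wsqrtr// (bigD1 i)//= lerDl.
by apply: sumr_ge0 => j _; exact: sqr_ge0.
Qed.

Lemma enorm_le_sum x : enorm x <= \sum_(i < d) `|x 0 i|.
Proof.
have s0 : 0 <= \sum_(i < d) `|x 0 i| by apply: sumr_ge0.
rewrite -(ler_pXn2r (n := 2))// ?nnegrE ?enorm_ge0//.
rewrite enorm_sqr expr2 mulr_suml; apply: ler_sum => i _.
rewrite (le_trans (ler_norm _))// normrM ler_wpM2l//.
by rewrite (bigD1 i)//= lerDl; apply: sumr_ge0.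
Qed.

Lemma enorm_eq0 x : enorm x = 0 -> x = 0.
Proof.
move=> x0; apply/rowP => i; rewrite mxE; apply/eqP.
by rewrite -normr_le0 -x0 ler_abs_coord_enorm.
Qed.

Lemma enormZ a x : enorm (a *: x) = `|a| * enorm x.
Proof.
rewrite /enorm -[`|a|]sqrtr_sqr -sqrtrM ?sqr_ge0// mulr_sumr.
by congr Num.sqrt; apply: eq_bigr => i _; rewrite mxE exprMn.
Qed.

Lemma enorm0 : enorm (0 : 'rV[R]_d) = 0.
Proof. by rewrite -(scale0r 0) enormZ normr0 mul0r. Qed.

Lemma enormN x : enorm (- x) = enorm x.
Proof. by rewrite -scaleN1r enormZ normrN1 mul1r. Qed.

Lemma enormB x y : enorm (x - y) = enorm (y - x).
Proof. by rewrite -enormN opprB. Qed.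

Lemma cauchy_schwarz_dotp x y : dotp x y <= enorm x * enorm y.
Proof.
have [x0|x0] := eqVneq (enorm x) 0.
  rewrite x0 mul0r (enorm_eq0 x0) /dotp big1// => i _.
  by rewrite mxE mul0r.
have [y0|y0] := eqVneq (enorm y) 0.
  rewrite y0 mulr0 (enorm_eq0 y0) /dotp big1// => i _.
  by rewrite mxE mulr0.
have xy : 0 < enorm x * enorm y.
  by rewrite mulr_gt0// lt_neqAle enorm_ge0 eq_sym ?x0 ?y0.
have := dotpp_ge0 (enorm y *: x - enorm x *: y).
rewrite dotpBr !dotpBl !dotpZr !dotpZl -!enorm_sqr (dotpC y x) => h.
rewrite -(ler_pM2l xy); nra.
Qed.

Lemma ler_enormD x y : enorm (x + y) <= enorm x + enorm y.
Proof.
rewrite -(ler_pXn2r (n := 2))// ?nnegrE ?addr_ge0 ?enorm_ge0//.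
rewrite enorm_sqr dotpDr !dotpDl -!enorm_sqr (dotpC y x).
have := cauchy_schwarz_dotp x y; nra.
Qed.

Lemma ler_enorm_dist z x y : enorm (x - y) <= enorm (x - z) + enorm (z - y).
Proof. by rewrite (le_trans _ (ler_enormD _ _))// addrA subrK. Qed.

Lemma enorm_le_mx_norm x : enorm x <= d%:R * `|x|.
Proof.
apply: (le_trans (enorm_le_sum x)).
rewrite -[d in d%:R](card_ord d) mulr_natl -sumr_const; apply: ler_sum => i _.
have /mapP[j Hj ->] : `|x 0 i| \in [seq `|x k.1 k.2| | k : 'I_1 * 'I_d].
  by apply/mapP; exists (0, i) => //=; rewrite mem_enum.
by rewrite [leRHS]/Num.norm /= mx_normrE; apply/bigmax_geP; right => /=; exists j.
Qed.

Lemma mx_norm_le_enorm x : `|x| <= enorm x.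
Proof.
rewrite [leLHS]/Num.norm /= mx_normrE; apply/bigmax_leP; split.
  exact: enorm_ge0.
by move=> [i j] _ /=; rewrite (ord1 i); exact: ler_abs_coord_enorm.
Qed.

Lemma nbhs_enormP x (U : set 'rV[R]_d) :
  nbhs x U <-> exists2 e : R, 0 < e & forall y, enorm (x - y) < e -> U y.
Proof.
split=> [/nbhs_normP[e /= e0 eU]|[e e0 eU]].
  exists e => // y xy; apply: eU => /=.
  exact: le_lt_trans (mx_norm_le_enorm _) xy.
apply/nbhs_ballP; exists (e / (d%:R + 1)) => /=; first by rewrite divr_gt0.
move=> y; rewrite -ball_normE /= => xy; apply: eU; apply: (le_lt_trans (enorm_le_mx_norm _)).
have d1 : 0 < d%:R + 1 :> R by [].
move: xy; rewrite ltr_pdivlMr//; have := normr_ge0 (x - y).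
have : 0 <= d%:R :> R by []. nra.
Qed.

Lemma closure_enormP A x :
  closure A x <-> forall e : R, 0 < e -> exists2 y, A y & enorm (x - y) < e.
Proof.
split=> [cA e e0|h U /nbhs_enormP[e e0 eU]].
  have [y [Ay xy]] : A `&` [set y | enorm (x - y) < e] !=set0.
    by apply: cA; apply/nbhs_enormP; exists e.
  by exists y.
by have [y Ay /eU Uy] := h e e0; exists y.
Qed.

Lemma closed_enorm A : closed A <->
  forall x, (forall e : R, 0 < e -> exists2 y, A y & enorm (x - y) < e) -> A x.
Proof.
by split=> cA x; [move/closure_enormP/cA|move/closure_enormP; exact: cA].
Qed.

Lemma continuous_enorm : continuous (@enorm R d).
Proof.
move=> x; apply/(@cvgrPdist_lt _ _ _ _ (nbhs_filter x)) => e e0.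
apply/nbhs_enormP; exists e => // y xy /=; apply: le_lt_trans xy.
have := ler_enormD (x - y) y; have := ler_enormD (y - x) x.
rewrite !subrK (enormB y x) ler_norml; lra.
Qed.

Lemma closed_eball x r : closed [set y | enorm (x - y) <= r].
Proof.
apply/closed_enorm => y h /=; apply/ler_addgt0Pr => e e0.
have [z /= xz yz] := h e e0.
by rewrite (le_trans (ler_enorm_dist z _ _))// lerD// ltW// enormB.
Qed.

Lemma compact_eball x r : compact [set y | enorm (x - y) <= r].
Proof.
apply: bounded_closed_compact; last exact: closed_eball.
exists (enorm x + r); split; first exact: num_real.
move=> M rM y /= xy; apply: (le_trans (mx_norm_le_enorm _)).
apply: le_trans (ltW rM); rewrite -[y](subrK x) addrC.
by rewrite (le_trans (ler_enormD _ _))// lerD2l enormB.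
Qed.

(** A single dense sequence, so that all countable operations run over [nat]. Numbers encoding no
    rational vector give 0, which does not affect density. *)
Definition rat_point (n : nat) : 'rV[R]_d :=
  if (unpickle n : option 'rV[rat]_d) is Some q then map_mx ratr q else 0.

Lemma dense_rat_point x (e : R) : 0 < e -> exists n, enorm (x - rat_point n) < e.
Proof.
move=> e0; pose e' := e / (d%:R + 1).
have d1 : 0 < d%:R + 1 :> R by [].
have e'0 : 0 < e' by rewrite divr_gt0.
have h (i : 'I_d) : exists q : rat, `|x 0 i - ratr q| < e'.
  have [|q] := @rat_in_itvoo R (x 0 i - e') (x 0 i + e'); first by lra.
  by rewrite in_itv/= -ltr_distlC => qx; exists q.
have /choice[q qP] := h.
exists (pickle (\row_i q i : 'rV[rat]_d)); rewrite /rat_point pickleK.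
apply: (le_lt_trans (enorm_le_sum _)).
apply: (@le_lt_trans _ _ (\sum_(i < d) e')).
  by apply: ler_sum => i _; rewrite !mxE ltW.
rewrite sumr_const card_ord -mulr_natl /e' mulrCA gtr_pMr// ltr_pdivrMr//.
by rewrite mul1r ltrDl.
Qed.

(* [x] lies within distance [r] of [B]; false when [B] is empty. *)
Definition near_set B r x := forall e : R, 0 < e ->
  exists2 b, B b & enorm (x - b) < r + e.

Lemma near_setP B r x :
  (ereal_inf [set (enorm (x - b))%:E | b in B] <= r%:E)%E <-> near_set B r x.
Proof.
split=> [h e e0|h].
  have /ereal_inf_lt[_ [b Bb <-]] : (ereal_inf [set (enorm (x - b))%:E | b in B] <
      (r + e)%:E)%E.
    by apply: (le_lt_trans h); rewrite lte_fin ltrDl.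
  by rewrite lte_fin => xb; exists b.
apply/lee_addgt0Pr => e e0; have [b Bb xb] := h e e0.
apply: ge_ereal_inf; exists (enorm (x - b))%:E; first by exists b.
by rewrite -EFinD lee_fin ltW.
Qed.

(** Reduces upper bounds on Hausdorff distances to two inclusions in [near_set], the form in which
    all later estimates are carried out. *)
Lemma hausdorff_leP A B (r : R) : (hausdorff A B <= r%:E)%E <->
  A `<=` near_set B r /\ B `<=` near_set A r.
Proof.
rewrite /hausdorff ge_max; split.
  move=> /andP[/ereal_supP h1 /ereal_supP h2]; split=> [a Aa|b Bb].
    by apply/near_setP/h1; exists a.
  have /h2/near_setP h : [set ereal_inf [set (enorm (a - b))%:E | a in A] | b in B]
      (ereal_inf [set (enorm (b - a))%:E | a in A]).
    by exists b => //; congr ereal_inf; apply: eq_imagel => a _; rewrite enormB.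
  exact: h.
move=> [h1 h2]; apply/andP; split; apply/ereal_supP => _ [a Aa <-].
  exact/near_setP/h1.
rewrite (_ : [set _ | _ in _] = [set (enorm (a - x))%:E | x in A]).
  exact/near_setP/h2.
by apply: eq_imagel => b _; rewrite enormB.
Qed.

Lemma hausdorff_ge0 A B : B !=set0 -> (0 <= hausdorff A B)%E.
Proof.
move=> [b Bb]; rewrite /hausdorff le_max; apply/orP; right.
apply: (@le_trans _ _ (ereal_inf [set (enorm (a - b))%:E | a in A])).
  by apply: le_ereal_inf_tmp => _ [a _ <-]; rewrite lee_fin enorm_ge0.
by apply: ereal_sup_ubound; exists b.
Qed.

Lemma near_set_le B r1 r2 x : r1 <= r2 -> near_set B r1 x -> near_set B r2 x.
Proof.
move=> r12 h e e0; have [b Bb xb] := h e e0; exists b => //.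
by apply: (lt_le_trans xb); rewrite lerD2r.
Qed.

Lemma near_set_dist B r x y : near_set B r y -> near_set B (enorm (x - y) + r) x.
Proof.
move=> h e e0; have [b Bb yb] := h e e0; exists b => //.
by apply: (le_lt_trans (ler_enorm_dist y _ _)); rewrite -addrA ltrD2l.
Qed.

Lemma near_set_trans A B r1 r2 x :
  near_set A r1 x -> A `<=` near_set B r2 -> near_set B (r1 + r2) x.
Proof.
move=> h1 h2 e e0; have e20 : 0 < e / 2 by rewrite divr_gt0.
have [a /h2 h xa] := h1 _ e20; have [b Bb ab] := h _ e20; exists b => //.
apply: (le_lt_trans (ler_enorm_dist a _ _)); lra.
Qed.

Lemma near_set_gt B r x : (forall e : R, 0 < e -> near_set B (r + e) x) ->
  near_set B r x.
Proof.
move=> h e e0; have e20 : 0 < e / 2 by rewrite divr_gt0.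
by have [b Bb xb] := h _ e20 _ e20; exists b => //; lra.
Qed.

Lemma closed_near_set B r : closed (near_set B r).
Proof.
apply/closed_enorm => x h; apply: near_set_gt => e e0.
have [y Ny xy] := h e e0; apply: near_set_le (near_set_dist x Ny); lra.
Qed.

Lemma near_set_closed B x : closed B -> near_set B 0 x -> B x.
Proof.
by move=> /closed_enorm cB h; apply: cB => e /h[b Bb]; rewrite add0r; exists b.
Qed.


End euclidean.

Section convex_cone.
Context {R : realType} {d : nat} (C : set 'rV[R]_d).
Hypotheses (C_neq0 : C !=set0) (closedC : closed C) (convexC : convex_set C)
  (coneC : is_cone C).
Implicit Types (x y p : 'rV[R]_d).

(** The definition of a cone allows positive factors only, so 0 is obtained as a limit of small
    multiples of a point. *)
Lemma cone0 : C 0.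
Proof.
have [c Cc] := C_neq0; move/closed_enorm : closedC; apply => e e0.
have c1 : 0 < enorm c + 1 by have := enorm_ge0 c; lra.
exists ((e / (enorm c + 1)) *: c); first by apply: coneC; rewrite ?divr_gt0.
rewrite sub0r enormN enormZ ger0_norm ?divr_ge0 ?ltW//.
rewrite mulrAC ltr_pdivrMr//; nra.
Qed.

Lemma coneD x y : C x -> C y -> C (x + y).
Proof.
move=> Cx Cy.
have h0 : 0 <= (2^-1 : R) by rewrite invr_ge0.
have h1 : (2^-1 : R) <= 1 by lra.
have e2 : 1 - (2^-1 : R) = 2^-1 by lra.
have : C (2^-1 *: x + (1 - 2^-1) *: y).
  by have := @convexC x y (Itv01 h0 h1); rewrite !inE; apply.
have two0 : 0 < 2 :> R by [].
move=> /(coneC two0).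
by rewrite e2 -scalerDr scalerA divff ?scale1r// pnatr_eq0.
Qed.

Lemma coneZ a x : 0 <= a -> C x -> C (a *: x).
Proof.
rewrite le_eqVlt => /orP[/eqP<- _|a0 Cx]; last exact: coneC.
by rewrite scale0r; exact: cone0.
Qed.

Definition polar p := forall c, C c -> dotp p c <= 0.

(** The point [pi] of C nearest to x exists because only the part of C in a ball matters. Minimality
    makes [x - pi] nonpositive on every direction in which one can move from [pi] inside C: the
    vectors of C give polarity, and the direction [- pi] gives orthogonality to [pi], hence the last
    equation. *)
Lemma cone_projection x :
  exists pi, [/\ C pi, polar (x - pi) & dotp (x - pi) x = enorm (x - pi) ^+ 2].
Proof.
have [c0 Cc0] := C_neq0.
pose K := C `&` [set y | enorm (x - y) <= enorm (x - c0)].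
have cK : compact K.
  rewrite /K setIC; apply: compact_closedI closedC; exact: compact_eball.
have K0 : K !=set0 by exists c0; split => //=.
have cf : {within K, continuous (fun y => enorm (x - y))}.
  apply: continuous_subspaceT => y.
  apply: (@continuous_comp _ _ _ (fun y => x - y)); last exact: continuous_enorm.
  by apply: continuousB; [exact: cst_continuous|].
have [pi] := EVT_min_rV K0 cK cf.
rewrite inE => -[Cpi /= xpi] min.
have {min xpi} minC y : C y -> enorm (x - pi) ^+ 2 <= enorm (x - y) ^+ 2.
  move=> Cy; rewrite ler_pXn2r// ?nnegrE ?enorm_ge0//.
  have [xy|xy] := leP (enorm (x - y)) (enorm (x - c0)); last exact/(le_trans xpi)/ltW.
  by apply: min; rewrite inE.
have var (v : 'rV[R]_d) (b : R) : 0 < b ->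
    (forall l : R, 0 < l -> l <= b -> C (pi + l *: v)) -> dotp (x - pi) v <= 0.
  move=> b0 Cv; rewrite leNgt; apply/negP => pv.
  have vv := dotpp_ge0 v.
  (* The step [l] stays in the admissible range and is so small that the gain
     [2 * l * dotp (x - pi) v] in squared distance exceeds the loss [l ^+ 2 * dotp v v]. *)
  pose l := Num.min b (dotp (x - pi) v / (dotp v v + 1)).
  have l0 : 0 < l by rewrite lt_min b0 divr_gt0//; lra.
  have lb : l <= b by rewrite ge_min lexx.
  have lp : l * (dotp v v + 1) <= dotp (x - pi) v.
    by rewrite -ler_pdivlMr ?ge_min ?lexx ?orbT//; lra.
  have := minC _ (Cv l l0 lb).
  rewrite !enorm_sqr opprD addrA.
  clearbody l; move: (x - pi) lp pv => q lp pv.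
  rewrite dotpBr !dotpBl !dotpZr !dotpZl (dotpC v q); nra.
have pol : polar (x - pi).
  by move=> c Cc; apply: (var c 1) => // l l0 _; apply: coneD => //; exact: coneC.
exists pi; split => //.
have ppi : dotp (x - pi) pi = 0.
  apply/eqP; rewrite eq_le pol//= -oppr_le0 -mulN1r -dotpZr.
  apply: (var _ 1) => // l l0 l1.
  rewrite scalerA mulrN1 -{1}(scale1r pi) -scalerDl; apply: coneZ => //; lra.
by rewrite enorm_sqr [RHS]dotpBr ppi subr0.
Qed.

(** Dual form of the distance to C: Cauchy-Schwarz in one direction, the residual of the projection
    as test functional in the other. Being a family of linear inequalities, the condition can be
    integrated. *)
Lemma near_coneP x r : 0 <= r ->
  near_set C r x <-> forall p, polar p -> dotp p x <= r * enorm p.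
Proof.
move=> r0; split=> [h p pp|h].
  apply/ler_addgt0Pr => e e0.
  have e1 : 0 < e / (enorm p + 1) by rewrite divr_gt0//; have := enorm_ge0 p; lra.
  have [c Cc xc] := h _ e1.
  have := cauchy_schwarz_dotp p (x - c); have := pp _ Cc; rewrite dotpBr => h1 h2.
  have h3 : e / (enorm p + 1) * (enorm p + 1) = e.
    by rewrite divfK// gt_eqF//; have := enorm_ge0 p; lra.
  have := enorm_ge0 p; nra.
have [pi [Cpi pol pE]] := cone_projection x.
move=> e e0; exists pi => //; have := h _ pol; rewrite pE => h1.
have := enorm_ge0 (x - pi); rewrite le_eqVlt => /orP[/eqP<-|p0]; first lra.
have : enorm (x - pi) <= r by rewrite -(ler_pM2r p0) -expr2.
lra.
Qed.

End convex_cone.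

(** * Measurable selections of closed random sets *)

(** The integral of a nonnegative function is a supremum over simple functions below it, hence
    monotone without measurability. This permits integrands such as squared Hausdorff distances,
    whose measurability is not established. *)
Lemma ge0_le_integral_nonmeasurable d (T : measurableType d) (R : realType)
    (mu : {measure set T -> \bar R}) (D : set T) (f g : T -> \bar R) :
  (forall x, D x -> (0 <= f x)%E) -> (forall x, D x -> (f x <= g x)%E) ->
  (\int[mu]_(x in D) f x <= \int[mu]_(x in D) g x)%E.
Proof.
move=> f0 fg; rewrite !(integral_mkcond D).
have h1 x : (0 <= (f \_ D) x)%E by apply: erestrict_ge0.
have h12 x : ((f \_ D) x <= (g \_ D) x)%E by apply: lee_restrict.
have h2 x : (0 <= (g \_ D) x)%E by exact: le_trans (h12 x).
rewrite !ge0_integralTE//; apply: le_ereal_sup => _ [h hf <-].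
by exists h => // x; exact: le_trans (h12 x).
Qed.

Lemma closed_far_set (R : realType) (d : nat) (B : set 'rV[R]_d) (r : R) :
  closed [set x | forall b, B b -> r <= enorm (x - b)].
Proof.
apply/closed_enorm => x h b Bb /=; apply/ler_addgt0Pr => e e0.
have [y /= yB xy] := h e e0; apply: (le_trans (yB _ Bb)).
by apply: (le_trans (ler_enorm_dist x _ _)); rewrite addrC lerD2l enormB ltW.
Qed.

Section measurable_vectors.
Context d0 (T : measurableType d0) {R : realType} {d : nat}.
Implicit Types (D : set T) (f g : T -> 'rV[R]_d).

Definition measurable_vec D f := forall i, measurable_fun D (fun w => f w 0 i).

Lemma measurable_vec_cst {D} (c : 'rV[R]_d) : measurable_vec D (fun=> c).
Proof. by move=> i; exact: measurable_cst. Qed.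

Lemma measurable_vecD D f g : measurable_vec D f -> measurable_vec D g ->
  measurable_vec D (fun w => f w + g w).
Proof.
move=> mf mg i; under eq_fun do rewrite mxE.
exact: measurable_funD (mf i) (mg i).
Qed.

Lemma measurable_vecB D f g : measurable_vec D f -> measurable_vec D g ->
  measurable_vec D (fun w => f w - g w).
Proof.
move=> mf mg i; under eq_fun do rewrite !mxE.
exact: measurable_funB (mf i) (mg i).
Qed.

Lemma measurable_vecZ D (a : T -> R) f : measurable_fun D a ->
  measurable_vec D f -> measurable_vec D (fun w => a w *: f w).
Proof.
move=> ma mf i; under eq_fun do rewrite !mxE.
exact: measurable_funM ma (mf i).
Qed.

Lemma measurable_enorm D f : measurable D -> measurable_vec D f ->
  measurable_fun D (fun w => enorm (f w)).
Proof.
move=> mD mf; rewrite /enorm.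
apply: (@measurableT_comp _ _ _ _ _ _ (@Num.sqrt R)).
  by apply: continuous_measurable_fun; exact: sqrt_continuous.
by apply: measurable_sum => i; apply: measurable_funX; exact: mf.
Qed.

Lemma measurable_enorm_le D f (c : 'rV[R]_d) (e : R) : measurable D ->
  measurable_vec D f -> measurable (D `&` [set w | enorm (f w - c) <= e]).
Proof.
move=> mD mf; have mB := measurable_vecB mf (measurable_vec_cst c).
have := measurable_enorm mD mB mD (measurable_itv `]-oo, e]).
by congr measurable; apply: eq_setIr => w /=; rewrite in_itv.
Qed.

Lemma measurable_enorm_lt D f (c : 'rV[R]_d) (e : R) : measurable D ->
  measurable_vec D f -> measurable (D `&` [set w | enorm (f w - c) < e]).
Proof.
move=> mD mf; have mB := measurable_vecB mf (measurable_vec_cst c).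
have := measurable_enorm mD mB mD (measurable_itv `]-oo, e[).
by congr measurable; apply: eq_setIr => w /=; rewrite in_itv.
Qed.

Lemma measurable_vec_preimage_open f (U : set 'rV[R]_d) :
  measurable_vec setT f -> open U -> measurable [set w | U (f w)].
Proof.
move=> mf oU.
pose good n k := forall y : 'rV[R]_d, enorm (y - rat_point n) < k.+1%:R^-1 -> U y.
rewrite (_ : mkset _ = \bigcup_n \bigcup_(k in good n)
  [set w | enorm (f w - rat_point n) < k.+1%:R^-1]).
  apply: bigcup_measurable => n _; apply: bigcup_measurable => k _.
  by rewrite -(setTI (mkset _)); exact: measurable_enorm_lt.
apply/seteqP; split=> [w /= Uw|w [n _ [k gk fw]]]; last exact: gk.
have /nbhs_enormP[e e0 eU] : nbhs (f w) U by exact: open_nbhs_nbhs.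
have [k ke] : exists k : nat, k.+1%:R^-1 < e / 2.
  have e20 : 0 < e / 2 by rewrite divr_gt0.
  have [k _ /(_ _ (leqnn k))] := near_infty_natSinv_lt (PosNum e20).
  by move=> /= ?; exists k.
have k0 : 0 < k.+1%:R^-1 :> R by [].
have [n nk] := dense_rat_point (f w) k0.
exists n => //; exists k => // y yn; apply: eU.
rewrite (le_lt_trans (ler_enorm_dist (rat_point n) _ _))//.
move: ke nk yn; rewrite (enormB y); move: (k.+1%:R^-1) => a; lra.
Qed.

(** As [X z] is closed, it contains [f z] iff for each k some rational ball of radius 1/(k+1)
    contains [f z] and meets [X z]; each of these events is measurable. *)
Lemma measurable_mem_closed_set D (X : T -> set 'rV[R]_d) f :
  measurable D -> (forall z, D z -> closed (X z)) ->
  (forall E, closed E -> measurable (D `&` [set z | X z `&` E !=set0])) ->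
  measurable_vec D f -> measurable (D `&` [set z | X z (f z)]).
Proof.
move=> mD cX mX mf.
rewrite (_ : _ `&` _ = \bigcap_k \bigcup_n
  ((D `&` [set z | enorm (f z - rat_point n) <= k.+1%:R^-1]) `&`
   (D `&` [set z | X z `&` [set y | enorm (rat_point n - y) <= k.+1%:R^-1] !=set0]))).
  apply: bigcap_measurableType => k _; apply: bigcup_measurable => n _.
  by apply: measurableI; [exact: measurable_enorm_le|exact/mX/closed_eball].
apply/seteqP; split=> [z [Dz /= Xf] k _|z h].
  have [n nk] := dense_rat_point (f z) (ltac:(by []) : 0 < k.+1%:R^-1 :> R).
  exists n => //; split; split => //=; first exact: ltW.
  by exists (f z); split => //=; rewrite enormB ltW.
have Dz : D z by have [n _ [[]]] := h 0%N I.
split => //; apply: (closed_enorm _).1 => [|e e0]; first exact: cX.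
have e20 : 0 < e / 2 by rewrite divr_gt0.
have [k _ /(_ _ (leqnn k)) /= ke] := near_infty_natSinv_lt (PosNum e20).
have [n _ [[_ /= fn] [_ [y [Xy /= ny]]]]] := h k I.
exists y => //; rewrite (le_lt_trans (ler_enorm_dist (rat_point n) _ _))//.
move: ke fn ny; move: (k.+1%:R^-1) => a; lra.
Qed.

Lemma measurable_vec_countable (idx : T -> nat) (h : nat -> 'rV[R]_d) :
  (forall n, measurable [set w | idx w = n]) ->
  measurable_vec setT (fun w => h (idx w)).
Proof.
move=> mi i _ Y mY; rewrite setTI.
rewrite (_ : _ @^-1` _ = \bigcup_(n in [set n | Y (h n 0 i)]) [set w | idx w = n]).
  by apply: bigcup_measurable => n _; exact: mi.
apply/seteqP; split=> [w /= Yw|w [n /= Yn] /= ->//].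
by exists (idx w).
Qed.

End measurable_vectors.

Section least_index.

(** A canonical choice, so that measurability in a parameter follows from that of the events [Q n].
    The default 0 for an empty [Q] makes 0 the exceptional value in the lemmas below. *)
Definition least_index (Q : nat -> Prop) : nat :=
  if pselect (exists n, `[< Q n >]) is left h then ex_minn h else 0.

Lemma least_indexP (Q : nat -> Prop) : (exists n, Q n) -> Q (least_index Q).
Proof.
move=> [n Qn]; rewrite /least_index; case: pselect => [h|[]].
  by case: ex_minnP => m /asboolP.
by exists n; exact/asboolP.
Qed.

Lemma least_index_eq (Q : nat -> Prop) n : least_index Q = n <->
  (Q n /\ forall i, (i < n)%N -> ~ Q i) \/ (n = 0%N /\ forall i, ~ Q i).
Proof.
rewrite /least_index; case: pselect => [h|h]; last first.
  have nQ i : ~ Q i by move=> Qi; apply: h; exists i; exact/asboolP.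
  split=> [<-|[[/nQ//]|[-> //]]]; by right.
case: ex_minnP => m /asboolP Qm min; split=> [<-|].
  left; split=> // i im Qi; have := min i (introT (asboolP _) Qi).
  by rewrite leqNgt im.
move=> [[Qn ltn]|[_ /(_ m)//]]; apply/eqP; rewrite eqn_leq min ?andTb; last exact/asboolP.
by rewrite leqNgt; apply/negP => /ltn.
Qed.

Lemma measurable_least_index d (T : measurableType d) (Q : nat -> set T) n :
  (forall n, measurable (Q n)) -> measurable [set w | least_index (Q^~ w) = n].
Proof.
move=> mQ; rewrite (_ : mkset _ =
  (Q n `&` \bigcap_(i in [set i | (i < n)%N]) ~` Q i) `|`
  (if n == 0%N then \bigcap_i ~` Q i else set0)).
  apply: measurableU.
    by apply: measurableI => //; apply: bigcap_measurableType => i _; exact: measurableC.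
  by case: ifP => // _; apply: bigcap_measurableType => i _; exact: measurableC.
apply/seteqP; split=> w /=.
  move=> /least_index_eq[[Qn h]|[-> h]]; [left|right]; first by split => // i /h.
  by move=> i _; exact: h.
move=> [[Qn h]|]; first by apply/least_index_eq; left; split => // i /h.
case: eqP => // -> h; apply/least_index_eq; right; split => // i; exact: h.
Qed.

End least_index.


Lemma measurable_fun_mem d (T : measurableType d) (S : set T) :
  measurable S -> measurable_fun setT (fun w => w \in S).
Proof.
move=> mS; apply: (measurable_fun_bool true); rewrite setTI.
have -> // : in_mem^~ (mem S) @^-1` [set true] = S.
by apply/seteqP; split=> w; [exact: set_mem|exact: mem_set].
Qed.

Section measurable_selection.
Context d0 (T : measurableType d0) {R : realType} {d : nat}.
Variable (X : T -> set 'rV[R]_d).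
Hypotheses (cX : forall w, closed (X w))
  (mX : forall E, closed E -> measurable [set w | X w `&` E !=set0]).

Let rad (k : nat) : R := 2^-1 ^+ k.
Let B (k n : nat) : set 'rV[R]_d := [set y | enorm (rat_point n - y) <= rad k].
Let hit w (E : set 'rV[R]_d) := X w `&` E !=set0.

(* Each index is the least one for which the corresponding ball of radius
   [2^-k] meets [X w] and the preceding ball at a common point. *)
Let idx := fix idx (k : nat) (w : T) : nat :=
  if k is k'.+1 then least_index (fun n => hit w (B k' (idx k' w) `&` B k n))
  else least_index (fun n => hit w (B 0 n)).

Let rad_gt0 k : 0 < rad k.
Proof. by rewrite exprn_gt0. Qed.

Let measurable_idx k n : measurable [set w | idx k w = n].
Proof.
elim: k n => [|k IH] n /=.
  apply: (measurable_least_index (Q := fun n => [set w | hit w (B 0 n)])) => j.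
  by apply: mX; exact: closed_eball.
apply: (measurable_least_index
  (Q := fun n => [set w | hit w (B k (idx k w) `&` B k.+1 n)])) => j.
rewrite (_ : mkset _ = \bigcup_i ([set w | idx k w = i] `&`
   [set w | hit w (B k i `&` B k.+1 j)])).
  apply: bigcup_measurable => i _; apply: measurableI => //.
  by apply: mX; apply: closedI; exact: closed_eball.
apply/seteqP; split=> [w /= hw|w [i _ [/= <-//]]].
by exists (idx k w).
Qed.

Let idx_hit w k : X w !=set0 -> hit w (B k (idx k w)).
Proof.
move=> [x Xx]; have cover j y : exists n, B j n y.
  have [n yn] := dense_rat_point y (rad_gt0 j).
  by exists n; rewrite /B/= enormB ltW.
elim: k => [|k [y [Xy By]]] /=.
  pose Q n := hit w (B 0 n).
  have : Q (least_index Q) by apply: least_indexP; have [n Bn] := cover 0%N x; exists n, x.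
  by [].
set Q := fun n => hit w (B k (idx k w) `&` B k.+1 n).
have : Q (least_index Q).
  by apply: least_indexP; have [n Bn] := cover k.+1 y; exists n, y.
by move=> [z [Xz [_ Bz]]]; exists z.
Qed.

Let idx_step w k : X w !=set0 ->
  enorm (rat_point (idx k w) - rat_point (idx k.+1 w) : 'rV[R]_d) <= 2 * rad k.
Proof.
move=> X0 /=; set Q := fun n => hit w (B k (idx k w) `&` B k.+1 n).
have : Q (least_index Q).
  apply: least_indexP; have [y [Xy By]] := idx_hit k X0.
  have [n yn] := dense_rat_point y (rad_gt0 k.+1).
  by exists n, y; split=> //; split=> //; rewrite /B/= enormB ltW.
move=> [z [Xz [/= h1 h2]]]; rewrite (le_trans (ler_enorm_dist z _ _))//.
have : rad k.+1 <= rad k by rewrite /rad exprSr ler_piMr ?exprn_ge0//; lra.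
move: h1 h2; rewrite /B /= (enormB z (rat_point _)); move: (rad k) (rad k.+1).
move: (enorm _) (enorm _) => a b u v; lra.
Qed.

(** The steps [2 * rad k] form a geometric series. The induction carries the telescoping bound
    [4 * (rad k - rad (k + j))], from which the stated one follows. *)
Let idx_tail w k j : X w !=set0 ->
  enorm (rat_point (idx k w) - rat_point (idx (k + j) w) : 'rV[R]_d) <=
    4 * rad k.
Proof.
move=> X0; suff : enorm (rat_point (idx k w) - rat_point (idx (k + j) w) : 'rV[R]_d) <=
    4 * (rad k - rad (k + j))
    by have := rad_gt0 (k + j); move: (enorm _) (rad k) (rad (k + j)) => *; lra.
elim: j => [|j IH]; first by rewrite addn0 !subrr enorm0 mulr0.
rewrite (le_trans (ler_enorm_dist (rat_point (idx (k + j) w)) _ _))// addnS.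
have := idx_step (k + j) X0.
have -> : rad (k + j).+1 = rad (k + j) / 2 by rewrite /rad exprSr.
move: IH; move: (enorm _) (enorm _) (rad k) (rad (k + j)) => *; lra.
Qed.

(** The Kuratowski-Ryll-Nardzewski theorem: the centres of the chosen balls are measurable with
    countably many values and form a Cauchy sequence whose limit is at distance zero from [X w]. *)
Lemma measurable_selection : exists g : T -> 'rV[R]_d,
  measurable_vec setT g /\ forall w, X w !=set0 -> X w (g w).
Proof.
(* The value 0 where [X w] is empty makes the sequence converge at every point. *)
pose v w k : 'rV[R]_d := if pselect (X w !=set0) then rat_point (idx k w) else 0.
have radcvg (e : R) : 0 < e -> exists k, rad k < e.
  move=> e0; have := @cvg_expr R (2^-1).
  rewrite ger0_norm// => /(_ ltac:(lra)) /cvgrPdist_lt /(_ _ e0)[k _ /(_ _ (leqnn k))].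
  by rewrite sub0r normrN ger0_norm ?exprn_ge0// => /= h; exists k.
have cv w : cvgn (v w).
  rewrite /v; case: pselect => X0; last exact: is_cvg_cst.
  apply: cauchy_cvg; apply/cauchy_exP => e e0.
  have [k ke] := radcvg (e / 4) ltac:(by rewrite divr_gt0).
  exists (rat_point (idx k w)); exists k => // j /= kj.
  rewrite -ball_normE /=; apply: (le_lt_trans (mx_norm_le_enorm _)).
  have := idx_tail k (j - k) X0; rewrite subnKC//.
  by move: ke; move: (enorm _) (rad k) => *; lra.
pose S := [set w | X w !=set0].
have mS : measurable S.
  have := mX closedT; congr measurable; apply/seteqP; split=> w /=.
    by move=> [x [Xx _]]; exists x.
  by move=> [x Xx]; exists x.
exists (fun w => lim (v w @ \oo)); split=> [i|w X0].
  apply: (measurable_fun_cvg (h := fun k w => v w k 0 i)) => [k|w _].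
    rewrite /v.
    rewrite (_ : (fun w => _) = fun w => if w \in S then rat_point (idx k w) 0 i else 0).
      apply: measurable_fun_ifT; [exact: measurable_fun_mem| |exact: measurable_cst].
      exact: measurable_vec_countable.
    apply/funext => w; case: pselect => h; first by rewrite mem_set.
    by rewrite memNset// mxE.
  exact: (cvg_comp (v w) (fun M => M 0 i) (cv w) (@coord_continuous R 1 d 0 i _)).
apply: (closed_enorm _).1 => // e e0.
have [k ke] := radcvg (e / 8) ltac:(by rewrite divr_gt0).
have [y [Xy /= By]] := idx_hit k X0.
exists y => //; rewrite (le_lt_trans (ler_enorm_dist (rat_point (idx k w)) _ _))//.
suff : enorm (rat_point (idx k w) - lim (v w @ \oo)) <= 4 * rad k.
  move: ke By; rewrite /B /= (enormB (lim _)).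
  by move: (enorm _) (enorm _) (rad k) => *; lra.
have : closed [set y : 'rV[R]_d | enorm (rat_point (idx k w) - y) <= 4 * rad k].
  exact: closed_eball.
move=> cE; apply: (@closed_cvg _ _ _ eventually_filter (v w) _ cE _ _ (cv w)).
exists k => // j /= kj; rewrite /v; case: pselect => //= X1.
by have := idx_tail k (j - k) X0; rewrite subnKC.
Qed.

End measurable_selection.

Lemma measurable_selection_ball d0 (T : measurableType d0) {R : realType} {d : nat}
    (X : T -> set 'rV[R]_d) (E : set 'rV[R]_d) :
  (forall w, closed (X w)) ->
  (forall E, closed E -> measurable [set w | X w `&` E !=set0]) -> closed E ->
  exists g : T -> 'rV[R]_d, measurable_vec setT g /\
    forall w, X w `&` E !=set0 -> (X w `&` E) (g w).
Proof.
move=> cX mX cE; apply: (@measurable_selection _ _ _ _ (fun w => X w `&` E)).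
  by move=> w; exact: closedI.
by move=> E' cE'; under eq_fun do rewrite -setIA; apply: mX; exact: closedI.
Qed.

(** * Decomposable sets of square-integrable random vectors *)

Lemma exists_invn_lt (R : realType) (e : R) : 0 < e -> exists k : nat, k.+1%:R^-1 < e.
Proof.
move=> e0; have [k _ /(_ _ (leqnn k)) /= ke] := near_infty_natSinv_lt (PosNum e0).
by exists k.
Qed.

Lemma compact_seq_cluster {R : realType} {d : nat} (K : set 'rV[R]_d)
    (a : nat -> 'rV[R]_d) : compact K -> (forall l, K (a l)) ->
  exists2 p, K p & forall (e : R) N, 0 < e -> exists2 l, (N <= l)%N & enorm (p - a l) < e.
Proof.
move=> cK Ka; have [|p [Kp cp]] := cK (a @ \oo) _.
  by exists 0%N => // l _; exact: Ka.
exists p => // e N e0.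
have [y [[l /= Nl ly] py]] : [set a l | l in [set l | (N <= l)%N]] `&`
    [set y | enorm (p - y) < e] !=set0.
  apply: cp; last by apply/nbhs_enormP; exists e.
  by exists N => // l Nl; exists l.
by exists l; rewrite ?ly.
Qed.

Section sub_sigma_algebra.
Context {R : realType} {dsp : measure_display} {Omega : measurableType dsp}.
Variable P : probability Omega R.
Context {d : nat}.
Implicit Types (f g : Omega -> 'rV[R]_d).

(** The properties of the augmented filtration at a fixed time on which the arguments rest.
    Containing the null sets makes G-measurability stable under almost sure modification. *)
Definition augmented_sub_sigma_algebra (G : set (set Omega)) :=
  [/\ sigma_algebra setT G, G `<=` measurable & forall N, P.-negligible N -> G N].

Variables (G : set (set Omega)) (GP : augmented_sub_sigma_algebra G).

(** Views G as the sigma-algebra of a type of its own, so that general measurability results apply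
    to G-measurability. *)
Lemma sub_measurableE : @measurable _ (g_sigma_algebraType G) = G.
Proof. by case: GP => sG _ _; exact: sigma_algebra_id. Qed.

Lemma rv_measurableE f : rv_measurable G f <->
  measurable_vec (T := g_sigma_algebraType G) setT f.
Proof.
split=> [mf i _ Y mY|mf i U mU]; first by rewrite setTI sub_measurableE; exact: mf.
by have := mf i measurableT U mU; rewrite setTI sub_measurableE.
Qed.

Lemma rv_measurable_vec f : rv_measurable G f -> measurable_vec setT f.
Proof. by case: GP => _ GF _ mf i _ Y mY; rewrite setTI; exact/GF/mf. Qed.

Lemma rv_measurable_ae f g : rv_measurable G f -> {ae P, forall w, f w = g w} ->
  rv_measurable G g.
Proof.
move=> mf fg i U mU; rewrite -sub_measurableE.
have mN (A : set Omega) : A `<=` [set w | f w <> g w] ->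
    measurable (A : set (g_sigma_algebraType G)).
  move=> AN; rewrite sub_measurableE; case: GP => _ _; apply.
  exact: negligibleS fg.
rewrite (_ : mkset _ = ([set w | U (f w 0 i)] `\` [set w | U (f w 0 i) /\ f w <> g w])
   `|` [set w | U (g w 0 i) /\ f w <> g w]).
  apply: measurableU; last by apply: mN => w [].
  by apply: measurableD; [rewrite sub_measurableE; exact: mf|apply: mN => w []].
apply/seteqP; split=> w /=.
  move=> Ug; have [fgw|fgw] := pselect (f w = g w); [left|by right].
  by rewrite fgw; split => // -[].
move=> [[Uf]|[]//]; rewrite not_andP => -[//|/contrapT <-//].
Qed.

Definition sq_norm f : \bar R := (\int[P]_w ((enorm (f w)) ^+ 2)%:E)%E.

Lemma sq_norm_ge0 f : (0 <= sq_norm f)%E.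
Proof. by apply: integral_ge0 => w _; rewrite lee_fin sqr_ge0. Qed.

Lemma measurable_sqr_enorm f : measurable_vec setT f ->
  measurable_fun setT (fun w => ((enorm (f w)) ^+ 2)%:E).
Proof.
by move=> mf; apply/measurable_EFinP; apply: measurable_funX; exact: measurable_enorm.
Qed.


Lemma integral_le_sq_norm (F : Omega -> \bar R) f g (a : R) : 0 <= a ->
  measurable_vec setT f -> measurable_vec setT g ->
  (forall w, (0 <= F w)%E) ->
  (forall w, (F w <= (a * enorm (f w) ^+ 2)%:E + (a * enorm (g w) ^+ 2)%:E)%E) ->
  (\int[P]_w F w <= a%:E * sq_norm f + a%:E * sq_norm g)%E.
Proof.
move=> a0 mf mg F0 Ffg.
apply: le_trans (ge0_le_integral_nonmeasurable _ (fun w _ => F0 w) (fun w _ => Ffg w)) _.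
have mZ h : measurable_vec setT h ->
    measurable_fun setT (fun w => (a * enorm (h w) ^+ 2)%:E).
  move=> mh; apply/measurable_EFinP; apply: measurable_funM => //.
  by apply: measurable_funX; exact: measurable_enorm.
rewrite ge0_integralD//; first last.
- exact: mZ.
- by move=> w _; rewrite lee_fin mulr_ge0// sqr_ge0.
- exact: mZ.
- by move=> w _; rewrite lee_fin mulr_ge0// sqr_ge0.
have IZ h : measurable_vec setT h ->
    (\int[P]_w (a * enorm (h w) ^+ 2)%:E = a%:E * sq_norm h)%E.
  move=> mh; under eq_integral do rewrite EFinM.
  rewrite ge0_integralZl//; first exact: measurable_sqr_enorm.
  by move=> w _; rewrite lee_fin sqr_ge0.
by rewrite !IZ.
Qed.

Lemma sq_norm_lty f g (a : R) (F : Omega -> \bar R) : 0 <= a ->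
  measurable_vec setT f -> measurable_vec setT g ->
  (forall w, (0 <= F w)%E) ->
  (forall w, (F w <= (a * enorm (f w) ^+ 2)%:E + (a * enorm (g w) ^+ 2)%:E)%E) ->
  (sq_norm f < +oo)%E -> (sq_norm g < +oo)%E -> (\int[P]_w F w < +oo)%E.
Proof.
move=> a0 mf mg F0 Ffg f2 g2; apply: le_lt_trans (integral_le_sq_norm a0 mf mg F0 Ffg) _.
by apply: lte_add_pinfty; apply: lte_mul_pinfty => //; exact: sq_norm_ge0.
Qed.

Lemma sqr_enormD (x y : 'rV[R]_d) :
  enorm (x + y) ^+ 2 <= 2 * enorm x ^+ 2 + 2 * enorm y ^+ 2.
Proof.
have : enorm (x + y) ^+ 2 <= (enorm x + enorm y) ^+ 2.
  by rewrite ler_pXn2r ?nnegrE ?addr_ge0 ?enorm_ge0// ler_enormD.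
have := sqr_ge0 (enorm x - enorm y); nra.
Qed.

Lemma sq_norm_dist f g h : measurable_vec setT f -> measurable_vec setT g ->
  measurable_vec setT h ->
  (sq_norm (fun w => (f w - h w)%R) <= 2%:E * sq_norm (fun w => (f w - g w)%R) +
                            2%:E * sq_norm (fun w => (g w - h w)%R))%E.
Proof.
move=> mf mg mh; apply: integral_le_sq_norm => //; try exact: measurable_vecB.
  by move=> w; rewrite lee_fin sqr_ge0.
by move=> w; rewrite -EFinD lee_fin -(subrKA (g w)) sqr_enormD.
Qed.

Lemma L2_add f g : L2 P G f -> L2 P G g -> L2 P G (fun w => f w + g w).
Proof.
move=> [mf f2] [mg g2]; split.
  by apply/rv_measurableE/measurable_vecD; exact/rv_measurableE.
apply: (sq_norm_lty (ler0n _ 2) _ _ _ _ f2 g2); try exact: rv_measurable_vec.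
  by move=> w; rewrite lee_fin sqr_ge0.
by move=> w; rewrite -EFinD lee_fin sqr_enormD.
Qed.

Definition splice (A : set Omega) f g := fun w => \1_A w *: f w + \1_(~` A) w *: g w.

Lemma splice_in A f g w : A w -> splice A f g w = f w.
Proof.
move=> Aw; rewrite /splice !indicE mem_set// memNset; last by apply.
by rewrite scale1r scale0r addr0.
Qed.

Lemma splice_out A f g w : ~ A w -> splice A f g w = g w.
Proof.
move=> Aw; rewrite /splice !indicE memNset// mem_set//.
by rewrite scale1r scale0r add0r.
Qed.

Lemma spliceP A f g w : splice A f g w = f w \/ splice A f g w = g w.
Proof. by have [Aw|Aw] := pselect (A w); [rewrite splice_in|rewrite splice_out]; auto. Qed.

Lemma rv_measurable_splice A f g : G A -> rv_measurable G f -> rv_measurable G g ->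
  rv_measurable G (splice A f g).
Proof.
move=> GA /rv_measurableE mf /rv_measurableE mg.
have mA : measurable (A : set (g_sigma_algebraType G)) by rewrite sub_measurableE.
apply/rv_measurableE; apply: measurable_vecD; apply: measurable_vecZ => //.
by apply: measurable_indic; exact: measurableC.
Qed.

Lemma L2_splice A f g : G A -> L2 P G f -> L2 P G g -> L2 P G (splice A f g).
Proof.
move=> GA [mf f2] [mg g2]; split; first exact: rv_measurable_splice.
apply: (sq_norm_lty ler01 _ _ _ _ f2 g2); try exact: rv_measurable_vec.
  by move=> w; rewrite lee_fin sqr_ge0.
move=> w; rewrite !mul1r -EFinD lee_fin.
by case: (spliceP A f g w) => ->; rewrite ?lerDl ?lerDr sqr_ge0.
Qed.

Lemma markov_sq_norm f (a : R) : 0 < a -> measurable_vec setT f ->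
  ((a ^+ 2)%:E * P [set w | (a <= enorm (f w))%R] <= sq_norm f)%E.
Proof.
move=> a0 mf.
have mA : measurable [set w | a <= enorm (f w)].
  have := measurable_enorm measurableT mf measurableT (measurable_itv `[a, +oo[).
  by rewrite setTI; congr measurable; apply/seteqP; split=> w /=; rewrite in_itv/= andbT.
rewrite -integral_cst// /sq_norm integral_mkcond.
apply: ge0_le_integral_nonmeasurable => w _.
  by apply: erestrict_ge0 => *; rewrite lee_fin sqr_ge0.
rewrite patchE; case: ifPn => [|_]; last by rewrite lee_fin sqr_ge0.
by rewrite inE /= => aw; rewrite lee_fin ler_pXn2r ?nnegrE ?enorm_ge0// ltW.
Qed.

End sub_sigma_algebra.

Section decomposable_hull.
Context {R : realType} {dsp : measure_display} {Omega : measurableType dsp}.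
Variable P : probability Omega R.
Context {d : nat}.
Implicit Types (f g : Omega -> 'rV[R]_d) (V : set (Omega -> 'rV[R]_d)).
Variables (G : set (set Omega)) (GP : augmented_sub_sigma_algebra P G).
Local Notation sqn := (sq_norm P).

Lemma dec_hull_sub V (W : set (Omega -> 'rV[R]_d)) :
  W `<=` L2 P G -> (forall f g A, W f -> W g -> G A -> W (splice A f g)) ->
  V `<=` W -> dec_hull P G V `<=` W.
Proof. by move=> WL Wdec VW; apply: smallest_sub => //; split. Qed.

Lemma sub_dec_hull V : V `<=` dec_hull P G V.
Proof. exact: sub_smallest. Qed.

Lemma dec_hull_L2 V : V `<=` L2 P G -> dec_hull P G V `<=` L2 P G.
Proof. by move=> VL; apply: dec_hull_sub => // f g A ? ? ?; exact: L2_splice. Qed.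

Lemma dec_hull_splice V f g A : dec_hull P G V f -> dec_hull P G V g -> G A ->
  dec_hull P G V (splice A f g).
Proof.
by move=> Vf Vg GA W hW; have [[_ +] _] := hW; apply; [exact: Vf|exact: Vg|].
Qed.

(** A splice takes at each point one of the two given values, so membership in [Phi] spreads to the
    decomposable hull. For an L^2 limit, Markov's inequality shows that staying at a fixed distance
    from all approximants, hence from [Phi], has probability zero. *)
Lemma closed_dec_hull_ae V (Phi : Omega -> set 'rV[R]_d) g : V `<=` L2 P G ->
  (forall w, closed (Phi w)) -> (forall v, V v -> {ae P, forall w, Phi w (v w)}) ->
  closed_dec_hull P G V g -> {ae P, forall w, Phi w (g w)}.
Proof.
move=> VL cPhi VPhi [[mg g2] gap].
have dPhi v : dec_hull P G V v -> L2 P G v /\ {ae P, forall w, Phi w (v w)}.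
  move: v; apply: (dec_hull_sub (W := [set v | L2 P G v /\
    {ae P, forall w, Phi w (v w)}])) => [f []//|f h A [Lf Pf] [Lh Ph] GA|v Vv].
    split; first exact: L2_splice.
    by apply: filterS2 Pf Ph => w Pf Ph; case: (spliceP A f h w) => ->.
  by split; [exact: VL|exact: VPhi].
have far k : P.-negligible [set w | forall y, Phi w y -> k.+1%:R^-1 <= enorm (g w - y)].
  have a0 : 0 < k.+1%:R^-1 :> R by [].
  move: (k.+1%:R^-1) a0 => a a0.
  have /choice[v vP] : forall n : nat, exists v, [/\ L2 P G v,
      {ae P, forall w, Phi w (v w)} & (sqn (fun w => (g w - v w)%R) < (n.+1%:R^-1)%:E)%E].
    move=> n; have [v /dPhi[Lv Pv] gv] := gap n.+1%:R^-1 ltac:(by []).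
    by exists v.
  have mB n : measurable_vec setT (fun w => g w - v n w).
    by have [[mv _] _ _] := vP n; apply: measurable_vecB; exact: (rv_measurable_vec GP).
  pose S := \bigcap_n [set w | a <= enorm (g w - v n w)].
  have mS n : measurable [set w | a <= enorm (g w - v n w)].
    have := measurable_enorm measurableT (mB n) measurableT (measurable_itv `[a, +oo[).
    by rewrite setTI; congr measurable; apply/seteqP; split=> w /=; rewrite in_itv/= andbT.
  have S0 : P S = 0.
    have Sle n : ((a ^+ 2)%:E * P S <= (n.+1%:R^-1)%:E)%E.
      have [_ _ /ltW] := vP n; apply: le_trans.
      apply: le_trans (markov_sq_norm P a0 (mB n)).
      apply: lee_wpmul2l; first by rewrite lee_fin sqr_ge0.
      by apply: le_measure; rewrite ?inE//; [exact: bigcap_measurableType|exact: bigcap_inf].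
    apply/eqP; rewrite eq_le measure_ge0 andbT leNgt; apply/negP => PS.
    have fPS : P S \is a fin_num by rewrite fin_num_measure//; exact: bigcap_measurableType.
    rewrite -(fineK fPS) lte_fin in PS.
    have [n] : exists n : nat, n.+1%:R^-1 < a ^+ 2 * fine (P S).
      by apply: exists_invn_lt; rewrite mulr_gt0// exprn_gt0.
    by have := Sle n; rewrite -(fineK fPS) -EFinM lee_fin leNgt => /negP.
  have NS : P.-negligible S by exists S; split => //; exact: bigcap_measurableType.
  have NV : P.-negligible (\bigcup_n [set w | ~ Phi w (v n w)]).
    by apply: negligible_bigcup => n; have [_ + _] := vP n.
  apply: negligibleS (negligibleU NS NV) => w /= h.
  have [Phiw|] := pselect (forall n, Phi w (v n w)).
    by left => n _; exact: h.
  by move=> /existsNP[n nPhi]; right; exists n.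
apply: negligibleS (negligible_bigcup far) => w /= nPhi.
apply: contrapT => h; apply: nPhi; apply: (closed_enorm _).1 => // e e0.
have [k ke] := exists_invn_lt e0.
apply: contrapT => h2; apply: h; exists k => // y Phiy.
rewrite leNgt; apply/negP => gy; apply: h2; exists y => //; exact: lt_trans gy ke.
Qed.


Section hull_properties.
Variables (V : set (Omega -> 'rV[R]_d)) (VL2 : V `<=` L2 P G).
Local Notation M := (closed_dec_hull P G V).


Lemma sub_closed_dec_hull : V `<=` M.
Proof.
move=> v Vv; split; first exact: VL2.
move=> e e0; exists v; first exact: sub_dec_hull.
by under eq_integral do rewrite subrr enorm0 expr0n/=; rewrite integral0 lte_fin.
Qed.

Lemma closed_dec_hull_closed g : L2 P G g ->
  (forall e : R, 0 < e -> exists2 f, M f & (sqn (fun w => (g w - f w)%R) < e%:E)%E) ->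
  M g.
Proof.
move=> Lg h; split=> // e e0; have e40 : 0 < e / 4 by rewrite divr_gt0.
have [f [Lf /(_ _ e40)[v Vv fv]] gf] := h _ e40.
exists v => //; have Lv := dec_hull_L2 VL2 Vv.
have mv (u : Omega -> 'rV[R]_d) : L2 P G u -> measurable_vec setT u by move=> [/(rv_measurable_vec GP)].
apply: (le_lt_trans (sq_norm_dist P (mv _ Lg) (mv _ Lf) (mv _ Lv))).
have -> : e%:E = (2%:E * (e / 4)%:E + 2%:E * (e / 4)%:E)%E.
  by rewrite -!EFinM -EFinD; congr _%:E; lra.
by apply: lteD; rewrite lte_pmul2l// lte_fin.
Qed.

Lemma closed_dec_hull_splice f g A : M f -> M g -> G A -> M (splice A f g).
Proof.
move=> [Lf fap] [Lg gap] GA; split; first exact: L2_splice.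
move=> e e0; have e20 : 0 < e / 2 by rewrite divr_gt0.
have [u Vu fu] := fap _ e20; have [v Vv gv] := gap _ e20.
exists (splice A u v); first exact: dec_hull_splice.
have mv (h : Omega -> 'rV[R]_d) : L2 P G h -> measurable_vec setT h by move=> [/(rv_measurable_vec GP)].
have Lu := dec_hull_L2 VL2 Vu; have Lv := dec_hull_L2 VL2 Vv.
apply: (@le_lt_trans _ _ (1%:E * sqn (fun w => f w - u w)%R +
                          1%:E * sqn (fun w => g w - v w)%R)%E).
  apply: integral_le_sq_norm => //.
  - by apply: measurable_vecB; exact: mv.
  - by apply: measurable_vecB; exact: mv.
  - by move=> w; rewrite lee_fin sqr_ge0.
  move=> w; rewrite !mul1r -EFinD lee_fin.
  by have [Aw|Aw] := pselect (A w);
    [rewrite !splice_in// lerDl|rewrite !splice_out// lerDr]; rewrite sqr_ge0.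
rewrite !mul1e; have -> : e%:E = ((e / 2)%:E + (e / 2)%:E)%E by rewrite -EFinD -splitr.
by apply: lteD; [exact: fu|exact: gv].
Qed.


End hull_properties.

End decomposable_hull.

(** * Closed decomposable sets as sets of selectors *)

Section hiai_umegaki.
Context {R : realType} {dsp : measure_display} {Omega : measurableType dsp}.
Variable P : probability Omega R.
Context {d : nat}.
Implicit Types (f g : Omega -> 'rV[R]_d).
Variables (G : set (set Omega)) (GP : augmented_sub_sigma_algebra P G).
Variables (V : set (Omega -> 'rV[R]_d)) (VL2 : V `<=` L2 P G) (V0 : V !=set0).
Local Notation M := (closed_dec_hull P G V).
Local Notation sqn := (sq_norm P).

Let ML2 f : M f -> L2 P G f.
Proof. by case. Qed.

Let Mvec f : M f -> measurable_vec setT f.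
Proof. by move=> /ML2[/(rv_measurable_vec GP)]. Qed.

Let L2vec f : L2 P G f -> measurable_vec setT f.
Proof. by move=> [/(rv_measurable_vec GP)]. Qed.

Let G_enorm_lt f g (u : Omega -> 'rV[R]_d) : rv_measurable G f ->
  rv_measurable G g -> rv_measurable G u ->
  G [set w | enorm (f w - g w) < enorm (f w - u w)].
Proof.
move=> /(rv_measurableE GP) mf /(rv_measurableE GP) mg /(rv_measurableE GP) mu.
rewrite -(sub_measurableE GP).
have := measurable_fun_ltr (measurable_enorm measurableT (measurable_vecB mf mg))
  (measurable_enorm measurableT (measurable_vecB mf mu)).
move=> /(_ measurableT [set true] ltac:(by [])); rewrite setTI.
by congr measurable; apply/seteqP; split.
Qed.

Let cst_L2 (c : 'rV[R]_d) : L2 P G (fun=> c).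
Proof.
split; first by apply/(rv_measurableE GP); exact: measurable_vec_cst.
by rewrite integral_cst// lte_mul_pinfty// ?lee_fin ?sqr_ge0// -ge0_fin_numE// fin_num_measure.
Qed.

Let q n : 'rV[R]_d := rat_point n.
Let dist2 n f := sqn (fun w => (f w - q n)%R).

Let dist2_lty n f : M f -> (dist2 n f < +oo)%E.
Proof.
move=> /ML2 Lf; have [] // : L2 P G (fun w => f w + (- q n)).
exact: (L2_add GP Lf (cst_L2 (- q n))).
Qed.

Let inf2 n := ereal_inf [set dist2 n f | f in M].

Let inf2_fin n : inf2 n \is a fin_num.
Proof.
have [v0 Vv0] := V0; have Mv0 := sub_closed_dec_hull VL2 Vv0.
rewrite ge0_fin_numE.
  apply: le_lt_trans (dist2_lty n Mv0); apply: ge_ereal_inf.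
  by exists (dist2 n v0) => //; exists v0.
by apply: le_ereal_inf_tmp => _ [f _ <-]; exact: sq_norm_ge0.
Qed.

(* A sequence of almost minimisers of the distances in L^2 from each
   rational point to [M] is pointwise dense: were [g] in [M] far from the
   sequence on a non-null event where [g] is close to [q n], replacing there a
   minimiser by [g] would beat the infimum. *)
Let dense_family : exists phi : nat -> Omega -> 'rV[R]_d, (forall k, M (phi k)) /\
  forall g, M g -> {ae P, forall w, closure (range (phi^~ w)) (g w)}.
Proof.
have /choice[psi psiP] : forall nj : nat * nat, exists f, M f /\
    (dist2 nj.1 f < inf2 nj.1 + (nj.2.+1%:R^-1)%:E)%E.
  move=> [n j] /=.
  have /ereal_inf_lt[_ [f Mf <-] fe] : (inf2 n < inf2 n + (j.+1%:R^-1)%:E)%E.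
    by rewrite lteDl ?lte_fin ?inf2_fin// invr_gt0.
  by exists f.
pose phi k := psi (odflt (0, 0)%N (unpickle k)).
have psiE nj : psi nj = phi (pickle nj) by rewrite /phi pickleK.
exists phi; split=> [k|g Mg]; first by have [] := psiP (odflt (0, 0)%N (unpickle k)).
have mphi k : measurable_vec setT (phi k) by apply: Mvec; have [] := psiP (odflt (0, 0)%N (unpickle k)).
have mg := Mvec Mg.
suff far l : P.-negligible [set w | forall k, l.+1%:R^-1 <= enorm (g w - phi k w)].
  apply: negligibleS (negligible_bigcup far) => w /= ncl.
  apply: contrapT => h; apply: ncl; apply/closure_enormP => e e0.
  have [l le] := exists_invn_lt e0.
  apply: contrapT => h2; apply: h; exists l => // k.
  rewrite leNgt; apply/negP => gphi; apply: h2; exists (phi k w); first by exists k.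
  exact: lt_trans gphi le.
have e0 : 0 < l.+1%:R^-1 :> R by [].
move: (l.+1%:R^-1) e0 => e e0.
have e30 : 0 < e / 3 by rewrite divr_gt0.
(* On [B n], g is far from the whole sequence but close to the n-th rational point. These events
   cover the far event, and each lies in G, so g may be spliced in on it. *)
pose B n := [set w | forall k, e <= enorm (g w - phi k w)] `&`
  [set w | enorm (g w - q n) < e / 3].
have GB n : G (B n).
  rewrite -(sub_measurableE GP).
  have rvg : measurable_vec (T := g_sigma_algebraType G) setT g.
    by apply/(rv_measurableE GP); case: (ML2 Mg).
  have rvphi k : measurable_vec (T := g_sigma_algebraType G) setT (phi k).
    apply/(rv_measurableE GP).
    by case: (ML2 (proj1 (psiP (odflt (0, 0)%N (unpickle k))))).
  apply: measurableI; last first.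
    rewrite -(setTI (mkset _)).
    exact: (measurable_enorm_lt (T := g_sigma_algebraType G)).
  rewrite (_ : mkset _ = \bigcap_k [set w | e <= enorm (g w - phi k w)]).
    apply: bigcap_measurableType => k _.
    have := measurable_enorm (T := g_sigma_algebraType G) measurableT
       (measurable_vecB rvg (rvphi k)) measurableT (measurable_itv `[e, +oo[).
    by rewrite setTI; congr measurable; apply/seteqP; split=> w /=; rewrite in_itv/= andbT.
  by apply/seteqP; split=> w /= h; [move=> k _; exact: h|move=> k; exact: h].
have GF : G `<=` measurable by case: GP.
suff PB n : P (B n) = 0.
  have NB n : P.-negligible (B n) by exists (B n); split => //; exact: GF.
  apply: negligibleS (negligible_bigcup NB) => w /= h.
  by have [n gn] := dense_rat_point (g w) e30; exists n.
have PBfin : P (B n) \is a fin_num by rewrite fin_num_measure//; exact: GF.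
(* On [B n] an approximate minimiser is at distance at least [e - e / 3] from [q n], while g is at
   distance less than [e / 3]; the squared distances differ by at least [(4 - 1) * e ^+ 2 / 9],
   which is [c]. *)
pose c := e ^+ 2 / 3.
have c0 : 0 < c by rewrite divr_gt0// exprn_gt0.
have ineq j : ((c%:E * P (B n)) <= (j.+1%:R^-1)%:E)%E.
  have [Mpsi psilt] := psiP (n, j); set f := psi (n, j) in Mpsi psilt.
  have Mh : M (splice (B n) g f) by exact: closed_dec_hull_splice.
  have hge : (inf2 n <= dist2 n (splice (B n) g f))%E.
    by apply: ge_ereal_inf; exists (dist2 n (splice (B n) g f)) => //; exists (splice (B n) g f).
  have mh : measurable_vec setT (fun w => splice (B n) g f w - q n).
    by apply: measurable_vecB; [exact: Mvec|exact: measurable_vec_cst].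
  have : (dist2 n (splice (B n) g f) + c%:E * P (B n) <= dist2 n f)%E.
    rewrite -(integral_cst P (GF _ (GB n))) integral_mkcond -ge0_integralD//.
    - apply: ge0_le_integral_nonmeasurable => w _.
        apply: adde_ge0; first by rewrite lee_fin sqr_ge0.
        by apply: erestrict_ge0 => *; rewrite lee_fin ltW.
      rewrite patchE; case: ifPn => [|]; rewrite ?inE ?notin_setE => Bw; last first.
        by rewrite splice_out// adde0.
      rewrite splice_in// -EFinD lee_fin.
      have [/= /(_ (pickle (n, j)))] := Bw; rewrite -psiE -/f => gf gq.
      have := ler_enorm_dist (q n) (g w) (f w); rewrite (enormB (q n)) /c.
      have := enorm_ge0 (g w - q n); move: gf gq.
      move: (enorm _) (enorm _) (enorm _) => a b u gf gq a0 abu; nra.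
    - by move=> w _; rewrite lee_fin sqr_ge0.
    - exact: measurable_sqr_enorm.
    - by move=> w _; apply: erestrict_ge0 => *; rewrite lee_fin ltW.
    - by apply/(measurable_restrictT _ _).1; [exact: GF|exact: measurable_cst].
  move=> h2; have h3 := le_lt_trans h2 psilt.
  have h4 : (inf2 n + c%:E * P (B n) < inf2 n + (j.+1%:R^-1)%:E)%E.
    by apply: le_lt_trans h3; exact: leeD2r.
  by apply: ltW; rewrite lteD2lE in h4.
apply/eqP; rewrite eq_le measure_ge0 andbT leNgt; apply/negP => PB.
rewrite -(fineK PBfin) lte_fin in PB.
have [j] : exists j : nat, j.+1%:R^-1 < c * fine (P (B n)).
  by apply: exists_invn_lt; rewrite mulr_gt0.
by have := ineq j; rewrite -(fineK PBfin) -EFinM lee_fin leNgt => /negP.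
Qed.


(** [u n.+1] is at each point the nearest to g among the first n + 1 members of the family, so it
    stays in M by decomposability. Its distance to g decreases to 0 almost surely, and dominated
    convergence with bound the initial squared distance makes g an L^2 limit of elements of M. *)
Lemma dense_family_selectors (phi : nat -> Omega -> 'rV[R]_d) g :
  (forall k, M (phi k)) -> L2 P G g ->
  {ae P, forall w, closure (range (phi^~ w)) (g w)} -> M g.
Proof.
move=> Mphi Lg gcl.
pose u := fix u n := if n is n'.+1 then
  splice [set w | enorm (g w - phi n' w) < enorm (g w - u n' w)] (phi n') (u n')
  else phi 0%N.
have rvu f : M f -> rv_measurable G f by move=> /ML2[].
have Mu n : M (u n).
  elim: n => [|n IH] /=; first exact: Mphi.
  apply: closed_dec_hull_splice => //.
  by apply: G_enorm_lt; [case: Lg|exact: rvu|exact: rvu].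
have u_le n w : enorm (g w - u n.+1 w) <= enorm (g w - u n w).
  rewrite /=; set A := mkset _; have [Aw|Aw] := pselect (A w).
    by rewrite splice_in//; exact: ltW.
  by rewrite splice_out.
have u_le_phi n w : enorm (g w - u n.+1 w) <= enorm (g w - phi n w).
  rewrite /=; set A := mkset _; have [Aw|Aw] := pselect (A w).
    by rewrite splice_in.
  by rewrite splice_out// leNgt; apply/negP.
have u_mono n k w : enorm (g w - u (n + k)%N w) <= enorm (g w - u n w).
  by elim: k => [|k IH]; rewrite ?addn0// addnS; exact: le_trans IH.
have mB n : measurable_vec setT (fun w => g w - u n w).
  by apply: measurable_vecB; [exact: L2vec|exact: Mvec].
have [] := @dominated_convergence _ _ _ P setT measurableT
  (fun n w => (enorm (g w - u n w) ^+ 2)%:E) (cst 0%E)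
  (fun w => (enorm (g w - u 0%N w) ^+ 2)%:E).
- by move=> n; exact: measurable_sqr_enorm.
- exact: measurable_cst.
- apply: filterS gcl => w gcl _ /=.
  apply/fine_cvgP; split; first by apply: nearW.
  apply/cvgrPdist_lt => e e0 /=.
  have se0 : 0 < Num.sqrt e by rewrite sqrtr_gt0.
  have [_ [k _ <-] gk] := (closure_enormP _ _).1 gcl _ se0.
  exists k.+1 => // n /= kn; rewrite sub0r normrN ger0_norm ?sqr_ge0//.
  rewrite -(sqr_sqrtr (ltW e0)) ltr_pXn2r ?nnegrE ?enorm_ge0 ?sqrtr_ge0//.
  apply: le_lt_trans gk; apply: le_trans (u_le_phi k w).
  by rewrite -(subnKC kn); exact: u_mono.
- apply/integrableP; split; first exact: measurable_sqr_enorm.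
  apply: le_lt_trans (_ : sqn (fun w => (g w + -1 *: u 0%N w)%R) < +oo)%E.
    apply: ge0_le_integral_nonmeasurable => w _ //.
    by rewrite scaleN1r gee0_abs// lee_fin sqr_ge0.
  have Lu := ML2 (Mu 0%N).
  have [] // : L2 P G (fun w => g w + -1 *: u 0%N w).
  apply: (L2_add GP) => //; split.
    apply/(rv_measurableE GP); apply: measurable_vecZ; first exact: measurable_cst.
    by apply/(rv_measurableE GP); case: Lu.
  by under eq_integral do rewrite scaleN1r enormN; case: Lu.
- apply: aeW => w n _; rewrite gee0_abs ?lee_fin ?sqr_ge0//.
  by rewrite ler_pXn2r ?nnegrE ?enorm_ge0//; have := u_mono 0%N n w.
move=> _ _; rewrite integral_cst// mul0e => /fine_cvgP[_ /cvgrPdist_lt cv0].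
apply: (closed_dec_hull_closed GP VL2) => // e e0.
have [n _ /(_ _ (leqnn n)) /=] := cv0 _ e0.
rewrite sub0r normrN => ne; exists (u n) => //.
have Lgu : (sqn (fun w => (g w - u n w)%R) < +oo)%E.
  apply: (sq_norm_lty (a := 2) (f := g) (g := u n)) => //.
  - exact: L2vec.
  - exact: Mvec.
  - by move=> w; rewrite lee_fin sqr_ge0.
  - by move=> w; rewrite -EFinD lee_fin (le_trans (sqr_enormD _ _))// enormN.
  - by case: Lg.
  - by case: (ML2 (Mu n)).
have fin : sqn (fun w => (g w - u n w)%R) \is a fin_num.
  by rewrite ge0_fin_numE//; exact: sq_norm_ge0.
rewrite -(fineK fin) lte_fin; apply: le_lt_trans ne.
exact: ler_norm.
Qed.

(** The closure meets E iff, for some m, points of the sequence come arbitrarily close to the part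
    of E in the ball of radius m. Compactness of that part turns approximate hits into an actual
    common point. *)
Lemma closed_random_set_closure (phi : nat -> Omega -> 'rV[R]_d) :
  (forall k, rv_measurable G (phi k)) ->
  closed_random_set G (fun w => closure (range (phi^~ w))).
Proof.
move=> mphi; split=> [w|E cE]; first exact: closed_closure.
pose K m := E `&` [set y : 'rV[R]_d | enorm (0 - y) <= m%:R].
pose U m l := [set x | exists2 a, K m a & enorm (x - a) < l.+1%:R^-1].
have oU m l : open (U m l).
  rewrite openE => x [a Ka xa]; apply/nbhs_enormP.
  exists (l.+1%:R^-1 - enorm (x - a)); first by rewrite subr_gt0.
  move=> y xy; exists a => //; apply: (le_lt_trans (ler_enorm_dist x _ _)).
  by rewrite (enormB y) -ltrBrDr.
rewrite (_ : mkset _ = \bigcup_m \bigcap_l \bigcup_k [set w | U m l (phi k w)]).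
  rewrite -(sub_measurableE GP); apply: bigcup_measurable => m _.
  apply: bigcap_measurableType => l _; apply: bigcup_measurable => k _.
  apply: (measurable_vec_preimage_open (T := g_sigma_algebraType G)) => //.
  exact/(rv_measurableE GP).
apply/seteqP; split=> w.
  move=> [x [/closure_enormP clx Ex]].
  exists (Num.truncn (enorm x)).+1 => // l _.
  have [_ [k _ <-] xk] := clx l.+1%:R^-1 ltac:(by []).
  exists k => //; exists x; last by rewrite enormB.
  split => //=; rewrite sub0r enormN ltW//.
  exact: truncnS_gt.
move=> [m _ h].
have /choice[a aP] : forall l, exists a, K m a /\
    exists k, enorm (phi k w - a) < l.+1%:R^-1.
  by move=> l; have [k _ [a Ka ka]] := h l I; exists a; split => //; exists k.
have cK : compact (K m).
  by rewrite /K setIC; apply: compact_closedI cE; exact: compact_eball.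
have [p [Ep _] pP] := compact_seq_cluster cK (fun l => (aP l).1).
exists p; split => //; apply/closure_enormP => e e0.
have e20 : 0 < e / 2 by rewrite divr_gt0.
have [N Ne] := exists_invn_lt e20.
have [l Nl pl] := pP _ N e20; have [_ [k kl]] := aP l.
exists (phi k w); first by exists k.
apply: (le_lt_trans (ler_enorm_dist (a l) _ _)); rewrite (enormB (a l)).
have : l.+1%:R^-1 <= N.+1%:R^-1 :> R by rewrite lef_pV2 ?posrE// ler_nat.
move: pl kl Ne; move: (enorm _) (enorm _) (l.+1%:R^-1) (N.+1%:R^-1) => *; lra.
Qed.

Lemma closed_random_set_ae (X Y : Omega -> set 'rV[R]_d) :
  closed_random_set G X -> (forall w, closed (Y w)) -> {ae P, forall w, X w = Y w} ->
  closed_random_set G Y.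
Proof.
move=> [_ mX] cY XY; split => // E /mX; rewrite -(sub_measurableE GP) => mXE.
have mN (A : set Omega) : A `<=` [set w | X w <> Y w] ->
    measurable (A : set (g_sigma_algebraType G)).
  move=> AN; rewrite (sub_measurableE GP); case: GP => _ _; apply.
  exact: negligibleS XY.
rewrite (_ : mkset _ = ([set w | X w `&` E !=set0] `\` [set w | X w <> Y w])
   `|` [set w | Y w `&` E !=set0 /\ X w <> Y w]).
  apply: measurableU; last by apply: mN => w [].
  by apply: measurableD => //; exact: mN.
apply/seteqP; split=> w /=.
  move=> YE; have [XYw|XYw] := pselect (X w = Y w); [left|by right].
  by rewrite XYw; split => //; apply.
by move=> [[XE /contrapT <-//]|[]//].
Qed.

Theorem hiai_umegaki : exists phi : nat -> Omega -> 'rV[R]_d,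
  let X := fun w => closure (range (phi^~ w)) in
  [/\ forall k, M (phi k), closed_random_set G X & L2_selectors P G X = M].
Proof.
have [phi [Mphi phiM]] := dense_family; exists phi; split => //.
  by apply: closed_random_set_closure => k; case: (ML2 (Mphi k)).
apply/seteqP; split=> g; first by move=> [Lg gX]; exact: dense_family_selectors gX.
by move=> Mg; split; [exact: ML2|exact: phiM].
Qed.

End hiai_umegaki.

(** * Recovering a random set from its selectors *)

Section selectors_determine.
Context {R : realType} {dsp : measure_display} {Omega : measurableType dsp}.
Variable P : probability Omega R.
Context {d : nat}.
Variables (G : set (set Omega)) (GP : augmented_sub_sigma_algebra P G).

(** On the event that X meets a given small rational ball, a measurable selection inside the ball
    exists. It is bounded there, so splicing it with [g0] elsewhere gives a square-integrable
    selector, and [Phi] must meet the ball as well. Countably many balls suffice, since [Phi] is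
    closed. *)
Lemma ae_sub_of_selectors (X Phi : Omega -> set 'rV[R]_d) g0 :
  closed_random_set G X -> (forall w, closed (Phi w)) -> L2_selectors P G X g0 ->
  (forall g, L2_selectors P G X g -> {ae P, forall w, Phi w (g w)}) ->
  {ae P, forall w, X w `<=` Phi w}.
Proof.
move=> [cX mX] cPhi [[mg0 g02] Xg0] XPhi.
pose E (nk : nat * nat) : set 'rV[R]_d :=
  [set y | enorm (rat_point nk.1 - y) <= nk.2.+1%:R^-1].
have cE nk : closed (E nk) by exact: closed_eball.
have h nk : {ae P, forall w, X w `&` E nk !=set0 -> Phi w `&` E nk !=set0}.
  have [g [mg gX]] := @measurable_selection_ball _ (g_sigma_algebraType G) R d X (E nk)
    cX ltac:(by move=> F /mX; rewrite (sub_measurableE GP)) (cE nk).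
  have GA : G [set w | X w `&` E nk !=set0] by exact: mX.
  set A := [set w | _] in GA.
  have rvg : rv_measurable G (splice A g g0).
    by apply: (rv_measurable_splice GP) => //; exact/(rv_measurableE GP).
  have sel : L2_selectors P G X (splice A g g0).
    split; last first.
      apply: filterS Xg0 => w Xg0; have [Aw|Aw] := pselect (A w).
        by rewrite splice_in//; case: (gX w Aw).
      by rewrite splice_out.
    split => //.
    pose r := enorm (rat_point nk.1 : 'rV[R]_d) + nk.2.+1%:R^-1.
    apply: (@le_lt_trans _ _ (\int[P]_w ((r ^+ 2)%:E + (enorm (g0 w) ^+ 2)%:E))%E).
      apply: ge0_le_integral_nonmeasurable => w _; first by rewrite lee_fin sqr_ge0.
      rewrite -EFinD lee_fin; have [Aw|Aw] := pselect (A w); last first.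
        by rewrite splice_out// lerDr sqr_ge0.
      rewrite splice_in//; have [_ /= Egw] := gX w Aw.
      apply: ler_wpDr; first exact: sqr_ge0.
      rewrite ler_pXn2r ?nnegrE ?enorm_ge0// ?addr_ge0 ?enorm_ge0//.
      have := ler_enormD (g w - rat_point nk.1) (rat_point nk.1).
      by rewrite subrK /r; move: Egw; rewrite /E /= (enormB (g w));
        move: (enorm _) (enorm _) (enorm _) (_^-1) => *; lra.
    rewrite ge0_integralD//; first last.
    - by apply: measurable_sqr_enorm; exact: (rv_measurable_vec GP).
    - by move=> w _; rewrite lee_fin sqr_ge0.
    - by move=> w _; rewrite lee_fin sqr_ge0.
    apply: lte_add_pinfty => //.
    by rewrite integral_cst// lte_mul_pinfty// ?lee_fin ?sqr_ge0// -ge0_fin_numE// fin_num_measure.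
  apply: filterS (XPhi _ sel) => w Phiw Aw; exists (g w).
  by move: Phiw; rewrite splice_in// => Phiw; split => //; case: (gX w Aw).
have hn := ae_foralln (fun n => ae_foralln (fun k => h (n, k))).
apply: filterS hn => w hw x Xx.
apply: (closed_enorm _).1 => // e e0; have e20 : 0 < e / 2 by rewrite divr_gt0.
have [k ke] := exists_invn_lt e20.
have [n nk] := dense_rat_point x (ltac:(by []) : 0 < k.+1%:R^-1 :> R).
have [|y [Phiy /= Ey]] := hw n k.
  by exists x; split => //; rewrite /E /= enormB ltW.
exists y => //; apply: (le_lt_trans (ler_enorm_dist (rat_point n) _ _)).
move: ke nk Ey; rewrite /E /=; move: (enorm _) (enorm _) (k.+1%:R^-1) => *; lra.
Qed.
End selectors_determine.

(** * Integrals of processes along paths *)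

Section measure_on_sub_sigma_algebra.
Context {R : realType} {dsp : measure_display} {Omega : measurableType dsp}.
Variables (P : probability Omega R).
Variables (G : set (set Omega)) (GP : augmented_sub_sigma_algebra P G).
Local Notation OG := (g_sigma_algebraType G).

Let GF (A : set OG) : measurable A -> measurable (A : set Omega).
Proof. by rewrite (sub_measurableE GP); case: GP => _ + _; apply. Qed.

Let measurable_id : measurable_fun setT (idfun : Omega -> OG).
Proof. by move=> _ Y mY; rewrite setTI; exact: GF. Qed.

Lemma measurable_fun_sub d' (T' : measurableType d') (f : OG -> T') :
  measurable_fun setT f -> measurable_fun setT (f : Omega -> T').
Proof. by move=> mf _ Y mY; have := mf measurableT Y mY; rewrite !setTI; exact: GF. Qed.

(** The proof [mB] is an argument so that the measure structure, whose additivity relies on it, can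
    be attached to [sub_measure mB]. *)
Definition sub_measure (B : set Omega) (mB : measurable B) (A : set OG) : \bar R :=
  P (A `&` B).

Section sub_measure_instance.
Variables (B : set Omega) (mB : measurable B).

Let sub_measure0 : sub_measure mB set0 = 0%E.
Proof. by rewrite /sub_measure set0I measure0. Qed.

Let sub_measure_ge0 A : (0 <= sub_measure mB A)%E.
Proof. exact: measure_ge0. Qed.

Let sub_measure_sigma_additive : semi_sigma_additive (sub_measure mB).
Proof.
move=> F mF tF mUF; rewrite /sub_measure setI_bigcupl.
apply: measure_semi_sigma_additive.
- by move=> n; apply: measurableI => //; exact: GF.
- exact: trivIset_setIr.
- by apply: bigcup_measurable => n _; apply: measurableI => //; exact: GF.
Qed.

HB.instance Definition _ := isMeasure.Build _ _ _ (sub_measure mB)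
  sub_measure0 sub_measure_ge0 sub_measure_sigma_additive.

Let sub_measure_fin : fin_num_fun (sub_measure mB).
Proof. by move=> A mA; apply: fin_num_measure; apply: measurableI => //; exact: GF. Qed.

HB.instance Definition _ := Measure_isFinite.Build _ _ _ (sub_measure mB) sub_measure_fin.

Lemma ge0_integral_sub_measure (D : set OG) (f : OG -> \bar R) : measurable D ->
  (forall w, (0 <= f w)%E) ->
  measurable_fun setT f -> (\int[sub_measure mB]_(w in D) f w = \int[P]_(w in D `&` B) f w)%E.
Proof.
move=> mD f0 mf; have mD' := GF mD.
transitivity (\int[pushforward (mrestr P mB) (idfun : Omega -> OG)]_(w in D) f w)%E.
  by apply: eq_measure_integral.
rewrite ge0_integral_pushforward//; last exact: measurable_funTS.
have mf' := measurable_fun_sub mf.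
rewrite (ge0_negligible_integral (N := ~` B))//.
- rewrite /preimage /= setDE setCK.
  apply: eq_measure_integral => A mA AB; rewrite /= /mrestr.
  by rewrite setIidl// => w /AB[].
- exact: measurableC.
- exact: measurable_funTS.
- by rewrite /= /mrestr setICl measure0.
Qed.

End sub_measure_instance.

(** [pi] is a version of P(B | G), the Radon-Nikodym derivative of A |-> P(A and B) with respect to
    P on G. It is at most 1 almost surely and is capped at 1 to make the bounds hold everywhere. *)
Lemma conditional_probability (B : set Omega) : measurable B -> exists pi : OG -> R,
  [/\ measurable_fun setT pi, forall w, 0 <= pi w <= 1 &
    forall f : OG -> \bar R, (forall w, (0 <= f w)%E) -> measurable_fun setT f ->
      (\int[P]_w (f w * (pi w)%:E) = \int[P]_(w in B) f w)%E].
Proof.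
move=> mB; pose PG := sub_measure (@measurableT _ Omega); pose nu := sub_measure mB.
have PGE A : PG A = P A by rewrite /PG /sub_measure setIT.
have nuPG : nu `<< PG.
  apply/null_content_dominatesP => A mA PA0.
  have {}PA0 : P A = 0%E by rewrite -PGE; exact: PA0.
  apply/eqP; rewrite eq_le measure_ge0 andbT -PA0.
  by apply: le_measure; rewrite ?inE//; [apply: measurableI => //|]; exact: GF.
pose h := Radon_Nikodym_SigmaFinite.f nu PG.
have h0 w : (0 <= h w)%E by exact: Radon_Nikodym_SigmaFinite.f_ge0.
have hfin w : h w \is a fin_num by exact: Radon_Nikodym_SigmaFinite.f_fin_num.
have mh : measurable_fun setT h.
  exact: measurable_int (Radon_Nikodym_SigmaFinite.f_integrable nuPG).
have PGint (D : set OG) (f : OG -> \bar R) : measurable D -> (forall w, (0 <= f w)%E) ->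
    measurable_fun setT f -> (\int[PG]_(w in D) f w = \int[P]_(w in D) f w)%E.
  by move=> mD f0 mf; rewrite ge0_integral_sub_measure// setIT.
have hint (f : OG -> \bar R) : (forall w, (0 <= f w)%E) -> measurable_fun setT f ->
    (\int[P]_w (f w * h w) = \int[P]_(w in B) f w)%E.
  move=> f0 mf; rewrite -(PGint _ (fun w => f w * h w)%E)//; first last.
  - exact: emeasurable_funM.
  - by move=> w; exact: mule_ge0.
  rewrite Radon_Nikodym_SigmaFinite.change_of_variables//.
  by rewrite ge0_integral_sub_measure// setTI.
have h_le1 : {ae P, forall w, (h w <= 1)%E}.
  (* If the derivative is at least 1 + 1/(n+1) on A, then integrating over A gives (1 + 1/(n+1))
     P(A) <= P(A and B) <= P(A), so P(A) = 0. *)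
  have neg n : P.-negligible [set w | (1 + (n.+1%:R^-1)%:E <= h w)%E].
    set A := mkset _.
    have mA : measurable (A : set OG) by rewrite -(setTI A); exact: emeasurable_fun_c_infty.
    have mA' := GF mA; exists A; split => //.
    have Afin : P A \is a fin_num by exact: fin_num_measure.
    have : ((1 + (n.+1%:R^-1)%:E) * P A <= P A)%E.
      rewrite -[leLHS]integral_cst// (@le_trans _ _ (\int[P]_(w in A) h w)%E)//.
        apply: ge0_le_integral_nonmeasurable => w Aw; last exact: Aw.
        by rewrite /= -EFinD lee_fin addr_ge0.
      rewrite -PGint// -Radon_Nikodym_SigmaFinite.f_integral//.
      by apply: le_measure; rewrite ?inE//; exact: measurableI.
    rewrite -(fineK Afin) -EFinD -EFinM lee_fin => h1.
    have : 0 <= fine (P A) by rewrite fine_ge0.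
    have n0 : 0 < n.+1%:R^-1 :> R by [].
    move: h1 n0; move: (n.+1%:R^-1) (fine _) => a b h1 a0 b0.
    suff -> : b = 0 by [].
    by apply/eqP; rewrite eq_le b0 andbT; nra.
  apply: negligibleS (negligible_bigcup neg) => w /= /negP; rewrite -ltNge.
  rewrite -(fineK (hfin w)) lte_fin -subr_gt0 => h1.
  have [n nh] := exists_invn_lt h1; exists n => //=.
  by rewrite -(fineK (hfin w)) -EFinD lee_fin -lerBrDl ltW.
exists (fun w => Num.min (fine (h w)) 1); split=> [|w|f f0 mf].
- apply: measurable_minr => //.
  by apply: measurableT_comp mh; exact: fine_measurable.
- by rewrite ge_min lexx orbT le_min ler01 fine_ge0.
rewrite -hint//; apply: ge0_ae_eq_integral => //.
- apply: emeasurable_funM; first exact: measurable_fun_sub.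
  apply/measurable_EFinP; apply: measurable_fun_sub; apply: measurable_minr => //.
  by apply: measurableT_comp mh; exact: fine_measurable.
- by apply: emeasurable_funM; exact: measurable_fun_sub.
- by move=> w _; rewrite mule_ge0// lee_fin le_min ler01 fine_ge0.
- by move=> w _; rewrite mule_ge0.
have [N [mN N0 hN]] := h_le1; exists N; split => // w /= nh.
apply: hN => /= hw1; apply: nh => _; congr (_ * _)%E.
by rewrite min_l ?fineK// -lee_fin fineK.
Qed.

End measure_on_sub_sigma_algebra.

(** * Tonelli on time x Omega and adaptedness of path integrals *)

Section horizon_integrals.
Context {R : realType} {dsp : measure_display} {Omega : measurableType dsp}.
Variables (P : probability Omega R) (T : R).
Local Notation leb := (@lebesgue_measure R).

Definition times : set (measurableTypeR R) := `[0, T]%classic.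
Definition horizon : set (measurableTypeR R * Omega) := times `*` setT.

Lemma measurable_times : measurable times.
Proof. exact: measurable_itv. Qed.

Lemma measurable_horizon : measurable horizon.
Proof. by apply: measurableX => //; exact: measurable_times. Qed.

Lemma horizonE s w : (((s, w) : measurableTypeR R * Omega) \in horizon) = (s \in times).
Proof.
by apply/idP/idP => /set_mem h; apply/mem_set; [case: h|split].
Qed.

Lemma patch_horizon (k : measurableTypeR R * Omega -> \bar R) s w :
  (k \_ horizon) (s, w) = ((fun s => k (s, w)) \_ times) s.
Proof. by rewrite !patchE horizonE. Qed.

Lemma measurable_path d' (T' : sigmaRingType d') (k : measurableTypeR R * Omega -> T') w :
  measurable_fun horizon k -> measurable_fun times (fun s => k (s, w)).
Proof.
move=> mk.
have mpair : measurable_fun times (fun s : measurableTypeR R => (s, w)).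
  by apply: measurable_funTS; exact: pair2_measurable.
apply: (measurable_comp measurable_horizon _ mk mpair).
by move=> _ [s sT <-].
Qed.

Section tonelli.
Variable k : measurableTypeR R * Omega -> \bar R.
Hypotheses (mk : measurable_fun horizon k) (k0 : forall z, horizon z -> (0 <= k z)%E).

Let k' := k \_ horizon.

Let mk' : measurable_fun setT k'.
Proof. by apply/(measurable_restrictT _ _).1 => //; exact: measurable_horizon. Qed.

Let k'0 z : (0 <= k' z)%E.
Proof. exact: erestrict_ge0. Qed.

Let GE w : fubini_G leb k' w = (\int[leb]_(s in times) k (s, w))%E.
Proof.
rewrite /fubini_G [RHS]integral_mkcond; apply: eq_integral => s _.
exact: patch_horizon.
Qed.

Let FE s : fubini_F P k' s = ((fun s => \int[P]_w k (s, w)) \_ times)%E s.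
Proof.
rewrite /fubini_F patchE; case: ifPn => sT.
  by apply: eq_integral => w _; rewrite /k' patch_horizon patchE sT.
by apply: integral0_eq => w _; rewrite /k' patch_horizon patchE (negbTE sT).
Qed.

Lemma tonelli_path :
  (\int[leb \x P]_(z in horizon) k z = \int[P]_w \int[leb]_(s in times) k (s, w))%E.
Proof.
by rewrite integral_mkcond fubini_tonelli2//; apply: eq_integral => w _; exact: GE.
Qed.

Lemma tonelli_time :
  (\int[leb \x P]_(z in horizon) k z = \int[leb]_(s in times) \int[P]_w k (s, w))%E.
Proof.
rewrite integral_mkcond fubini_tonelli1// [RHS]integral_mkcond.
by apply: eq_integral => s _; exact: FE.
Qed.

Lemma measurable_path_integral :
  measurable_fun setT (fun w => \int[leb]_(s in times) k (s, w))%E.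
Proof.
rewrite (_ : (fun w => _) = fubini_G leb k'); last by apply/funext => w; rewrite GE.
exact: measurable_fun_fubini_tonelli_G.
Qed.

End tonelli.

Section integrable.
Variable k : measurableTypeR R * Omega -> R.
Hypotheses (ik : (leb \x P)%E.-integrable horizon (EFin \o k)).

Lemma ae_integrable_path :
  {ae P, forall w, leb.-integrable times (EFin \o (fun s => k (s, w)))}.
Proof.
have := (integrable_mkcond _ measurable_horizon).1 ik.
move=> /ae_integrable2; apply: filterS => w iw.
apply/(integrable_mkcond _ measurable_times).
by apply: eq_integrable iw => // s _; rewrite patch_horizon.
Qed.

End integrable.

Lemma ae_horizon_path (Q : measurableTypeR R * Omega -> Prop) :
  {ae (leb \x P)%E, forall z, horizon z -> Q z} ->
  {ae P, forall w, {ae leb, forall s, times s -> Q (s, w)}}.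
Proof.
move=> [N [mN N0 QN]].
have : (\int[P]_w leb (ysection N w) = 0)%E.
  transitivity (\int[leb \x P]_z (\1_N z)%:E)%E; last first.
    by rewrite integral_indic// setIT.
  rewrite fubini_tonelli2//; last first.
    by apply/measurable_EFinP; exact: measurable_indic.
  by rewrite (_ : fubini_G _ _ = leb \o ysection N) ?indic_fubini_tonelli_GE.
have mG : measurable_fun setT (leb \o ysection N) by exact: measurable_fun_ysection.
under eq_integral do rewrite -[leb _]gee0_abs ?measure_ge0//.
move=> /(ae_eq_integral_abs _ measurableT mG); apply: filterS => w /(_ I) /= w0.
exists (ysection N w); split => //; first exact: measurable_ysection.
by move=> s /= /not_implyP[sT nQ]; rewrite /ysection/= inE; apply: QN => /= /(_ (conj sT I)).
Qed.

(** Passes from statements valid almost surely at each fixed time to the product measure. The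
    measurability of N is essential: the null sections may depend on time in an arbitrary way. *)
Lemma negligible_horizon (N : set (measurableTypeR R * Omega)) : measurable N ->
  (forall s, times s -> P.-negligible (xsection N s)) -> N `<=` horizon ->
  (leb \x P)%E.-negligible N.
Proof.
move=> mN Ns NH; exists N; split => //; rewrite /product_measure1.
apply: integral0_eq => s _ /=.
have [sT|sT] := pselect (times s).
  by apply/negligibleP; [exact: measurable_xsection|exact: Ns].
rewrite (_ : xsection N s = set0) ?measure0// -subset0 => w.
by rewrite /xsection /= inE => /NH[].
Qed.

Lemma horizon_finite : ((leb \x P)%E horizon < +oo)%E.
Proof.
have tf : (leb times \is a fin_num)%E.
  rewrite ge0_fin_numE//.
  have -> : leb times = lebesgue_measure (`[0, T]%classic : set R) by [].
  by rewrite lebesgue_measure_itv/=; case: ifP => _; rewrite ?ltry// -EFinB ltry.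
have pf : (P setT \is a fin_num)%E by rewrite fin_num_measure.
rewrite product_measure1E//; last exact: measurable_times.
rewrite -ge0_fin_numE; first exact: fin_numM.
by apply: mule_ge0.
Qed.

Lemma integrable_of_sqr (k : measurableTypeR R * Omega -> R) :
  measurable_fun horizon k ->
  (\int[leb \x P]_(z in horizon) ((k z) ^+ 2)%:E < +oo)%E ->
  (leb \x P)%E.-integrable horizon (EFin \o k).
Proof.
move=> mk k2; apply/integrableP; split; first exact/measurable_EFinP.
apply: (@le_lt_trans _ _ (\int[leb \x P]_(z in horizon) (1%:E + ((k z) ^+ 2)%:E))%E).
  apply: ge0_le_integral_nonmeasurable => z _; first by [].
  by rewrite /= -EFinD lee_fin; have := sqr_ge0 (`|k z| - 1);
     rewrite -(real_normK (num_real (k z))); nra.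
rewrite ge0_integralD//; first last.
- by apply/measurable_EFinP; apply: measurable_funX.
- by move=> z _; rewrite lee_fin sqr_ge0.
- exact: measurable_horizon.
apply: lte_add_pinfty => //.
rewrite integral_cst; last exact: measurable_horizon.
by rewrite mul1e; exact: horizon_finite.
Qed.


Section adapted.
Variables (G : set (set Omega)) (GP : augmented_sub_sigma_algebra P G).
Local Notation OG := (g_sigma_algebraType G).

Definition path_int (k : measurableTypeR R * Omega -> R) (w : Omega) : R :=
  Rintegral leb times (fun s => k (s, w)).

Lemma measurable_ge0_path_int (k : measurableTypeR R * Omega -> R) :
  measurable_fun horizon k -> (forall z, 0 <= k z) ->
  measurable_fun setT (path_int k).
Proof.
move=> mk k0; rewrite /path_int /Rintegral.
apply: measurableT_comp; first exact: fine_measurable.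
by apply: (measurable_path_integral (k := EFin \o k)) => //; [exact/measurable_EFinP|
  move=> z _; rewrite lee_fin].
Qed.

(* With [B = {I > a}] and [pi = P(B | G)], adaptedness yields
   [E[(I - a) 1_B] = E[(I - a) pi]], while [(I - a)(1_B - pi) >= 0]; hence
   [pi = 1] a.s. where [I > a] and [pi = 0] a.s. where [I < a]. *)
Lemma adapted_level_set (k : measurableTypeR R * Omega -> R) (a : R) :
  (leb \x P)%E.-integrable horizon (EFin \o k) -> (forall z, 0 <= k z) ->
  (forall s, times s -> measurable_fun setT ((fun w => k (s, w)) : OG -> R)) ->
  exists A, [/\ G A, {ae P, forall w, a < path_int k w -> A w} &
                     {ae P, forall w, A w -> a <= path_int k w}].
Proof.
move=> ik k0 ak; set I := path_int k.
have I0 w : 0 <= I w by apply: Rintegral_ge0 => s _; exact: k0.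
have [a0|a0] := ltP a 0.
  exists setT; split; [by rewrite -(sub_measurableE GP)|exact: aeW|].
  by apply: aeW => w _; rewrite (le_trans (ltW a0)).
have mk : measurable_fun horizon k by apply/measurable_EFinP; exact: measurable_int ik.
have mI : measurable_fun setT I by exact: measurable_ge0_path_int.
pose B := [set w | a < I w].
have mB : measurable B.
  have := mI measurableT _ (measurable_itv `]a, +oo[); rewrite setTI.
  by congr measurable; apply/seteqP; split=> w /=; rewrite in_itv/= andbT.
have [pi [mpi pi01 piP]] := conditional_probability GP mB.
have mpiF : measurable_fun setT (pi : Omega -> R) by exact: (measurable_fun_sub GP).
have aeI : {ae P, forall w, (\int[leb]_(s in times) (k (s, w))%:E = (I w)%:E)%E}.
  apply: filterS (ae_integrable_path ik) => w iw.
  by rewrite /I /path_int /Rintegral fineK//; apply: integrable_fin_num iw; exact: measurable_times.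
have weight (q : Omega -> R) : measurable_fun setT q -> (forall w, 0 <= q w <= 1) ->
    (\int[P]_w (I w * q w)%:E =
     \int[leb]_(s in times) \int[P]_w ((k (s, w))%:E * (q w)%:E))%E.
  move=> mq q01.
  have q0 w : 0 <= q w by case/andP: (q01 w).
  have mkq : measurable_fun horizon (fun z => ((k z)%:E * (q z.2)%:E)%E).
    apply: emeasurable_funM; first exact/measurable_EFinP.
    apply/measurable_EFinP; apply: measurable_funTS.
    exact: measurableT_comp mq measurable_snd.
  rewrite -(tonelli_time mkq); last by move=> z _; rewrite -EFinM lee_fin mulr_ge0.
  rewrite tonelli_path//; last by move=> z _; rewrite -EFinM lee_fin mulr_ge0.
  apply: ge0_ae_eq_integral => //.
  - by apply/measurable_EFinP; exact: measurable_funM.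
  - apply: (measurable_path_integral mkq) => z _.
    by rewrite -EFinM lee_fin mulr_ge0.
  - by move=> w _; rewrite lee_fin mulr_ge0.
  - by move=> w _; apply: integral_ge0 => s _; rewrite -EFinM lee_fin mulr_ge0.
  have [N [mN N0 sub]] := aeI; exists N; split => // w /= nh; apply: sub => /= Iw.
  apply: nh => _; rewrite EFinM -Iw.
  under [RHS]eq_integral do rewrite muleC.
  rewrite ge0_integralZl//; first by rewrite muleC.
  - exact: measurable_times.
  - by apply/measurable_EFinP; exact: measurable_path.
  - by move=> s _; rewrite lee_fin.
  - by rewrite lee_fin.
(* Adaptedness enters here. After Tonelli the time is fixed, [k (s, w)] is G-measurable in w, and
   conditioning exchanges the indicator of B with [pi]; nothing is assumed on [I] relative to G. *)
have EB : (\int[P]_w (I w * pi w)%:E = \int[P]_w (I w * \1_B w)%:E)%E.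
  rewrite !weight//; last first.
    by move=> w; rewrite indicE; case: (_ \in _); rewrite /= ?ler01 ?lexx.
  apply: eq_integral => s; rewrite inE => sT; rewrite piP//; first last.
  - by apply/measurable_EFinP; exact: ak.
  - by move=> w; rewrite lee_fin.
  rewrite integral_mkcond; apply: eq_integral => w _.
  by rewrite patchE indicE; case: ifP => _; rewrite ?mule1 ?mule0.
have E1 : (\int[P]_w (pi w)%:E = \int[P]_w (\1_B w)%:E)%E.
  have := piP (cst 1%E) ltac:(by []) ltac:(exact: measurable_cst).
  under eq_integral do rewrite mul1e.
  move=> ->; rewrite integral_cst// mul1e integral_indic// setIT //.
have mB1 : measurable_fun setT (\1_B : Omega -> R) by exact: measurable_indic.
have mEpi : measurable_fun setT (fun w => (pi w)%:E : \bar R) by exact/measurable_EFinP.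
have mEB1 : measurable_fun setT (fun w => (\1_B w)%:E : \bar R) by exact/measurable_EFinP.
have pi0 w : 0 <= pi w by case/andP: (pi01 w).
have B0 w : 0 <= \1_B w :> R by rewrite indicE.
have finI : (\int[P]_w (I w)%:E < +oo)%E.
  have /integrableP[_] := ik; apply: le_lt_trans.
  apply: (@le_trans _ _ (\int[leb \x P]_(z in horizon) (k z)%:E)%E); last first.
    by apply: ge0_le_integral_nonmeasurable => z _;
      [rewrite lee_fin|rewrite /= lee_fin ler_norm].
  rewrite tonelli_path//; last 2 first.
  - exact/measurable_EFinP.
  - by move=> z _; rewrite lee_fin.
  rewrite le_eqVlt; apply/orP; left; apply/eqP; apply: ge0_ae_eq_integral => //.
  - exact/measurable_EFinP.
  - apply: (measurable_path_integral (k := EFin \o k)); first exact/measurable_EFinP.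
    by move=> z _; rewrite lee_fin.
  - by move=> w _; rewrite lee_fin.
  - by move=> w _; apply: integral_ge0 => s _; rewrite lee_fin.
  - by apply: filterS aeI => w -> _.
pose h w := (I w - a) * (\1_B w - pi w).
have h0 w : 0 <= h w.
  rewrite /h indicE; case: (boolP (w \in B)); rewrite ?inE ?notin_setE /B /= => Bw.
    by rewrite mulr_ge0// subr_ge0 ?(ltW Bw)//; case/andP: (pi01 w).
  move/negP: Bw; rewrite -leNgt => Bw; rewrite sub0r mulrN -mulNr opprB.
  by rewrite mulr_ge0// subr_ge0.
have mh : measurable_fun setT h by apply: measurable_funM; exact: measurable_funB.
have c_fin : (\int[P]_w (I w * \1_B w)%:E + \int[P]_w (a * \1_B w)%:E)%E \is a fin_num.
  have bound (q q' : Omega -> R) : (forall w, 0 <= q w <= q' w) ->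
      (\int[P]_w (q' w)%:E < +oo)%E -> (\int[P]_w (q w)%:E)%E \is a fin_num.
    move=> qq' q'oo; rewrite ge0_fin_numE; last first.
      by apply: integral_ge0 => w _; rewrite lee_fin; case/andP: (qq' w).
    apply: le_lt_trans q'oo; apply: ge0_le_integral_nonmeasurable => w _;
      by rewrite lee_fin; case/andP: (qq' w).
  rewrite fin_numD; apply/andP; split.
    apply: (bound _ I) finI => w; rewrite mulr_ge0//= indicE; case: (_ \in _);
      by rewrite /= ?mulr1 ?mulr0.
  apply: (bound _ (cst a)) => [w|].
    by rewrite mulr_ge0//= indicE; case: (_ \in _); rewrite /= ?mulr1 ?mulr0.
  have -> : (\int[P]_w (cst a w)%:E = a%:E * P setT)%E.
    by rewrite -(integral_cst P (@measurableT _ Omega)).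
  by rewrite -ge0_fin_numE ?fin_numM ?fin_num_measure// mule_ge0// lee_fin.
(* The identity for [h] is arranged with nonnegative terms on both sides, since integrals in the
   extended reals cannot be subtracted freely; [c_fin] then allows cancellation. *)
have sumE : (\int[P]_w (h w)%:E + (\int[P]_w (I w * pi w)%:E + \int[P]_w (a * \1_B w)%:E) =
    \int[P]_w (I w * \1_B w)%:E + \int[P]_w (a * pi w)%:E)%E.
  have mIq (q : Omega -> R) : measurable_fun setT q ->
    measurable_fun setT (fun w => (I w * q w)%:E : \bar R).
    by move=> mq; apply/measurable_EFinP; exact: measurable_funM.
  have maq (q : Omega -> R) : measurable_fun setT q ->
    measurable_fun setT (fun w => (a * q w)%:E : \bar R).
    by move=> mq; apply/measurable_EFinP; exact: measurable_funM.
  rewrite -ge0_integralD//; first last.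
  - exact: maq.
  - by move=> w _; rewrite lee_fin mulr_ge0.
  - exact: mIq.
  - by move=> w _; rewrite lee_fin mulr_ge0.
  rewrite -ge0_integralD//; first last.
  - by apply: emeasurable_funD; [exact: mIq|exact: maq].
  - by move=> w _; rewrite -EFinD lee_fin addr_ge0// mulr_ge0.
  - exact/measurable_EFinP.
  - by move=> w _; rewrite lee_fin.
  rewrite -ge0_integralD//; first last.
  - exact: maq.
  - by move=> w _; rewrite lee_fin mulr_ge0.
  - exact: mIq.
  - by move=> w _; rewrite lee_fin mulr_ge0.
  apply: eq_integral => w _; rewrite -!EFinD; congr _%:E; rewrite /h; ring.
have aE : (\int[P]_w (a * pi w)%:E = \int[P]_w (a * \1_B w)%:E)%E.
  under eq_integral do rewrite EFinM.
  under [RHS]eq_integral do rewrite EFinM.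
  rewrite !ge0_integralZl//; first by rewrite E1.
  - exact/measurable_EFinP.
  - by move=> w _; rewrite lee_fin.
have hint0 : (\int[P]_w (h w)%:E = 0)%E.
  rewrite EB aE in sumE.
  have := @addeK _ _ (\int[P]_w (h w)%:E)%E c_fin.
  by rewrite sumE subee// => <-.
have hae : {ae P, forall w, h w = 0}.
  have : (\int[P]_w `|(h w)%:E| = 0)%E.
    by rewrite -hint0; apply: eq_integral => w _; rewrite gee0_abs// lee_fin.
  move=> /(ae_eq_integral_abs _ measurableT); move=> /(_ ltac:(exact/measurable_EFinP)).
  by apply: filterS => w /(_ Logic.I) [].
exists [set w | pi w = 1]; split.
- rewrite -(sub_measurableE GP); have := mpi measurableT [set 1] (measurable_set1 _).
  by rewrite setTI; congr measurable.
- apply: filterS hae => w; rewrite /h => hw Iw /=.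
  move: hw; rewrite indicE mem_set// => /eqP; rewrite mulf_eq0 subr_eq0.
  by rewrite gt_eqF//= subr_eq0 => /eqP.
- apply: filterS hae => w; rewrite /h => hw /= piw.
  rewrite leNgt; apply/negP => Iw.
  move: hw; rewrite indicE memNset; last by rewrite /B /= => /ltW; rewrite leNgt Iw.
  by rewrite piw sub0r mulrN1 => /eqP; rewrite oppr_eq0 subr_eq0 lt_eqF.
Qed.

(** The events A of the level set lemma are undetermined where the integral equals the level. Taking
    levels b - 1/(n+1) and intersecting removes the ambiguity, and the null sets left over belong to
    G. *)
Lemma adapted_ge0_path_int (k : measurableTypeR R * Omega -> R) :
  (leb \x P)%E.-integrable horizon (EFin \o k) -> (forall z, 0 <= k z) ->
  (forall s, times s -> measurable_fun setT ((fun w => k (s, w)) : OG -> R)) ->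
  measurable_fun setT (path_int k : OG -> R).
Proof.
move=> ik k0 ak; apply: (measurability _ (RGenCInfty.measurableE R)) => //.
move=> _ [_ [b ->] <-]; rewrite setTI.
have /choice[A AP] : forall n : nat, exists A, [/\ G A,
    {ae P, forall w, b - n.+1%:R^-1 < path_int k w -> A w} &
    {ae P, forall w, A w -> b - n.+1%:R^-1 <= path_int k w}].
  by move=> n; exact: adapted_level_set.
have aeA : {ae P, forall w, (b <= path_int k w) = `[< forall n, A n w >]}.
  have h1 := ae_foralln (fun n => let: And3 _ h _ := AP n in h).
  have h2 := ae_foralln (fun n => let: And3 _ _ h := AP n in h).
  apply: filterS2 h1 h2 => w h1 h2; apply/idP/asboolP => [bI n|An].
    by apply: h1; apply: lt_le_trans bI; rewrite ltrBlDr ltrDl.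
  apply/ler_addgt0Pr => e e0; have [n ne] := exists_invn_lt e0.
  have := h2 n (An n); move: ne; move: (n.+1%:R^-1) => x; lra.
have mA : measurable (\bigcap_n A n : set OG).
  by apply: bigcap_measurableType => n _; rewrite (sub_measurableE GP); case: (AP n).
set S := _ @^-1` _.
have SE w : S w = (b <= path_int k w) :> Prop.
  by rewrite /S /= in_itv/= andbT.
pose N := [set w | (b <= path_int k w) <> `[< forall n, A n w >]].
have mN (X : set Omega) : X `<=` N -> measurable (X : set OG).
  move=> XN; rewrite (sub_measurableE GP); case: GP => _ _; apply.
  exact: negligibleS aeA.
rewrite (_ : S = (\bigcap_n A n `\` (N `\` S)) `|` (S `&` N)).
  by apply: measurableU; [apply: measurableD => //|]; apply: mN => w [].
apply/seteqP; split=> w.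
  move=> Sw; have [Nw|Nw] := pselect (N w); [by right|left].
  split; last by move=> [].
  move/contrapT : Nw; move: (Sw); rewrite SE => -> /esym/asboolP h n _; exact: h.
move=> [[Aw NS]|[]//]; apply: contrapT => nS; apply: NS; split => //.
rewrite /N /=; move: nS; rewrite SE => /negP/negbTE ->.
by rewrite asboolT// => n; exact: Aw.
Qed.

(** J is the difference of the integrals of the positive and negative parts; it agrees with the
    integral on integrable paths, that is, almost surely. *)
Lemma adapted_path_int (k : measurableTypeR R * Omega -> R) :
  (leb \x P)%E.-integrable horizon (EFin \o k) ->
  (forall s, times s -> measurable_fun setT ((fun w => k (s, w)) : OG -> R)) ->
  exists J : OG -> R, measurable_fun setT J /\ {ae P, forall w, path_int k w = J w}.
Proof.
move=> ik ak.
exists (fun w => path_int (k^\+)%R w - path_int (k^\-)%R w); split.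
  apply: measurable_funB; apply: adapted_ge0_path_int.
  - by apply: integrable_funrpos => //; exact: measurable_horizon.
  - by move=> z; exact: funrpos_ge0.
  - by move=> s sT; apply: measurable_funrpos; exact: ak.
  - by apply: integrable_funrneg => //; exact: measurable_horizon.
  - by move=> z; exact: funrneg_ge0.
  - by move=> s sT; apply: measurable_funrneg; exact: ak.
apply: filterS (ae_integrable_path ik) => w iw; rewrite /path_int -RintegralB//.
- apply: eq_Rintegral => s _.
  by have := congr1 (fun u => u (s, w)) (funrposBneg k).
- exact: measurable_times.
- by apply: (integrable_funrpos (f := fun s => k (s, w))) => //; exact: measurable_times.
- by apply: (integrable_funrneg (f := fun s => k (s, w))) => //; exact: measurable_times.
Qed.

End adapted.

End horizon_integrals.

(** Raising g to [+oo] on the exceptional null set makes the inequality hold everywhere without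
    changing the integral of g, so f may be arbitrary. *)
Lemma ae_le_integral_nonmeasurable d (T : measurableType d) (R : realType)
    (mu : {measure set T -> \bar R}) (f g : T -> \bar R) :
  (forall x, (0 <= f x)%E) -> (forall x, (0 <= g x)%E) -> measurable_fun setT g ->
  {ae mu, forall x, (f x <= g x)%E} -> (\int[mu]_x f x <= \int[mu]_x g x)%E.
Proof.
move=> f0 g0 mg [N [mN N0 fgN]].
pose g' x := if x \in N then +oo%E else g x.
apply: (@le_trans _ _ (\int[mu]_x g' x)%E).
  apply: ge0_le_integral_nonmeasurable => // x _; rewrite /g'.
  case: ifPn => [|]; first by rewrite leey.
  by rewrite notin_setE => xN; apply: contrapT => h; apply: xN; exact: fgN.
rewrite le_eqVlt; apply/orP; left; apply/eqP; apply: ge0_ae_eq_integral => //.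
- apply: measurable_fun_ifT => //; exact: measurable_fun_mem.
- by move=> x _; rewrite /g'; case: ifP.
exists N; split => // x /= h; apply: contrapT => xN; apply: h => _.
by rewrite /g' memNset.
Qed.

(** * Inequalities and linearity for real-valued integrals *)

Section Rintegral_complements.
Context d (T : measurableType d) (R : realType) (mu : {measure set T -> \bar R}).
Variables (D : set T) (mD : measurable D).
Implicit Types f g : T -> R.

Lemma ae_eq_Rintegral f g : measurable_fun D f -> measurable_fun D g ->
  {ae mu, forall x, D x -> f x = g x} -> Rintegral mu D f = Rintegral mu D g.
Proof.
move=> mf mg fg; rewrite /Rintegral; congr fine; apply: ae_eq_integral => //.
- exact/measurable_EFinP.
- exact/measurable_EFinP.
by apply: filterS fg => x fg Dx; rewrite fg.
Qed.

Lemma ae_le_Rintegral f g : mu.-integrable D (EFin \o f) ->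
  mu.-integrable D (EFin \o g) -> {ae mu, forall x, D x -> f x <= g x} ->
  Rintegral mu D f <= Rintegral mu D g.
Proof.
move=> if_ ig fg; rewrite -subr_ge0 -RintegralB//.
have mf : measurable_fun D f by apply/measurable_EFinP; exact: measurable_int if_.
have mg : measurable_fun D g by apply/measurable_EFinP; exact: measurable_int ig.
rewrite (@ae_eq_Rintegral _ (fun x => `|g x - f x|)).
- by apply: Rintegral_ge0.
- exact: measurable_funB.
- by apply: measurableT_comp => //; exact: measurable_funB.
by apply: filterS fg => x fg /fg; rewrite -subr_ge0 => h; rewrite ger0_norm.
Qed.

Lemma integrable_lincomb n (p : 'I_n -> R) (f : 'I_n -> T -> R) (r : seq 'I_n) :
  (forall i, mu.-integrable D (EFin \o f i)) ->
  mu.-integrable D (EFin \o (fun x => \sum_(i <- r) p i * f i x)) /\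
  Rintegral mu D (fun x => \sum_(i <- r) p i * f i x) =
  \sum_(i <- r) p i * Rintegral mu D (f i).
Proof.
move=> intf; elim: r => [|i r [IH1 IH2]].
  rewrite big_nil; split; under eq_fun do rewrite big_nil; first exact: integrable0.
  by rewrite Rintegral_cst// mul0r.
have ip : mu.-integrable D (EFin \o (fun x => p i * f i x)).
  by apply: eq_integrable (integrableZl mD (p i) (intf i)).
rewrite big_cons; split; under eq_fun do rewrite big_cons.
  by apply: eq_integrable (integrableD mD ip IH1).
by rewrite RintegralD// IH2 RintegralZl.
Qed.

(** Cauchy-Schwarz against the constant 1, from the nonnegativity of the integral of the squared
    deviation of f from its mean [a]. *)
Lemma sqr_Rintegral_le (f : T -> R) (c : R) : 0 < c -> mu D = c%:E ->
  mu.-integrable D (EFin \o f) ->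
  (((Rintegral mu D f) ^+ 2)%:E <= c%:E * \int[mu]_(x in D) (f x ^+ 2)%:E)%E.
Proof.
move=> c0 muD intf.
have mf : measurable_fun D f by apply/measurable_EFinP; exact: measurable_int intf.
have [Qoo|Qoo] := eqVneq (\int[mu]_(x in D) (f x ^+ 2)%:E)%E +oo%E.
  by rewrite Qoo gt0_muley ?leey.
have intf2 : mu.-integrable D (EFin \o (fun x => f x ^+ 2)).
  apply/integrableP; split; first by apply/measurable_EFinP; exact: measurable_funX.
  rewrite ltey; apply: contra Qoo => /eqP <-; apply/eqP; apply: eq_integral => x _.
  by rewrite /= ger0_norm ?sqr_ge0.
rewrite -(fineK (integrable_fin_num mD intf2)) -EFinM lee_fin.
rewrite -/(Rintegral mu D (fun x => f x ^+ 2)).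
set Q := Rintegral mu D (fun x => f x ^+ 2); set J := Rintegral mu D f.
pose a := J / c.
have ic : mu.-integrable D (EFin \o cst (a ^+ 2)).
  apply/integrableP; split.
    by apply/measurable_EFinP; exact: measurable_cst.
  under eq_integral do rewrite /=.
  by rewrite (integral_cst mu mD) muD -EFinM ltry.
have ib : mu.-integrable D (EFin \o (fun x => 2 * a * f x)).
  by apply: eq_integrable (integrableZl mD (2 * a) intf).
have : 0 <= Rintegral mu D (fun x => (f x ^+ 2 - 2 * a * f x) + cst (a ^+ 2) x).
  apply: Rintegral_ge0 => x _ /=.
  by have := sqr_ge0 (f x - a); nra.
rewrite RintegralD//; last by apply: eq_integrable (integrableB mD intf2 ib).
rewrite RintegralB// RintegralZl// Rintegral_cst// muD /= -/Q -/J.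
have aJ : a * c = J by rewrite /a divfK// gt_eqF.
clear ic ib; clearbody a => /(mulr_ge0 (ltW c0)); rewrite -aJ; nra.
Qed.

End Rintegral_complements.

(** * Integrals of vector-valued paths *)

Section path_vectors.
Context {R : realType} {dsp : measure_display} {Omega : measurableType dsp}.
Variables (P : probability Omega R) (T : R) (T_gt0 : 0 < T).
Context {d : nat}.
Local Notation leb := (@lebesgue_measure R).
Implicit Types (f g : R -> Omega -> 'rV[R]_d) (e : R -> Omega -> R).

Definition path_integrable f w :=
  forall i, leb.-integrable (times T) (EFin \o (fun s => f s w 0 i)).

Lemma path_integralD f g w : path_integrable f w -> path_integrable g w ->
  path_integral T (fun s w => f s w + g s w) w = path_integral T f w + path_integral T g w.
Proof.
move=> iF ig; apply/rowP => i; rewrite !mxE.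
rewrite -(RintegralD (measurable_times T) (iF i) (ig i)).
by apply: eq_Rintegral => s _; rewrite mxE.
Qed.

(** By duality the hypothesis reads [dotp p (f s w) <= e s w * enorm p] for all polar p, and each of
    these inequalities integrates separately. *)
Lemma near_path_integral (C : set 'rV[R]_d) f e w :
  C !=set0 -> closed C -> convex_set C -> is_cone C ->
  path_integrable f w -> leb.-integrable (times T) (EFin \o e^~ w) ->
  (forall s, 0 <= e s w) ->
  {ae leb, forall s, times T s -> near_set C (e s w) (f s w)} ->
  near_set C (Rintegral leb (times T) (e^~ w)) (path_integral T f w).
Proof.
move=> C0 clC cvC coneC intf inte e0 fC.
have mT := measurable_times T.
have r0 : 0 <= Rintegral leb (times T) (e^~ w) by exact: Rintegral_ge0.
apply/(near_coneP C0 clC cvC coneC) => // p pp.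
have [h1 h2] := integrable_lincomb mT (fun i => p 0 i) (index_enum _) intf.
rewrite /dotp (eq_bigr (fun i => p 0 i * Rintegral leb (times T) (fun s => f s w 0 i))); last first.
  by move=> i _; rewrite mxE.
rewrite -h2 mulrC -RintegralZl//.
apply: ae_le_Rintegral => //.
  by apply: eq_integrable (integrableZl mT (enorm p) inte).
apply: filterS fC => s h sT; rewrite mulrC.
by apply: (near_coneP C0 clC cvC coneC _ _).1 => //; exact: h.
Qed.

(** A coordinatewise bound, which is why the l^1 norm of the selection appears in [rate]. *)
Lemma enorm_path_integral_le f w : path_integrable f w ->
  enorm (path_integral T f w) <=
  Rintegral leb (times T) (fun s => \sum_(i < d) `|f s w 0 i|).
Proof.
move=> intf; apply: (le_trans (enorm_le_sum _)).
have mT := measurable_times T.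
have inta i : leb.-integrable (times T) (EFin \o (fun s => `|f s w 0 i|)).
  by apply: eq_integrable (integrable_abse (intf i)).
have [_] := integrable_lincomb mT (fun=> 1) (index_enum _) inta.
under eq_fun do under eq_bigr do rewrite mul1r.
move=> ->; apply: ler_sum => i _; rewrite mxE mul1r.
exact: le_normr_Rintegral.
Qed.

End path_vectors.

(** * Square-integrable adapted processes *)

Section processes.
Context {R : realType} {dsp : measure_display} {Omega : measurableType dsp}.
Variables (P : probability Omega R) (T : R) (T_gt0 : 0 < T).
Context {d : nat}.
Local Notation leb := (@lebesgue_measure R).
Variable Ft : R -> set (set Omega).
Hypothesis FtP : forall t : R, 0 <= t <= T -> augmented_sub_sigma_algebra P (Ft t).
Hypothesis Ft_mono : forall s t : R, 0 <= s -> s <= t -> t <= T -> Ft s `<=` Ft t.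
Implicit Types (f g : R -> Omega -> 'rV[R]_d) (F : R -> Omega -> set 'rV[R]_d).

Definition process2 f := nonanticipative T Ft f /\
  (\int[(leb \x P)%E]_(z in horizon T) ((enorm (f z.1 z.2)) ^+ 2)%:E < +oo)%E.

Lemma process2_measurable f : process2 f ->
  measurable_vec (horizon T) (fun z : measurableTypeR R * Omega => f z.1 z.2).
Proof. by move=> [[mf _] _] i; exact: mf. Qed.

Lemma process2_coord f i : process2 f ->
  (leb \x P)%E.-integrable (horizon T) (EFin \o (fun z => f z.1 z.2 0 i)).
Proof.
move=> pf; apply: integrable_of_sqr; first exact: process2_measurable.
case: pf => _; apply: le_lt_trans; apply: ge0_le_integral_nonmeasurable => z _.
  by rewrite lee_fin sqr_ge0.
rewrite lee_fin -real_normK ?num_real// ler_pXn2r ?nnegrE ?enorm_ge0//.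
exact: ler_abs_coord_enorm.
Qed.

Lemma process2_path_integrable f : process2 f -> {ae P, forall w, path_integrable T f w}.
Proof.
move=> pf; have h i := ae_integrable_path (process2_coord i pf).
have : {ae P, forall w, forall i, i \in index_enum 'I_d ->
    leb.-integrable (times T) (EFin \o (fun s => f s w 0 i))}.
  elim: (index_enum _) => [|i r IH]; first exact: aeW.
  apply: filterS2 (h i) IH => w hi IH j; rewrite inE => /orP[/eqP->//|]; exact: IH.
by apply: filterS => w hw i; apply: hw; exact: mem_index_enum.
Qed.

Lemma process2_add f g : process2 f -> process2 g ->
  process2 (fun s w => f s w + g s w).
Proof.
move=> pf pg; have [[mf af] f2] := pf; have [[mg ag] g2] := pg; split.
  split; first by apply: measurable_vecD; exact: process2_measurable.
  move=> t tT; apply/(rv_measurableE (FtP tT)).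
  by apply: measurable_vecD; apply/(rv_measurableE (FtP tT)); [exact: af|exact: ag].
have mH := @measurable_horizon R dsp Omega T.
have m2 h : process2 h -> measurable_fun (horizon T)
    (fun z : measurableTypeR R * Omega => (2 * enorm (h z.1 z.2) ^+ 2)%:E).
  move=> /process2_measurable mh; apply/measurable_EFinP; apply: measurable_funM => //.
  by apply: measurable_funX; exact: measurable_enorm.
have i2 h : process2 h -> (\int[(leb \x P)%E]_(z in horizon T)
    (2 * enorm (h z.1 z.2) ^+ 2)%:E < +oo)%E.
  move=> ph; under eq_integral do rewrite EFinM.
  rewrite ge0_integralZl//; first by apply: lte_mul_pinfty => //; case: ph.
    apply/measurable_EFinP; apply: measurable_funX.
    by apply: measurable_enorm => //; exact: process2_measurable.
  by move=> z _; rewrite lee_fin sqr_ge0.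
apply: (@le_lt_trans _ _ (\int[(leb \x P)%E]_(z in horizon T)
  ((2 * enorm (f z.1 z.2) ^+ 2)%:E + (2 * enorm (g z.1 z.2) ^+ 2)%:E))%E).
  apply: ge0_le_integral_nonmeasurable => z _; first by rewrite lee_fin sqr_ge0.
  by rewrite -EFinD lee_fin sqr_enormD.
rewrite ge0_integralD//.
- by apply: lte_add_pinfty; exact: i2.
- by move=> z _; rewrite lee_fin mulr_ge0// sqr_ge0.
- exact: m2.
- by move=> z _; rewrite lee_fin mulr_ge0// sqr_ge0.
- exact: m2.
Qed.

(** Open on the left, as in [indicator_process], so that []0, s]] and []s, t]] partition []0,
    t]]. *)
Definition restrict_time (s t : R) f : R -> Omega -> 'rV[R]_d :=
  fun u w => \1_(`]s, t]%classic : set R) u *: f u w.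

Lemma restrict_time_in s t f u w : s < u <= t -> restrict_time s t f u w = f u w.
Proof. by move=> ut; rewrite /restrict_time indicE mem_set ?scale1r//= in_itv. Qed.

Lemma restrict_time_out s t f u w : ~~ (s < u <= t) -> restrict_time s t f u w = 0.
Proof.
by move=> ut; rewrite /restrict_time indicE memNset ?scale0r//= in_itv; exact/negP.
Qed.

Lemma enorm_restrict_time_le s t f u w : enorm (restrict_time s t f u w) <= enorm (f u w).
Proof.
by case: (boolP (s < u <= t)) => ut;
  [rewrite restrict_time_in|rewrite restrict_time_out// enorm0 enorm_ge0].
Qed.

Lemma process2_restrict_time s t f : process2 f -> process2 (restrict_time s t f).
Proof.
move=> pf; have [[mf af] f2] := pf; split.
  split.
    apply: measurable_vecZ; last exact: process2_measurable.
    apply: measurable_funTS.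
    have mI : measurable_fun setT (\1_(`]s, t]%classic : set R) : measurableTypeR R -> R).
      by apply: measurable_indic; exact: measurable_itv.
    exact: measurableT_comp mI measurable_fst.
  move=> u uT; apply/(rv_measurableE (FtP uT)); apply: measurable_vecZ => //.
  by apply/(rv_measurableE (FtP uT)); exact: af.
apply: le_lt_trans f2; apply: ge0_le_integral_nonmeasurable => z _.
  by rewrite lee_fin sqr_ge0.
by rewrite lee_fin ler_pXn2r ?nnegrE ?enorm_ge0// enorm_restrict_time_le.
Qed.

Lemma process2_cst (c : 'rV[R]_d) : process2 (fun _ _ => c).
Proof.
split.
  split; first by move=> i; exact: measurable_cst.
  move=> u uT; apply/(rv_measurableE (FtP uT)); exact: measurable_vec_cst.
rewrite integral_cst; last exact: measurable_horizon.
rewrite -ge0_fin_numE; last by rewrite mule_ge0// lee_fin sqr_ge0.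
by rewrite fin_numM// ge0_fin_numE//; exact: horizon_finite.
Qed.

Lemma path_integral_ae_eq f g : process2 f -> process2 g ->
  {ae (leb \x P)%E, forall z : measurableTypeR R * Omega, horizon T z ->
    f z.1 z.2 = g z.1 z.2} ->
  {ae P, forall w, path_integral T f w = path_integral T g w}.
Proof.
move=> pf pg /ae_horizon_path; apply: filterS => w fg.
apply/rowP => i; rewrite !mxE.
apply: ae_eq_Rintegral; first exact: measurable_times.
- exact: (measurable_path w (process2_measurable pf i)).
- exact: (measurable_path w (process2_measurable pg i)).
- by apply: filterS fg => s h sT; rewrite (h sT).
Qed.

Lemma lebesgue_times : leb (times T) = T%:E.
Proof.
rewrite (_ : leb (times T) = lebesgue_measure (`[0, T]%classic : set R))//.
by rewrite lebesgue_measure_itv/= lte_fin T_gt0 oppr0 adde0.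
Qed.

(** All values of f are F_t-measurable here, as happens after restriction to []0, t]]. Adaptedness
    of each coordinate integral gives measurability; Cauchy-Schwarz in time and Tonelli give the
    moment bound. *)
Lemma path_integral_L2 f t : 0 <= t <= T -> process2 f ->
  (forall u, times T u -> rv_measurable (Ft t) (f u)) ->
  L2 P (Ft t) (path_integral T f).
Proof.
move=> tT pf ft; have Gt := FtP tT; split.
  have h i : exists J : Omega -> R, measurable_fun (setT : set (g_sigma_algebraType (Ft t))) J /\
      {ae P, forall w, path_int T (fun z => f z.1 z.2 0 i) w = J w}.
    apply: (adapted_path_int Gt); first exact: process2_coord.
    by move=> s sT; exact: ((rv_measurableE Gt _).1 (ft s sT) i).
  have /choice[J JP] := h.
  apply: (rv_measurable_ae Gt (f := fun w => \row_i J i w)).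
    apply/(rv_measurableE Gt) => i; under eq_fun do rewrite mxE.
    by case: (JP i).
  have : {ae P, forall w, forall i, i \in index_enum 'I_d ->
      path_int T (fun z => f z.1 z.2 0 i) w = J i w}.
    elim: (index_enum _) => [|i r IH]; first exact: aeW.
    have [_ Ji] := JP i.
    apply: filterS2 Ji IH => w hi IH j; rewrite inE => /orP[/eqP->//|]; exact: IH.
  apply: filterS => w hw; apply/rowP => i; rewrite !mxE -hw// mem_index_enum.
pose sq w := (\int[leb]_(s in times T) ((enorm (f s w)) ^+ 2)%:E)%E.
have mf2 : measurable_fun (horizon T)
    (fun z : measurableTypeR R * Omega => ((enorm (f z.1 z.2)) ^+ 2)%:E).
  apply/measurable_EFinP; apply: measurable_funX.
  by apply: measurable_enorm; [exact: measurable_horizon|exact: process2_measurable].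
have msq : measurable_fun setT sq.
  by apply: (measurable_path_integral mf2) => z _; rewrite lee_fin sqr_ge0.
have sq0 w : (0 <= sq w)%E by apply: integral_ge0 => s _; rewrite lee_fin sqr_ge0.
apply: (@le_lt_trans _ _ (\int[P]_w (T%:E * sq w))%E).
  apply: ae_le_integral_nonmeasurable.
  - by move=> w; rewrite lee_fin sqr_ge0.
  - by move=> w; rewrite mule_ge0// lee_fin ltW.
  - exact: measurable_funeM.
  apply: filterS (process2_path_integrable pf) => w iw.
  rewrite enorm_sqr /dotp /sq.
  under eq_integral do rewrite enorm_sqr /dotp -sumEFin.
  rewrite ge0_integral_sum//; last 3 first.
  - exact: measurable_times.
  - move=> i; apply/measurable_EFinP; apply: measurable_funM;
      exact: (measurable_path w (process2_measurable pf i)).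
  - by move=> i s _; rewrite lee_fin -expr2 sqr_ge0.
  rewrite ge0_sume_distrr; last first.
    by move=> i _; apply: integral_ge0 => s _; rewrite lee_fin -expr2 sqr_ge0.
  rewrite -sumEFin; apply: lee_sum => i _; rewrite mxE -expr2.
  exact: (sqr_Rintegral_le (measurable_times T) T_gt0 lebesgue_times (iw i)).
rewrite ge0_integralZl//; last by rewrite lee_fin ltW.
apply: lte_mul_pinfty => //; first by rewrite lee_fin ltW.
have <- : (\int[(leb \x P)%E]_(z in horizon T) ((enorm (f z.1 z.2)) ^+ 2)%:E =
    \int[P]_w sq w)%E.
  by apply: (tonelli_path P mf2) => z _; rewrite lee_fin sqr_ge0.
by case: pf.
Qed.

End processes.

(** * Selections of a set-valued process *)

(** For each small rational ball meeting C, a point of C in it is retained. The sequence lies inside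
    C, so that almost sure statements for each vector of C can be made simultaneous. *)
Lemma separable_subset {R : realType} {d : nat} (C : set 'rV[R]_d) : C !=set0 ->
  exists c : nat -> 'rV[R]_d, (forall n, C (c n)) /\
    forall x, C x -> forall e : R, 0 < e -> exists n, enorm (x - c n) < e.
Proof.
move=> [c0 Cc0].
have /choice[c cP] : forall nk : nat * nat, exists y, C y /\
    ((exists2 x, C x & enorm (x - rat_point nk.1) < nk.2.+1%:R^-1) ->
     enorm (y - rat_point nk.1) < nk.2.+1%:R^-1).
  move=> nk; have [[x Cx xn]|h] := pselect (exists2 x, C x &
      enorm (x - rat_point nk.1) < nk.2.+1%:R^-1); first by exists x.
  by exists c0.
exists (fun m => c (odflt (0, 0)%N (unpickle m))); split=> [m|x Cx e e0].
  by have [] := cP (odflt (0, 0)%N (unpickle m)).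
have e20 : 0 < e / 2 by rewrite divr_gt0.
have [k ke] := exists_invn_lt e20.
have [n nk] := dense_rat_point x (ltac:(by []) : 0 < k.+1%:R^-1 :> R).
exists (pickle (n, k)); rewrite pickleK /=.
have [_ /= h] := cP (n, k).
have {}h := h (ex_intro2 _ _ x Cx nk).
apply: (le_lt_trans (ler_enorm_dist (rat_point n) _ _)).
move: ke nk h; rewrite (enormB (c _)).
by move: (enorm _) (enorm _) (k.+1%:R^-1) => *; lra.
Qed.

Section set_integrals.
Context {R : realType} {dsp : measure_display} {Omega : measurableType dsp}.
Variables (P : probability Omega R) (T : R) (T_gt0 : 0 < T).
Context {d : nat}.
Local Notation leb := (@lebesgue_measure R).
Variable Ft : R -> set (set Omega).
Hypothesis FtP : forall t : R, 0 <= t <= T -> augmented_sub_sigma_algebra P (Ft t).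
Hypothesis Ft_mono : forall s t : R, 0 <= s -> s <= t -> t <= T -> Ft s `<=` Ft t.
Variable C : set 'rV[R]_d.
Hypotheses (C_neq0 : C !=set0) (closedC : closed C) (convexC : convex_set C)
  (coneC : is_cone C).
Variable F : R -> Omega -> set 'rV[R]_d.
Hypothesis FL2 : L2_CF P T Ft C F.
Implicit Types (f g : R -> Omega -> 'rV[R]_d) (s t r : R).
Local Notation proc := (process2 P T Ft).
Local Notation horizonT := (horizon T).
Local Notation timesT := (times T).

Let C0 : C 0.
Proof. exact: cone0. Qed.

Let mH : measurable (horizonT : set (measurableTypeR R * Omega)).
Proof. exact: measurable_horizon. Qed.

Lemma horizonP (z : measurableTypeR R * Omega) : horizonT z <-> 0 <= z.1 <= T.
Proof. by rewrite /horizon /times /= in_itv; split=> [[]|]. Qed.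

Lemma S2P (F' : R -> Omega -> set 'rV[R]_d) f : S2 P T Ft F' f <-> proc f /\
  {ae (leb \x P)%E, forall z : measurableTypeR R * Omega, horizonT z ->
     F' z.1 z.2 (f z.1 z.2)}.
Proof.
split=> [[nf f2 fF]|[[nf f2] fF]]; split => //.
  have [N [mN N0 sub]] := fF; exists N; split => // z /= nh; apply: sub => /= h.
  by apply: nh => /horizonP; exact: h.
have [N [mN N0 sub]] := fF; exists N; split => // z /= nh; apply: sub => /= h.
by apply: nh => /horizonP; exact: h.
Qed.

Let closedF z : horizonT z -> closed (F z.1 z.2).
Proof.
by move=> /horizonP zT; case: FL2 => -[_ cF] _ _ _; have [cFz _] := cF _ zT; exact: cFz.
Qed.

Let measurableF (E : set 'rV[R]_d) : closed E ->
  measurable (horizonT `&` [set z : measurableTypeR R * Omega | F z.1 z.2 `&` E !=set0]).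
Proof.
move=> cE; case: FL2 => -[mF _] _ _ _; have := mF E cE; congr measurable.
by apply/seteqP; split=> z [h1 h2]; split => //; exact/horizonP.
Qed.

Let F_nonempty :
  {ae (leb \x P)%E, forall z : measurableTypeR R * Omega, horizonT z -> F z.1 z.2 !=set0}.
Proof.
case: FL2 => _ [f /S2P[_ fF]] _ _; apply: filterS fF => z h zH.
by exists (f z.1 z.2); exact: h.
Qed.

Let measurable_memF f : proc f ->
  measurable (horizonT `&` [set z : measurableTypeR R * Omega | F z.1 z.2 (f z.1 z.2)]).
Proof.
move=> pf; apply: (measurable_mem_closed_set (X := fun z => F z.1 z.2)) => //.
exact: (process2_measurable pf).
Qed.

(** At each fixed time this is the identity between F and the closure of F + C, almost surely. The
    exceptional set is a difference of two membership events, hence measurable, and Tonelli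
    applies. *)
Lemma ae_shift f c : proc f -> C c ->
  {ae (leb \x P)%E, forall z : measurableTypeR R * Omega, horizonT z ->
     F z.1 z.2 (f z.1 z.2) -> F z.1 z.2 (f z.1 z.2 + c)}.
Proof.
move=> pf Cc.
have pfc : proc (fun s w => f s w + c) by apply: process2_add => //; exact: process2_cst.
pose N := (horizonT `&` [set z : measurableTypeR R * Omega | F z.1 z.2 (f z.1 z.2)]) `\`
  (horizonT `&` [set z : measurableTypeR R * Omega | F z.1 z.2 (f z.1 z.2 + c)]).
have mN : measurable N.
  by apply: measurableD; [exact: (measurable_memF pf)|exact: (measurable_memF pfc)].
have : (leb \x P)%E.-negligible N.
  apply: (negligible_horizon (T := T)) => // [s sT|z [[]]//].
  case: FL2 => _ _ FL _; have sT' : 0 <= s <= T by move: sT; rewrite /times /= in_itv.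
  apply: negligibleS (FL s sT') => w; rewrite /xsection /= inE.
  move=> [[_ Ffw] nF] [_ _ FE _]; apply: nF; split => //.
  by rewrite /= FE; apply: subset_closure; exists (f s w) => //; exists c.
apply: negligibleS => z /= h; apply: contrapT => nN; apply: h => zH Fz.
by apply: contrapT => h; apply: nN; split => // -[].
Qed.

Definition selection t f := proc f /\
  {ae (leb \x P)%E, forall z : measurableTypeR R * Omega, horizonT z ->
     (0 < z.1 <= t -> F z.1 z.2 (f z.1 z.2)) /\ (~~ (0 < z.1 <= t) -> f z.1 z.2 = 0)}.

(** Off []0, t]] the indicator process equals {0} only where F is nonempty; nonemptiness almost
    everywhere comes from the existence of a selection. *)
Lemma S2_indicatorP t f : S2 P T Ft (indicator_process t F) f <-> selection t f.
Proof.
rewrite S2P; split=> -[pf fF]; split => //.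
  apply: filterS fF => z h zH; have [x Fx fE] := h zH; split=> zt.
    by rewrite -fE indicE mem_set ?scale1r//= in_itv.
  by rewrite -fE indicE memNset ?scale0r//= in_itv; exact/negP.
apply: filterS2 F_nonempty fF => z Fz h zH; have [h1 h2] := h zH.
rewrite /indicator_process /= indicE; case: (boolP (0 < z.1 <= t)) => zt.
  exists (f z.1 z.2); first exact: h1.
  by rewrite mem_set ?scale1r//= in_itv.
have [x Fx] := Fz zH; exists x => //.
by rewrite memNset ?scale0r ?h2//= in_itv; exact/negP.
Qed.

Lemma selection_restrict_time s t f : s <= t -> selection t f -> selection s (restrict_time 0 s f).
Proof.
move=> st [pf fF]; split; first exact: process2_restrict_time.
apply: filterS fF => z h zH; have [h1 h2] := h zH; split=> zs; last by rewrite restrict_time_out.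
rewrite restrict_time_in//; apply: h1; case/andP: zs => -> zs; exact: le_trans st.
Qed.

Variable f0 : R -> Omega -> 'rV[R]_d.
Hypothesis F0 : S2 P T Ft F f0.

Let pf0 : proc f0.
Proof. by have [] := (S2P _ _).1 F0. Qed.

Lemma selection_extend s t f : 0 <= s -> s <= t -> selection s f ->
  selection t (fun u w => f u w + restrict_time s t f0 u w).
Proof.
move=> s0 st [pf fF]; split.
  by apply: process2_add => //; exact: process2_restrict_time.
have [_ f0F] := (S2P _ _).1 F0.
apply: filterS2 fF f0F => z h h' zH; have [h1 h2] := h zH.
have [zs|zs] := boolP (0 < z.1 <= s).
  rewrite restrict_time_out; last by rewrite negb_and -leNgt; case/andP: zs => _ ->.
  rewrite addr0; split=> [_|]; first exact: h1.
  by case/andP: zs => -> zs /=; rewrite (le_trans zs st).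
rewrite h2// add0r; split=> zt.
  rewrite restrict_time_in; first exact: h'.
  case/andP: zt zs => -> -> /=; by rewrite -ltNge andbT.
rewrite restrict_time_out//; apply: contra zt => /andP[sz ->].
by rewrite (le_lt_trans s0 sz).
Qed.

Lemma selection_shift t f c : 0 < t -> C c -> selection t f ->
  selection t (fun u w => f u w + restrict_time 0 t (fun _ _ => t^-1 *: c) u w).
Proof.
move=> t0 Cc [pf fF]; split.
  by apply: process2_add => //; apply: process2_restrict_time => //; exact: process2_cst.
have Ctc : C (t^-1 *: c) by apply: coneC; rewrite ?invr_gt0.
apply: filterS2 fF (ae_shift pf Ctc) => z h h' zH; have [h1 h2] := h zH.
split=> zt; last by rewrite restrict_time_out// addr0 h2.
by rewrite restrict_time_in//; apply: h' => //; exact: h1.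
Qed.

Lemma selection0 : selection 0 (fun _ _ => 0).
Proof.
split; first exact: process2_cst.
by apply: aeW => z zH; split => // /andP[z0 z0']; move: z0; rewrite ltNge z0'.
Qed.

Lemma path_integral_shift t (c : 'rV[R]_d) w : 0 < t -> t <= T ->
  path_integral T (restrict_time 0 t (fun _ (_ : Omega) => t^-1 *: c)) w = c.
Proof.
move=> t0 tT; apply/rowP => i; rewrite mxE.
have mI : measurable (`]0, t]%classic : set (measurableTypeR R)) by exact: measurable_itv.
transitivity (Rintegral leb timesT (fun s => (t^-1 * c 0 i) *
    \1_(`]0, t]%classic : set (measurableTypeR R)) s)).
  by apply: eq_Rintegral => s _; rewrite !mxE mulrC.
rewrite RintegralZl//; first last.
- have := @integrable_indic_itv R 0 t false false.
  by apply: integrableS => //; exact: measurable_times.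
- exact: measurable_times.
rewrite /Rintegral integral_indic//; last exact: measurable_times.
rewrite (_ : _ `&` _ = `]0, t]%classic); last first.
  apply/seteqP; split=> s /=; first by case.
  rewrite !in_itv/= => /andP[s0 st]; split; first by rewrite s0.
  by rewrite /times /= in_itv/= (ltW s0) (le_trans st).
have lebI : fine (lebesgue_measure (`]0, t]%classic : set R)) = t.
  by rewrite lebesgue_measure_itv/= lte_fin t0 oppr0 adde0.
transitivity (t^-1 * c 0 i * t); first by congr (_ * _); exact: lebI.
by rewrite mulrAC mulVf ?mul1r// gt_eqF.
Qed.

Lemma path_integral_split s t f : 0 <= s -> s <= t -> selection t f ->
  {ae P, forall w, path_integral T f w =
     path_integral T (restrict_time 0 s f) w + path_integral T (restrict_time s t f) w}.
Proof.
move=> s0 st [pf fF].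
have pc a b : proc (restrict_time a b f) by exact: process2_restrict_time.
have h := path_integral_ae_eq pf (process2_add FtP (pc 0 s) (pc s t)).
apply: filterS3 (process2_path_integrable (pc 0 s)) (process2_path_integrable (pc s t)) (h _).
  by move=> w i1 i2 ->; exact: path_integralD.
apply: filterS fF => z hz zH; have [_ h2] := hz zH.
have [z1|z1] := boolP (0 < z.1 <= s).
  rewrite restrict_time_in// restrict_time_out ?addr0// negb_and -leNgt.
  by case/andP: z1 => _ ->.
rewrite (restrict_time_out f z.2 z1) add0r.
have [z2|z2] := boolP (s < z.1 <= t); first by rewrite restrict_time_in.
rewrite restrict_time_out// h2//; apply: contra z2 => /andP[z0 ->]; rewrite andbT.
by move: z1; rewrite z0 /= -ltNge.
Qed.

(** A selection vanishes off []0, t]] only almost everywhere, so its values there need not be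
    F_r-measurable. Restricting it to []0, t]] repairs this and changes the integral on a null set
    only. *)
Lemma selection_L2 t r f : 0 <= t -> t <= r -> r <= T -> selection t f ->
  L2 P (Ft r) (path_integral T f).
Proof.
move=> t0 tr rT [pf fF].
have rT' : 0 <= r <= T by rewrite (le_trans t0 tr).
have pc : proc (restrict_time 0 t f) by exact: process2_restrict_time.
have [m1 m2] : L2 P (Ft r) (path_integral T (restrict_time 0 t f)).
  apply: (path_integral_L2 T_gt0 FtP) => // u uT.
  have uT' : 0 <= u <= T by move: uT; rewrite /times /= in_itv.
  have [ut|ut] := boolP (0 < u <= t).
    rewrite (_ : restrict_time 0 t f u = f u); last by apply/funext => w; rewrite restrict_time_in.
    case: pf => -[_ af] _ i U mU; apply: (Ft_mono (s := u)); last exact: af.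
    - by case/andP: uT'.
    - by case/andP: ut => _ ut; exact: le_trans tr.
    - by [].
  rewrite (_ : restrict_time 0 t f u = fun=> 0); last by apply/funext => w; rewrite restrict_time_out.
  by apply/(rv_measurableE (FtP rT')); exact: measurable_vec_cst.
have eqae : {ae P, forall w, path_integral T (restrict_time 0 t f) w = path_integral T f w}.
  apply: (path_integral_ae_eq pc pf); apply: filterS fF => z hz zH.
  have [_ h2] := hz zH; have [zt|zt] := boolP (0 < z.1 <= t); first by rewrite restrict_time_in.
  by rewrite restrict_time_out// h2.
split; first exact: (rv_measurable_ae (FtP rT') m1 eqae).
suff -> : (\int[P]_w ((enorm (path_integral T f w)) ^+ 2)%:E =
    \int[P]_w ((enorm (path_integral T (restrict_time 0 t f) w)) ^+ 2)%:E)%E by [].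
have mv (g : Omega -> 'rV[R]_d) : rv_measurable (Ft r) g -> measurable_fun setT
    (fun w => ((enorm (g w)) ^+ 2)%:E).
  by move=> mg; apply: measurable_sqr_enorm; exact: (rv_measurable_vec (FtP rT')).
apply: ae_eq_integral => //; [|exact: mv|].
  by apply: mv; exact: (rv_measurable_ae (FtP rT') m1 eqae).
by apply: filterS eqae => w ->.
Qed.

End set_integrals.

(** * Comparison of the integrals at two times *)

Lemma ae_conj {R : realType} {dsp : measure_display} {Omega : measurableType dsp}
    (P : probability Omega R) (A B : Omega -> Prop) :
  {ae P, forall w, A w} -> {ae P, forall w, B w} -> {ae P, forall w, A w /\ B w}.
Proof. by move=> a b; apply: filterS2 a b => w. Qed.

Section excess.
Context {R : realType} {dsp : measure_display} {Omega : measurableType dsp}.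
Variables (P : probability Omega R) (T : R).
Context {d : nat}.
Local Notation leb := (@lebesgue_measure R).
Variable Ft : R -> set (set Omega).
Variable C : set 'rV[R]_d.
Hypotheses (C_neq0 : C !=set0).
Variable F : R -> Omega -> set 'rV[R]_d.
Hypothesis FL2 : L2_CF P T Ft C F.
Local Notation horizonT := (horizon T : set (measurableTypeR R * Omega)).

Let ex (z : measurableTypeR R * Omega) : \bar R :=
  ereal_sup [set ereal_inf [set (enorm (a - b))%:E | b in C] | a in F z.1 z.2].

(** Measurability of F is tested on closed sets: the excess is greater than r iff, for some n, F
    meets the closed set of points at distance at least r + 1/(n+1) from C. *)
Let measurable_ex : measurable_fun horizonT ex.
Proof.
move=> mH; apply: (measurability _ (ErealGenOInfty.measurableE R)) => //.
move=> _ [_ [r ->] <-].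
pose E n := [set x : 'rV[R]_d | forall b, C b -> r + n.+1%:R^-1 <= enorm (x - b)].
rewrite (_ : _ `&` _ = \bigcup_n [set z : measurableTypeR R * Omega |
    0 <= z.1 <= T /\ F z.1 z.2 `&` E n !=set0]).
  apply: bigcup_measurable => n _; case: FL2 => -[mF _] _ _ _.
  by apply: mF; exact: closed_far_set.
apply/seteqP; split=> z.
  move=> [/horizonP zT]; rewrite /= in_itv/= andbT => /ereal_sup_gt[_ [a Fa <-] ra].
  have [[n En]|/forallNP h] := pselect (exists n, E n a).
    by exists n => //; split => //; exists a.
  move: ra; rewrite ltNge => /negP[]; apply/near_setP => e' e'0.
  have [n ne] := exists_invn_lt e'0.
  have /existsNP[b /not_implyP[Cb /negP]] := h n; rewrite -ltNge => ab.
  by exists b => //; apply: (lt_trans ab); rewrite ltrD2l.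
move=> [n _ [zT [a [Fa Ea]]]]; split; first exact/horizonP.
rewrite /= in_itv/= andbT.
apply: (@lt_le_trans _ _ (r + n.+1%:R^-1)%:E); first by rewrite lte_fin ltrDl.
apply: (@le_trans _ _ (ereal_inf [set (enorm (a - b))%:E | b in C])).
  by apply: le_ereal_inf_tmp => _ [b Cb <-]; rewrite lee_fin; exact: Ea.
by apply: ereal_sup_ubound; exists a.
Qed.

Let ex_le z : (ex z <= hausdorff (F z.1 z.2) C)%E.
Proof. by rewrite /hausdorff le_max lexx. Qed.

Lemma excess_bound : exists e : measurableTypeR R * Omega -> R,
  [/\ measurable_fun horizonT e, forall z, 0 <= e z,
      (\int[(leb \x P)%E]_(z in horizonT) ((e z) ^+ 2)%:E < +oo)%E &
      {ae (leb \x P)%E, forall z, horizonT z ->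
         F z.1 z.2 `<=` near_set C (e z)}].
Proof.
have mH := @measurable_horizon R dsp Omega T.
(* [fine] sends infinite values to 0: an empty value of F (excess [-oo]) needs no bound, and excess
   [+oo] occurs on a null set only, as shown below. *)
pose e z := Num.max 0 (fine (ex z)).
have me : measurable_fun horizonT e.
  apply: measurable_maxr; first exact: measurable_cst.
  by apply: measurableT_comp measurable_ex; exact: fine_measurable.
have e0 z : 0 <= e z by rewrite /e le_max lexx.
exists e; split => //.
  rewrite tonelli_path; last 2 first.
  - by apply/measurable_EFinP; exact: measurable_funX.
  - by move=> z _; rewrite lee_fin sqr_ge0.
  case: FL2 => _ _ _; apply: le_lt_trans.
  apply: ge0_le_integral_nonmeasurable => w _.
    by apply: integral_ge0 => s _; rewrite lee_fin sqr_ge0.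
  apply: ge0_le_integral_nonmeasurable => s _; first by rewrite lee_fin sqr_ge0.
  have h0 : (0 <= hausdorff (F s w) C)%E by exact: hausdorff_ge0.
  rewrite EFin_expe; apply: lee_pmul; rewrite ?lee_fin//; rewrite /e; have := ex_le (s, w);
    case: (ex (s, w)) => [r| |] /=; rewrite ?maxxx// => rh; rewrite /Num.max;
    by case: ifP.
have : (leb \x P)%E.-negligible (horizonT `&` ex @^-1` [set +oo%E]).
  apply: (negligible_horizon (T := T)) => [|s sT|z []//].
    by apply: measurable_ex => //; exact: emeasurable_set1.
  case: FL2 => _ _ FL _; have sT' : 0 <= s <= T by move: sT; rewrite /times /= in_itv.
  apply: negligibleS (FL s sT') => w; rewrite /xsection /= inE.
  by move=> [_ exoo] [_ _ _]; have := ex_le (s, w); rewrite exoo leye_eq => /eqP ->.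
apply: negligibleS => z /= h; apply: contrapT => nN; apply: h => zH x Fx.
apply/near_setP.
have xex : (ereal_inf [set (enorm (x - b))%:E | b in C] <= ex z)%E.
  by apply: ereal_sup_ubound; exists x.
apply: (le_trans xex).
have ex0 : (0 <= ex z)%E.
  by apply: le_trans xex; apply: le_ereal_inf_tmp => _ [b _ <-]; rewrite lee_fin enorm_ge0.
have exfin : ex z \is a fin_num.
  rewrite ge0_fin_numE// ltey; apply/eqP => exoo; apply: nN; split => //.
by rewrite -(fineK exfin) lee_fin /e le_max lexx orbT.
Qed.

End excess.

(** * The modulus of continuity as an integral *)

Section partial_integral.
Context {R : realType}.
Variables (T : R) .
Local Notation leb := (@lebesgue_measure R).
Local Notation timesT := (times T).
Variable k : measurableTypeR R -> R.
Hypotheses (ik : leb.-integrable timesT (EFin \o k)) (k_ge0 : forall u, 0 <= k u).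
Implicit Types s t : R.

Lemma integrable_indic_mul s t :
  leb.-integrable timesT (EFin \o (fun u => \1_(`]s, t]%classic : set R) u * k u)).
Proof.
have mT := measurable_times T.
have mk : measurable_fun timesT k by apply/measurable_EFinP; exact: measurable_int ik.
apply: (le_integrable mT _ _ ik).
  apply/measurable_EFinP; apply: measurable_funM => //.
move=> u _; rewrite /= lee_fin normrM ler_piMl// indicE.
by case: (_ \in _); rewrite /= ?normr1 ?normr0.
Qed.

Definition partial_integral s t :=
  Rintegral leb timesT (fun u => \1_(`]s, t]%classic : set R) u * k u).

Lemma partial_integral_split s t : 0 <= s -> s <= t ->
  partial_integral 0 t = partial_integral 0 s + partial_integral s t.
Proof.
move=> s0 st; rewrite /partial_integral -RintegralD//; last 3 first.
- exact: measurable_times.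
- exact: integrable_indic_mul.
- exact: integrable_indic_mul.
apply: eq_Rintegral => u _ /=; rewrite -mulrDl; congr (_ * _); rewrite !indicE !mem_setE !in_itv/=; have [us|su] := leP u s.
  by rewrite (le_trans us st) andbT addr0.
by rewrite (le_lt_trans s0 su) add0r.
Qed.

Lemma partial_integral_dist s t : 0 <= s -> s <= t ->
  `|partial_integral 0 s - partial_integral 0 t| = partial_integral s t.
Proof.
move=> s0 st; rewrite (partial_integral_split s0 st) opprD addrA subrr add0r normrN.
by rewrite ger0_norm//; apply: Rintegral_ge0 => u _; rewrite mulr_ge0// indicE.
Qed.

Lemma partial_integral_continuous t : 0 < T -> 0 <= t <= T -> forall e : R, 0 < e ->
  exists2 r, 0 < r & forall s : R, 0 <= s <= T -> `|t - s| < r ->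
    `|partial_integral 0 t - partial_integral 0 s| < e.
Proof.
move=> T_gt0 tT e e0.
have gE s : 0 <= s <= T -> partial_integral 0 s = parameterized_integral leb 0 s k.
  move=> /andP[s0 sT]; rewrite /parameterized_integral -Rintegral_itv_obnd_cbnd; last first.
    apply: integrableS ik => //; first exact: measurable_times.
    move=> u; rewrite /= /times/= !in_itv/= => /andP[u0 us].
    by rewrite (ltW u0) (le_trans us sT).
  rewrite (_ : [set` `]0, s]] = timesT `&` [set` `]0, s]]); last first.
    apply/seteqP; split => [u|u []//]; rewrite /= /times/= !in_itv/= => /andP[u0 us].
    by rewrite us u0 (ltW u0) (le_trans us sT).
  rewrite Rintegral_mkcondr; apply: eq_Rintegral => u _; rewrite patchE indicE.
  by case: ifP; rewrite ?mul1r ?mul0r.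
have /subspace_continuousP := parameterized_integral_continuous (ltW T_gt0) ik.
have tT' : [set` `[0, T]] t by rewrite /= in_itv.
move=> /(_ _ tT')/cvgrPdist_lt/(_ _ e0)/nbhs_ballP[r /= r0 tr].
exists r => // s sT ts; rewrite !gE//; exact: tr.
Qed.

End partial_integral.

(** * Integrals as generated closed random sets *)

Section generated_sets.
Context {R : realType} {dsp : measure_display} {Omega : measurableType dsp}.
Variables (P : probability Omega R) (T : R) (T_gt0 : 0 < T).
Context {d : nat}.
Local Notation leb := (@lebesgue_measure R).
Variable Ft : R -> set (set Omega).
Hypothesis FtP : forall t : R, 0 <= t <= T -> augmented_sub_sigma_algebra P (Ft t).
Hypothesis Ft_mono : forall s t : R, 0 <= s -> s <= t -> t <= T -> Ft s `<=` Ft t.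
Variable C : set 'rV[R]_d.
Hypotheses (C_neq0 : C !=set0) (closedC : closed C) (convexC : convex_set C)
  (coneC : is_cone C).
Variable F : R -> Omega -> set 'rV[R]_d.
Hypothesis FL2 : L2_CF P T Ft C F.
Implicit Types (f g : R -> Omega -> 'rV[R]_d) (X Y : Omega -> set 'rV[R]_d) (s t r : R).
Local Notation proc := (process2 P T Ft).
Local Notation horizonT := (horizon T : set (measurableTypeR R * Omega)).
Local Notation timesT := (times T).
Local Notation sel := (selection P T Ft F).

Let C0 : C 0.
Proof. exact: cone0. Qed.

(* Up to null sets, [X] is the closed random set generated by the translates by
   vectors of [C] of the integrals over [0, t] of the selections of [F]. *)
Definition generated t X := [/\ forall w, closed (X w),
  forall f c, sel t f -> C c -> {ae P, forall w, X w (path_integral T f w + c)} &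
  forall Phi : Omega -> set 'rV[R]_d, (forall w, closed (Phi w)) ->
    (forall f c, sel t f -> C c -> {ae P, forall w, Phi w (path_integral T f w + c)}) ->
    {ae P, forall w, X w `<=` Phi w}].

Lemma generated_unique t X Y : generated t X -> generated t Y ->
  {ae P, forall w, X w = Y w}.
Proof.
move=> [cX Xf XPhi] [cY Yf YPhi].
apply: filterS2 (XPhi Y cY Yf) (YPhi X cX Xf) => w XY YX.
by apply/seteqP.
Qed.

Lemma generated_ae t X Y : generated t X -> (forall w, closed (Y w)) ->
  {ae P, forall w, X w = Y w} -> generated t Y.
Proof.
move=> [cX Xf XPhi] cY XY; split => // [f c sf Cc|Phi cPhi hPhi].
  by apply: filterS2 XY (Xf f c sf Cc) => w <-.
by apply: filterS2 XY (XPhi Phi cPhi hPhi) => w <-.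
Qed.

(** For each c in a dense sequence of C, the set of x with [x + c] in X is closed and contains the
    generating vectors, as C is stable under sums; minimality of X gives the inclusion. Closedness
    of X then covers all of C. *)
Lemma generated_addC t X : generated t X ->
  {ae P, forall w, forall x c, X w x -> C c -> X w (x + c)}.
Proof.
move=> [cX Xf XPhi]; have [c [Cc c_dense]] := separable_subset C_neq0.
have h n : {ae P, forall w, X w `<=` [set x | X w (x + c n)]}.
  apply: (XPhi (fun w => [set x | X w (x + c n)])) => [w|f c' sf Cc'].
    apply/closed_enorm => x hx /=; apply: (closed_enorm (X w)).1 => // e' e'0.
    have [y Xy xy] := hx _ e'0; exists (y + c n) => //.
    by rewrite opprD addrACA subrr addr0.
  have := Xf f (c' + c n) sf (coneD convexC coneC Cc' (Cc n)).
  by apply: filterS => w; rewrite /= addrA.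
apply: filterS (ae_foralln h) => w hw x c' Xx Cc'.
apply: (closed_enorm _).1 => // e' e'0; have [n cn] := c_dense _ Cc' _ e'0.
exists (x + c n); first exact: hw.
by rewrite opprD addrACA subrr add0r.
Qed.

Lemma path_integral0 w : path_integral T (fun _ (_ : Omega) => 0 : 'rV[R]_d) w = 0.
Proof.
apply/rowP => i; rewrite !mxE Rintegral_cst; last exact: (measurable_times T).
by rewrite mul0r.
Qed.

(** Selections over the empty interval integrate to 0, so the generating vectors are those of C.
    Time 0 thus becomes an ordinary instance of the comparison between two times. *)
Lemma generated_time0 : generated 0 (fun=> C).
Proof.
split=> // [f c [pf fF] Cc|Phi cPhi hPhi].
  have h : {ae P, forall w, path_integral T f w = path_integral T (fun _ _ => 0) w}.
    apply: (path_integral_ae_eq pf (process2_cst FtP 0)).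
    apply: filterS fF => z hz zH; apply: (hz zH).2.
    by apply/negP => /andP[z0 z0']; move: z0; rewrite ltNge z0'.
  by apply: filterS h => w ->; rewrite path_integral0 add0r.
have [c [Cc c_dense]] := separable_subset C_neq0.
have h n : {ae P, forall w, Phi w (c n)}.
  apply: filterS (hPhi _ (c n) (selection0 FtP F) (Cc n)) => w.
  by rewrite path_integral0 add0r.
apply: filterS (ae_foralln h) => w hw x Cx.
apply: (closed_enorm _).1 => // e' e'0; have [n cn] := c_dense _ Cx _ e'0.
by exists (c n).
Qed.

Local Notation integrals t := (path_integral T @` S2 P T Ft (indicator_process t F)).

Lemma integrals_L2 t r : 0 <= t -> t <= r -> r <= T -> integrals t `<=` L2 P (Ft r).
Proof.
move=> t0 tr rT _ [f /(S2_indicatorP FL2) sf <-].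
exact: (selection_L2 T_gt0 FtP Ft_mono t0 tr rT sf).
Qed.

Variable f0 : R -> Omega -> 'rV[R]_d.
Hypothesis F0 : S2 P T Ft F f0.

Let pf0 : proc f0.
Proof. by have [] := (S2P _ _ _ _ _).1 F0. Qed.

Lemma selection_f0 t : 0 <= t -> sel t (fun u w => 0 + restrict_time 0 t f0 u w).
Proof. by move=> t0; exact: (selection_extend FtP F0 (lexx 0) t0 (selection0 FtP F)). Qed.

Lemma integrals_neq0 t : 0 <= t -> integrals t !=set0.
Proof.
move=> /selection_f0 sf; exists (path_integral T (fun u w => 0 + restrict_time 0 t f0 u w)).
by exists (fun u w => 0 + restrict_time 0 t f0 u w) => //; exact/(S2_indicatorP FL2).
Qed.

(** The parameter r is taken to be T, as in the definition of the integral, and also t, to obtain an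
    F_t-measurable version. Minimality combines the transfer of membership to the closed hull with
    the recovery of X from its selectors. *)
Lemma generated_hull t r X : 0 < t -> t <= r -> r <= T ->
  closed_random_set (Ft r) X ->
  L2_selectors P (Ft r) X = closed_dec_hull P (Ft r) (integrals t) -> generated t X.
Proof.
move=> t0 tr rT rX XM.
have rT' : 0 <= r <= T by rewrite (le_trans (ltW t0) tr).
have VL2 := integrals_L2 (ltW t0) tr rT.
have Xv v : integrals t v -> {ae P, forall w, X w (v w)}.
  by move=> /(sub_closed_dec_hull VL2); rewrite -XM => -[].
split=> [w|f c sf Cc|Phi cPhi hPhi]; first by case: rX.
  have sfc := selection_shift FtP coneC FL2 t0 Cc sf.
  have := Xv _ (ex_intro2 _ _ _ ((S2_indicatorP FL2 _ _).2 sfc) erefl).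
  have [pf _] := sf.
  have pc : proc (restrict_time 0 t (fun _ _ => t^-1 *: c)).
    by apply: (process2_restrict_time FtP); exact: process2_cst.
  apply: filterS3 (process2_path_integrable pf) (process2_path_integrable pc).
  move=> w i1 i2; rewrite path_integralD// path_integral_shift//.
  exact: le_trans rT.
have [g0 Vg0] := integrals_neq0 (ltW t0).
apply: (ae_sub_of_selectors (FtP rT') (g0 := g0)) => //.
  by rewrite XM; exact: (sub_closed_dec_hull VL2).
move=> g; rewrite XM; apply: (closed_dec_hull_ae (FtP rT')) => // v.
move=> [f /(S2_indicatorP FL2) sf <-].
by have := hPhi f 0 sf C0; apply: filterS => w; rewrite addr0.
Qed.

Lemma exists_generated t r : 0 < t -> t <= r -> r <= T -> exists X,
  [/\ closed_random_set (Ft r) X,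
      L2_selectors P (Ft r) X = closed_dec_hull P (Ft r) (integrals t) & generated t X].
Proof.
move=> t0 tr rT; have rT' : 0 <= r <= T by rewrite (le_trans (ltW t0) tr).
have VL2 := integrals_L2 (ltW t0) tr rT.
have [phi [_ rX XM]] := hiai_umegaki (FtP rT') VL2 (integrals_neq0 (ltW t0)).
by exists (fun w => closure (range (phi^~ w))); split => //; exact: generated_hull rX XM.
Qed.

Variable e : measurableTypeR R * Omega -> R.
Hypotheses (me : measurable_fun horizonT e) (e_ge0 : forall z, 0 <= e z)
  (e2 : (\int[(leb \x P)%E]_(z in horizonT) ((e z) ^+ 2)%:E < +oo)%E)
  (eP : {ae (leb \x P)%E, forall z, horizonT z -> F z.1 z.2 `<=` near_set C (e z)}).

Definition rate (z : measurableTypeR R * Omega) : R :=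
  e z + \sum_(i < d) `|f0 z.1 z.2 0 i|.

Definition rate_integral s t w := partial_integral T (fun u => rate (u, w)) s t.

Lemma rate_ge0 z : 0 <= rate z.
Proof. by rewrite addr_ge0// sumr_ge0. Qed.

Lemma integrable_rate : (leb \x P)%E.-integrable horizonT (EFin \o rate).
Proof.
have mH := @measurable_horizon R dsp Omega T.
have ie := integrable_of_sqr me e2.
have i0 i : (leb \x P)%E.-integrable horizonT (EFin \o (fun z => `|f0 z.1 z.2 0 i|)).
  by apply: eq_integrable (integrable_abse (process2_coord i pf0)).
have [h _] := integrable_lincomb mH (fun=> 1) (index_enum _) i0.
apply: eq_integrable (integrableD mH ie h) => // z _ /=.
by rewrite -EFinD; congr _%:E; congr (_ + _); apply: eq_bigr => i _; rewrite mul1r.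
Qed.

Lemma near_C_path_integral s t f : 0 <= s -> sel t f ->
  {ae P, forall w, near_set C (rate_integral s t w) (path_integral T (restrict_time s t f) w)}.
Proof.
move=> s0 [pf fF].
have pc := process2_restrict_time FtP s t pf.
have nearz : {ae (leb \x P)%E, forall z : measurableTypeR R * Omega, horizonT z ->
    near_set C (\1_(`]s, t]%classic : set R) z.1 * e z) (restrict_time s t f z.1 z.2)}.
  apply: filterS2 fF eP => z hz ez zH; rewrite indicE.
  have [zs|zs] := boolP (s < z.1 <= t).
    rewrite restrict_time_in// mem_set/= ?in_itv// mul1r; apply: ez => //.
    by apply: (hz zH).1; case/andP: zs => sz ->; rewrite (le_lt_trans s0).
  rewrite restrict_time_out// memNset/= ?in_itv ?mul0r; last exact/negP.
  by move=> e' e'0; exists 0 => //; rewrite subrr enorm0 add0r.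
apply: filterS3 (process2_path_integrable pc) (ae_integrable_path integrable_rate)
  (ae_horizon_path nearz) => w i1 i2 nearw.
have mT := measurable_times T.
have ie : leb.-integrable timesT (EFin \o (fun u => e (u, w))).
  apply: (le_integrable mT _ _ i2).
    by apply/measurable_EFinP; exact: (measurable_path w me).
  move=> u _; rewrite /= lee_fin !ger0_norm ?rate_ge0//.
  by rewrite lerDl sumr_ge0.
have ie1 := integrable_indic_mul ie s t.
have := near_path_integral C_neq0 closedC convexC coneC i1
  (e := fun u w => \1_(`]s, t]%classic : set R) u * e (u, w)) ie1 _ nearw.
move=> /(_ _)/near_set_le; apply; last by move=> u; rewrite mulr_ge0// indicE.
apply: le_Rintegral => //; first exact: integrable_indic_mul.
move=> u _; apply: ler_wpM2l; first by rewrite indicE.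
by rewrite lerDl sumr_ge0.
Qed.

(** Minimality of Y is applied with the neighbourhood of X as competitor, which is closed; only the
    generating vectors remain to be estimated. The vector of C approximating the increment is
    absorbed by X. *)
Lemma generated_sub_near s t X Y : 0 <= s -> s <= t -> generated s X -> generated t Y ->
  {ae P, forall w, Y w `<=` near_set (X w) (rate_integral s t w)}.
Proof.
move=> s0 st gX [_ _ YPhi]; apply: YPhi => [w|f c sf Cc]; first exact: closed_near_set.
have [_ Xf _] := gX.
have := Xf _ c (selection_restrict_time FtP st sf) Cc.
have h := ae_conj (path_integral_split FtP s0 st sf) (near_C_path_integral s0 sf).
move=> Xf'; apply: filterS3 h (generated_addC gX) Xf' => w [-> nC] XC Xw e' e'0.
have [c' Cc' yc'] := nC _ e'0; rewrite addrAC.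
exists (path_integral T (restrict_time 0 s f) w + c + c'); first exact: XC.
by rewrite opprD addrACA subrr add0r.
Qed.

Lemma generated_near_sub s t X Y : 0 <= s -> s <= t -> generated s X -> generated t Y ->
  {ae P, forall w, X w `<=` near_set (Y w) (rate_integral s t w)}.
Proof.
move=> s0 st [_ _ XPhi] gY; apply: XPhi => [w|f c sf Cc]; first exact: closed_near_set.
have [_ Yf _] := gY; have [pf _] := sf.
have pc := process2_restrict_time FtP s t pf0.
have := Yf _ c (selection_extend FtP F0 s0 st sf) Cc.
have h := ae_conj (process2_path_integrable pf) (process2_path_integrable pc).
move=> Yf'; apply: filterS3 h (ae_integrable_path integrable_rate) Yf' => w [i1 i2] ir.
rewrite path_integralD// => Yw e' e'0.
exists (path_integral T f w + path_integral T (restrict_time s t f0) w + c) => //.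
rewrite opprD addrACA subrr addr0 opprD addrA subrr add0r enormN.
apply: (@le_lt_trans _ _ (rate_integral s t w)); last by rewrite ltrDl.
apply: (le_trans (enorm_path_integral_le i2)).
have mT := measurable_times T.
have inta i : leb.-integrable timesT (EFin \o (fun u => `|restrict_time s t f0 u w 0 i|)).
  by apply: eq_integrable (integrable_abse (i2 i)).
apply: le_Rintegral => //.
- have [+ _] := integrable_lincomb mT (fun=> 1) (index_enum _) inta.
  by apply: eq_integrable => // u _ /=; congr _%:E; apply: eq_bigr => i _; rewrite mul1r.
- exact: integrable_indic_mul.
move=> u _; rewrite indicE; have [us|us] := boolP (s < u <= t).
  by rewrite restrict_time_in// mem_set/= ?in_itv// mul1r lerDr.
rewrite restrict_time_out// memNset/= ?in_itv; last exact/negP.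
by rewrite mul0r big1// => i _; rewrite mxE normr0.
Qed.

End generated_sets.

(** * Extension of a set-valued path from a dense set of times *)

Section continuous_extension.
Context {R : realType} {d : nat}.
Variables (T : R) (X : nat -> set 'rV[R]_d) (u : nat -> R) (g : R -> R).
Hypotheses (uT : forall n, 0 <= u n <= T)
  (u_dense : forall t : R, 0 <= t <= T -> forall e : R, 0 < e -> exists n, `|t - u n| < e)
  (g_cont : forall t : R, 0 <= t <= T -> forall e : R, 0 < e -> exists2 r, 0 < r &
     forall s : R, 0 <= s <= T -> `|t - s| < r -> `|g t - g s| < e)
  (X_near : forall n k, X n `<=` near_set (X k) `|g (u n) - g (u k)|).
Implicit Types s t : R.

(* The largest set compatible with the bounds on the distances to the [X n];
   unlike a limit along a subsequence it requires no choice. *)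
Definition modulus_extension t := [set x | forall n, near_set (X n) `|g t - g (u n)| x].

Lemma closed_modulus_extension t : closed (modulus_extension t).
Proof.
rewrite (_ : modulus_extension t = \bigcap_n near_set (X n) `|g t - g (u n)|).
  by apply: closed_bigI => n _; exact: closed_near_set.
by apply/seteqP; split => x hx n; [move=> _; exact: hx|exact: hx].
Qed.

Let approx t : 0 <= t <= T -> forall e : R, 0 < e -> exists n, `|g t - g (u n)| < e.
Proof.
move=> tT e e0; have [r r0 gr] := g_cont tT e0; have [n un] := u_dense tT r0.
by exists n; exact: gr.
Qed.

Let dist_triangle a b c : `|g a - g c| <= `|g a - g b| + `|g b - g c|.
Proof. exact: ler_distD. Qed.

(** Indices [v l] are chosen with [g (u (v l))] tending to [g t]; closeness is needed in the
    modulus, not in time. Points of [X (v l)] near x have a cluster point, and the bounds between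
    the sets pass to it by the triangle inequality. *)
Lemma sub_near_modulus_extension t n : 0 <= t <= T ->
  X n `<=` near_set (modulus_extension t) `|g t - g (u n)|.
Proof.
move=> tT x Xx.
have /choice[v vP] : forall l : nat, exists k, `|g t - g (u k)| < l.+1%:R^-1.
  by move=> l; exact: approx.
have inv0 l : 0 < l.+1%:R^-1 :> R by rewrite invr_gt0.
have /choice[a aP] : forall l, exists y, X (v l) y /\
    enorm (x - y) < `|g t - g (u n)| + l.+1%:R^-1 + l.+1%:R^-1.
  move=> l; have [y Xy xy] := @X_near n (v l) x Xx _ (inv0 l).
  exists y; split => //; apply: (lt_le_trans xy); rewrite lerD2r.
  have := vP l; have := dist_triangle (u n) t (u (v l)).
  rewrite [`|g (u n) - g t|]distrC; move: (l.+1%:R^-1) => *; lra.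
have inv1 l : l.+1%:R^-1 <= 1 :> R by rewrite invf_le1// ler1n.
(* The two error terms 1/(l+1) are each at most 1, so a margin of 2 contains the whole sequence. *)
have [l|p _ pP] := compact_seq_cluster (@compact_eball R d x (`|g t - g (u n)| + 2)) (a := a).
  have [_] := aP l; have := inv1 l; move=> /=; move: (l.+1%:R^-1) (enorm _) => *; lra.
have cluster (e : R) : 0 < e -> exists l, enorm (p - a l) < e /\ l.+1%:R^-1 < e.
  move=> e0; have [k ke] := exists_invn_lt e0; have [l kl pl] := pP e k e0.
  exists l; split => //; apply: le_lt_trans ke.
  by rewrite lef_pV2 ?posrE// ler_nat ltnS.
move=> e e0; exists p; last first.
  have e40 : 0 < e / 4 by rewrite divr_gt0.
  have [l [pl le]] := cluster _ e40; have [_ xa] := aP l.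
  have := ler_enorm_dist (a l) x p; rewrite (enormB (a l) p).
  move: (enorm (x - a l)) (enorm (p - a l)) (enorm (x - p)) (l.+1%:R^-1) pl le xa => *; lra.
move=> k; apply: near_set_gt => e' e'0; have e20 : 0 < e' / 2 by rewrite divr_gt0.
have [l [pl le]] := cluster _ e20; have [Xa _] := aP l.
apply: near_set_le (near_set_dist p (@X_near (v l) k _ Xa)).
have := vP l; have := dist_triangle (u (v l)) t (u k).
rewrite [`|g (u (v l)) - g t|]distrC.
by move: (enorm (p - a l)) (l.+1%:R^-1) pl le => *; lra.
Qed.

Lemma modulus_extension_near s t : 0 <= s <= T -> 0 <= t <= T ->
  modulus_extension s `<=` near_set (modulus_extension t) `|g s - g t|.
Proof.
move=> sT tT x xs; apply: near_set_gt => e e0.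
have e20 : 0 < e / 2 by rewrite divr_gt0.
have [n sn] := approx sT e20.
have := near_set_trans (xs n) (sub_near_modulus_extension (n := n) tT).
apply: near_set_le; have := dist_triangle t s (u n).
by rewrite [`|g t - g s|]distrC; lra.
Qed.

Lemma modulus_extension_continuous : X 0 !=set0 -> 0 <= T ->
  hausdorff_continuous T modulus_extension.
Proof.
move=> [x0 Xx0] T0 t tT.
have Y0 : modulus_extension t !=set0.
  by have [y Yy _] := sub_near_modulus_extension tT Xx0 ltr01; exists y.
have hausE s : 0 <= s <= T ->
    (hausdorff (modulus_extension s) (modulus_extension t) <= `|g s - g t|%:E)%E.
  move=> sT; apply/hausdorff_leP; split; first exact: modulus_extension_near.
  by rewrite distrC; exact: modulus_extension_near.
have hausfin s : 0 <= s <= T ->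
    hausdorff (modulus_extension s) (modulus_extension t) \is a fin_num.
  by move=> sT; rewrite ge0_fin_numE ?hausdorff_ge0//; apply: le_lt_trans (hausE s sT) (ltry _).
have inT : \forall s \near within (times T) (nbhs t), 0 <= s <= T.
  by apply: filterS (withinT _ _) => s; rewrite /= /times/= in_itv.
apply/fine_cvgP; split; first by apply: filterS inT => s; exact: hausfin.
apply/cvgrPdist_lt => e e0; have [r r0 gr] := g_cont tT e0.
near=> s.
have sT : 0 <= s <= T by near: s.
rewrite /= sub0r normrN ger0_norm ?fine_ge0 ?hausdorff_ge0//.
apply: (@le_lt_trans _ _ `|g s - g t|).
  by rewrite -lee_fin fineK ?hausfin// hausE.
rewrite distrC; apply: gr => //; near: s.
apply: cvg_within; exact: nbhsx_ballx.
Unshelve. all: by end_near.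
Qed.

End continuous_extension.

(** * The indefinite set-valued integral *)

Section augmented_filtration.
Context {R : realType} {dsp : measure_display} {Omega : measurableType dsp}.
Variables (P : probability Omega R) (T : R) (m : nat) (W : R -> Omega -> 'rV[R]_m).

Lemma augmented_filtration_sub_sigma_algebra t : measure_is_complete P ->
  is_brownian_motion P T W -> 0 <= t <= T ->
  augmented_sub_sigma_algebra P (augmented_filtration P W t).
Proof.
move=> completeP [mW _ _ _] /andP[t0 tT]; split.
- exact: smallest_sigma_algebra.
- apply: smallest_sub; first exact: sigma_algebra_measurable.
  move=> _ [[s [i [U [/andP[s0 st] mU ->]]]]|/completeP//].
  have := mW s _ i measurableT U mU; rewrite setTI; apply.
  by rewrite s0 (le_trans st).
- by move=> N N0; apply: sub_gen_smallest; right.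
Qed.

Lemma augmented_filtration_mono s t : s <= t ->
  augmented_filtration P W s `<=` augmented_filtration P W t.
Proof.
move=> st; apply: smallest_sub; first exact: smallest_sigma_algebra.
move=> A [[u [i [U [/andP[u0 us] mU ->]]]]|N0]; apply: sub_gen_smallest; last by right.
by left; exists u, i, U; rewrite u0 (le_trans us).
Qed.

End augmented_filtration.

Section indefinite_integral.
Context {R : realType} {dsp : measure_display} {Omega : measurableType dsp}.
Variables (P : probability Omega R) (T : R) (T_gt0 : 0 < T).
Context {d : nat}.
Local Notation leb := (@lebesgue_measure R).
Variable Ft : R -> set (set Omega).
Hypothesis FtP : forall t : R, 0 <= t <= T -> augmented_sub_sigma_algebra P (Ft t).
Hypothesis Ft_mono : forall s t : R, 0 <= s -> s <= t -> t <= T -> Ft s `<=` Ft t.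
Variable C : set 'rV[R]_d.
Hypotheses (C_neq0 : C !=set0) (closedC : closed C) (convexC : convex_set C)
  (coneC : is_cone C).
Variable F : R -> Omega -> set 'rV[R]_d.
Hypothesis FL2 : L2_CF P T Ft C F.
Local Notation horizonT := (horizon T : set (measurableTypeR R * Omega)).
Local Notation timesT := (times T).
Implicit Types (s t : R) (X Y : Omega -> set 'rV[R]_d).

(** [g] and [h] are fixed once for all, while the null set of the second clause may depend on the
    times and versions. [h] is T times the path integral of the squared rate: by Cauchy-Schwarz a
    measurable, integrable bound for the squared distance to C. *)
Lemma generated_modulus : exists (g : R -> Omega -> R) (h : Omega -> \bar R),
  [/\ {ae P, forall w, forall t : R, 0 <= t <= T -> forall e : R, 0 < e ->
        exists2 r, 0 < r & forall s : R, 0 <= s <= T -> `|t - s| < r ->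
          `|g t w - g s w| < e},
      forall s t X Y, 0 <= s <= T -> 0 <= t <= T ->
        generated P T Ft C F s X -> generated P T Ft C F t Y ->
        {ae P, forall w, X w `<=` near_set (Y w) `|g s w - g t w|} &
      [/\ measurable_fun setT h, (forall w, (0 <= h w)%E), (\int[P]_w h w < +oo)%E &
        forall t, 0 <= t <= T ->
          {ae P, forall w, ((`|g 0 w - g t w| ^+ 2)%:E <= h w)%E}]].
Proof.
have [_ [f0 F0] _ _] := FL2.
have [e [me e_ge0 e2 eP]] := excess_bound C_neq0 FL2.
have mH := @measurable_horizon R dsp Omega T.
have mT := measurable_times T.
have [pf0 _] := (S2P _ _ _ _ _).1 F0.
have [_ f02] := pf0.
pose k := rate f0 e.
have k0 z : 0 <= k z by exact: rate_ge0.
have ik : (leb \x P)%E.-integrable horizonT (EFin \o k).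
  exact: (integrable_rate F0 me e2).
have mk : measurable_fun horizonT k by apply/measurable_EFinP; exact: measurable_int ik.
have mk2 : measurable_fun horizonT (fun z => ((k z) ^+ 2)%:E).
  by apply/measurable_EFinP; exact: measurable_funX.
have k2 z : (0 <= ((k z) ^+ 2)%:E)%E by rewrite lee_fin sqr_ge0.
pose h w := (T%:E * \int[leb]_(u in timesT) ((k (u, w)) ^+ 2)%:E)%E.
have mh : measurable_fun setT (fun w => \int[leb]_(u in timesT) ((k (u, w)) ^+ 2)%:E)%E.
  exact: (measurable_path_integral mk2).
have pk := ae_integrable_path ik.
exists (rate_integral T f0 e 0), h; split.
- apply: filterS pk => w ikw t tT e' e'0.
  exact: (partial_integral_continuous ikw T_gt0 tT e'0).
- move=> s t X Y /andP[s0 sT] /andP[t0 tT] gX gY.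
  have [st|/ltW ts] := leP s t.
    apply: filterS2 pk (generated_near_sub FtP F0 me e_ge0 e2 s0 st gX gY) => w ikw.
    by rewrite /rate_integral (partial_integral_dist ikw _ s0 st).
  apply: filterS2 pk (generated_sub_near FtP C_neq0 closedC convexC coneC F0 me e_ge0 e2 eP
    t0 ts gY gX) => w ikw.
  by rewrite distrC (partial_integral_dist ikw _ t0 ts).
split.
- by apply: measurable_funeM.
- by move=> w; rewrite mule_ge0 ?lee_fin ?(ltW T_gt0)// integral_ge0.
- rewrite ge0_integralZl//; last 2 first.
  + by move=> w _; exact: integral_ge0.
  + by rewrite lee_fin ltW.
  rewrite lte_mul_pinfty ?lee_fin ?(ltW T_gt0)//.
  rewrite -(tonelli_path P mk2)//.
  (* From (a + S)^2 <= 2 a^2 + 2 S^2 and the bound of the l^1 norm by d times the Euclidean norm. *)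
  have b z : (((k z) ^+ 2)%:E <= (2 * e z ^+ 2)%:E +
      ((2 * d%:R ^+ 2) * enorm (f0 z.1 z.2) ^+ 2)%:E)%E.
    rewrite -EFinD lee_fin /k /rate.
    have s0 : 0 <= \sum_(i < d) `|f0 z.1 z.2 0 i| by apply: sumr_ge0.
    have : \sum_(i < d) `|f0 z.1 z.2 0 i| <= d%:R * enorm (f0 z.1 z.2).
      rewrite mulr_natl -[d in _ *+ d]card_ord -sumr_const.
      by apply: ler_sum => i _; exact: ler_abs_coord_enorm.
    move: (\sum_(i < d) _) (e z) (enorm _) (d%:R : R) s0 => S a E D S0 SDE.
    have : S ^+ 2 <= (D * E) ^+ 2 by rewrite ler_pXn2r// nnegrE (le_trans S0).
    by have := sqr_ge0 (a - S); rewrite exprMn; nra.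
  have me2 : measurable_fun horizonT (fun z => (e z ^+ 2)%:E).
    by apply/measurable_EFinP; exact: measurable_funX.
  have mf2 : measurable_fun horizonT (fun z => (enorm (f0 z.1 z.2) ^+ 2)%:E).
    apply/measurable_EFinP; apply: measurable_funX.
    exact: measurable_enorm (process2_measurable pf0).
  apply: (@le_lt_trans _ _ (\int[(leb \x P)%E]_(z in horizonT) (2%:E * (e z ^+ 2)%:E +
      (2 * d%:R ^+ 2)%:E * (enorm (f0 z.1 z.2) ^+ 2)%:E))%E).
    apply: ge0_le_integral_nonmeasurable => // z _.
  rewrite ge0_integralD//; last 4 first.
  + by move=> z _; rewrite mule_ge0// lee_fin sqr_ge0.
  + exact: measurable_funeM.
  + by move=> z _; rewrite mule_ge0// lee_fin ?sqr_ge0// mulr_ge0// sqr_ge0.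
  + exact: measurable_funeM.
  rewrite !ge0_integralZl//; last 2 first.
  + by move=> z _; rewrite lee_fin sqr_ge0.
  + by move=> z _; rewrite lee_fin sqr_ge0.
  by rewrite lte_add_pinfty// lte_mul_pinfty// lee_fin// mulr_ge0// sqr_ge0.
move=> t /andP[t0 tT]; apply: filterS pk => w ikw.
rewrite /rate_integral (partial_integral_dist ikw _ (lexx 0) t0)//.
have ikt := integrable_indic_mul ikw 0 t.
apply: (le_trans (sqr_Rintegral_le mT T_gt0 (lebesgue_times T_gt0) ikt)).
rewrite lee_wpmul2l ?lee_fin ?(ltW T_gt0)//.
apply: ge0_le_integral_nonmeasurable => u _; rewrite lee_fin ?sqr_ge0//.
rewrite ler_pXn2r ?nnegrE ?mulr_ge0// indicE.
by case: (_ \in _); rewrite ?mul1r ?mul0r.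
Qed.

Lemma generated_L2_C t X : 0 <= t <= T -> closed_random_set (Ft t) X ->
  generated P T Ft C F t X -> L2_C P C (Ft t) X.
Proof.
move=> tT tX gX; have /andP[t0 t_le] := tT.
have [g [h [_ gnear [mh h0 hint hbound]]]] := generated_modulus.
have gC := generated_time0 FtP C_neq0 closedC F.
have T0 : 0 <= (0 : R) <= T by rewrite lexx (ltW T_gt0).
have CX := gnear _ _ _ _ T0 tT gC gX.
have XC : {ae P, forall w, X w `<=` near_set C `|g 0 w - g t w|}.
  by apply: filterS (gnear _ _ _ _ tT T0 gX gC) => w; rewrite distrC.
have hX : {ae P, forall w, (hausdorff (X w) C <= `|g 0 w - g t w|%:E)%E}.
  by apply: filterS2 CX XC => w CX XC; apply/hausdorff_leP.
split => //; last first.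
  apply: le_lt_trans hint; apply: ae_le_integral_nonmeasurable => //.
    by move=> w; rewrite expe_ge0// hausdorff_ge0.
  apply: filterS2 hX (hbound _ tT) => w hw; apply: le_trans.
  by rewrite EFin_expe; apply: lee_pmul; rewrite ?hausdorff_ge0.
have [_ [f0 F0] _ _] := FL2; have [_ Xf _] := gX.
have C0 : C 0 by exact: cone0.
have := Xf _ 0 (selection_f0 FtP F0 t0) C0.
move=> Xw; apply: filterS3 Xw (generated_addC C_neq0 convexC coneC gX) hX => w Xw XC' hw.
split; [by eexists; exact: Xw|by case: tX| |exact: le_lt_trans hw (ltry _)].
apply/seteqP; split=> [x Xx|].
  by apply: subset_closure; exists x => //; exists 0 => //; rewrite addr0.
have cX : closed (X w) by case: tX.
rewrite [X in _ `<=` X](closure_id _).1//; apply: closure_subset.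
by move=> _ [x Xx [c Cc <-]]; exact: XC'.
Qed.

Lemma closed_random_set_cst r : 0 <= r <= T -> closed_random_set (Ft r) (fun=> C).
Proof.
move=> /FtP[[G0 GC GU] _ _]; split => // E cE.
have GT : Ft r setT by have := GC _ G0; rewrite setD0.
have [CE|CE] := pselect (C `&` E !=set0).
  by rewrite (_ : [set _ | _] = setT)//; apply/seteqP; split.
by rewrite (_ : [set _ | _] = set0)//; apply/seteqP; split.
Qed.

Lemma is_indefinite_set_integral_generated t X : 0 <= t <= T ->
  is_indefinite_set_integral P T Ft C F t X ->
  generated P T Ft C F t X /\ closed_random_set (Ft t) X.
Proof.
move=> tT; have /andP[t0 t_le] := tT.
have [_ [f0 F0] _ _] := FL2.
rewrite /is_indefinite_set_integral; case: eqP => [->|/eqP tn0] [rX XM].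
  have T0 : 0 <= (0 : R) <= T by rewrite lexx (ltW T_gt0).
  have XC : {ae P, forall w, C = X w} by apply: filterS XM.
  have cX w : closed (X w) by case: rX.
  split; first exact: generated_ae (generated_time0 FtP C_neq0 closedC F) cX XC.
  exact: (closed_random_set_ae (FtP T0) (closed_random_set_cst T0) cX XC).
have tp : 0 < t by rewrite lt_neqAle eq_sym tn0.
have gX := generated_hull T_gt0 FtP Ft_mono C_neq0 closedC coneC FL2 F0 tp t_le (lexx T) rX XM.
split => //.
have [X' [tX' _ gX']] := exists_generated T_gt0 FtP Ft_mono C_neq0 closedC coneC FL2 F0
  tp (lexx t) t_le.
by apply: (closed_random_set_ae (FtP tT) tX' _ (generated_unique gX' gX)) => w; case: rX.
Qed.

Lemma exists_indefinite_set_integral t : 0 <= t <= T -> exists2 X,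
  is_indefinite_set_integral P T Ft C F t X & generated P T Ft C F t X.
Proof.
move=> tT; have /andP[t0 t_le] := tT.
have TT : 0 <= T <= T by rewrite lexx (ltW T_gt0).
have [_ [f0 F0] _ _] := FL2.
have [t_eq|tn0] := eqVneq t 0.
  exists (fun=> C); last by rewrite t_eq; exact: generated_time0.
  by rewrite /is_indefinite_set_integral t_eq eqxx; split; [exact: closed_random_set_cst|exact: aeW].
have tp : 0 < t by rewrite lt_neqAle eq_sym tn0.
have [X [rX XM gX]] := exists_generated T_gt0 FtP Ft_mono C_neq0 closedC coneC FL2 F0
  tp t_le (lexx T).
by exists X => //; rewrite /is_indefinite_set_integral (negbTE tn0).
Qed.

Lemma is_indefinite_set_integral_ae t X Y : 0 <= t <= T ->
  is_indefinite_set_integral P T Ft C F t X -> (forall w, closed (Y w)) ->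
  {ae P, forall w, X w = Y w} -> is_indefinite_set_integral P T Ft C F t Y.
Proof.
move=> tT + cY XY; have TT : 0 <= T <= T by rewrite lexx (ltW T_gt0).
rewrite /is_indefinite_set_integral; case: ifP => _ [rX XM].
  split; first exact: (closed_random_set_ae (FtP TT) rX cY XY).
  by apply: filterS2 XY XM => w <-.
split; first exact: (closed_random_set_ae (FtP TT) rX cY XY).
rewrite -XM; apply/seteqP; split=> g [Lg gX]; split => //.
  by apply: filterS2 XY gX => w <-.
by apply: filterS2 XY gX => w ->.
Qed.

Lemma dense_times : exists u : nat -> R, (forall n, 0 <= u n <= T) /\
  forall t : R, 0 <= t <= T -> forall e : R, 0 < e -> exists n, `|t - u n| < e.
Proof.
pose v n : R := if (unpickle n : option rat) is Some q then ratr q else 0.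
exists (fun n => if 0 <= v n <= T then v n else 0); split=> [n|t /andP[t0 tT] e e0].
  by case: ifP => // _; rewrite lexx (ltW T_gt0).
pose a := Num.max 0 (t - e); pose b := Num.min T (t + e).
have ab : a < b.
  rewrite /a /b lt_min !gt_max T_gt0 /=; apply/andP; split; lra.
have [q] := rat_in_itvoo ab; rewrite in_itv/= /a /b gt_max lt_min.
move=> /andP[/andP[q0 qe] /andP[qT qe']].
exists (pickle q); rewrite /v pickleK (ltW q0) (ltW qT)/=.
by rewrite ltr_norml; apply/andP; split; lra.
Qed.

(** The version [Y] depends only on the integrals at the dense times, so a single null set governs
    the regularity of its paths. Agreement with the integral is needed one time at a time, and its
    null set may depend on that time. *)
Lemma continuous_indefinite_integral : exists X : R -> Omega -> set 'rV[R]_d,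
  (forall t, 0 <= t <= T -> is_indefinite_set_integral P T Ft C F t (X t)) /\
  {ae P, forall w, hausdorff_continuous T (X ^~ w)}.
Proof.
have [g [h [gc gnear _]]] := generated_modulus.
have [u [uT u_dense]] := dense_times.
have T0 := ltW T_gt0.
have /choice[X0 X0P] : forall t, exists X, 0 <= t <= T ->
    is_indefinite_set_integral P T Ft C F t X /\ generated P T Ft C F t X.
  move=> t; have [/exists_indefinite_set_integral[X iX gX]|nt] := boolP (0 <= t <= T).
    by exists X.
  by exists (fun=> set0).
pose Xu w n := X0 (u n) w.
pose Y t w := modulus_extension (Xu w) u (g^~ w) t.
have near_all : {ae P, forall w, forall n k,
    Xu w n `<=` near_set (Xu w k) `|g (u n) w - g (u k) w|}.
  apply: ae_foralln => n; apply: ae_foralln => k.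
  by apply: gnear => //; apply: (X0P _ (uT _)).2.
have cY t w : closed (Y t w) by exact: closed_modulus_extension.
(* One inclusion is the definition of the extension; for the other, a point of [Y t w] is at
   distance at most twice the modulus from [X0 t w], and the modulus is small along dense times
   tending to t. *)
have X0Y t : 0 <= t <= T -> {ae P, forall w, X0 t w = Y t w}.
  move=> tT; have [_ gX] := X0P t tT.
  have h1 : {ae P, forall w, forall n, X0 t w `<=` near_set (Xu w n) `|g t w - g (u n) w|}.
    apply: ae_foralln => n; apply: gnear => //; exact: (X0P _ (uT n)).2.
  have h2 : {ae P, forall w, forall n, Xu w n `<=` near_set (X0 t w) `|g (u n) w - g t w|}.
    apply: ae_foralln => n; apply: gnear => //; exact: (X0P _ (uT n)).2.
  apply: filterS3 gc h1 h2 => w gcw h1 h2; apply/seteqP; split=> [x Xx n|x Yx].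
    exact: h1.
  apply: near_set_closed; first by case: gX.
  apply: near_set_gt => e e0; have e20 : 0 < e / 2 by rewrite divr_gt0.
  have [r r0 gr] := gcw t tT _ e20; have [n tn] := u_dense t tT r r0.
  apply: near_set_le (near_set_trans (Yx n) (h2 n)).
  have := gr _ (uT n) tn; rewrite [X in _ + X <= _]distrC; lra.
exists Y; split=> [t tT|].
  by apply: is_indefinite_set_integral_ae (X0P t tT).1 _ (X0Y t tT).
have Xne : {ae P, forall w, Xu w 0 !=set0}.
  have [_ [f0 F0] _ _] := FL2.
  have [_ gX] := X0P _ (uT 0); have [_ Xf _] := gX.
  have u0 : 0 <= u 0 by have /andP[] := uT 0.
  have C0 : C 0 by exact: cone0.
  by apply: filterS (Xf _ 0 (selection_f0 FtP F0 u0) C0) => w Xw; eexists; exact: Xw.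
apply: filterS3 gc near_all Xne => w gcw nearw Xw.
exact: modulus_extension_continuous.
Qed.

End indefinite_integral.

(** The first claim concerns every version of the integral. Continuity is asserted for a suitable
    family of versions, since each integral is determined only up to a null set depending on its
    time. *)
Theorem proposition4p6 (R : realType) (dsp : measure_display)
    (Omega : measurableType dsp) (P : probability Omega R)
    (completeP : measure_is_complete P)
    (T : R) (T_gt0 : 0 < T)
    (m : nat) (m_gt0 : (0 < m)%N) (W : R -> Omega -> 'rV[R]_m)
    (brownianW : is_brownian_motion P T W)
    (d : nat) (C : set 'rV[R]_d)
    (C_neq0 : C !=set0) (closedC : closed C) (convexC : convex_set C)
    (coneC : is_cone C) (C_nontrivial : C <> [set 0]) (C_proper : C <> setT)
    (F : R -> Omega -> set 'rV[R]_d)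
    (FL2 : L2_CF P T (augmented_filtration P W) C F) :
  (forall t : R, 0 <= t <= T -> forall X : Omega -> set 'rV[R]_d,
     is_indefinite_set_integral P T (augmented_filtration P W) C F t X ->
     L2_C P C (augmented_filtration P W t) X) /\
  (exists X : R -> Omega -> set 'rV[R]_d,
     (forall t : R, 0 <= t <= T ->
        is_indefinite_set_integral P T (augmented_filtration P W) C F t (X t)) /\
     {ae P, forall w, hausdorff_continuous T (X ^~ w)}).
Proof.
have FtP (t : R) : 0 <= t <= T ->
    augmented_sub_sigma_algebra P (augmented_filtration P W t).
  exact: (augmented_filtration_sub_sigma_algebra completeP brownianW).
have Ft_mono (s t : R) : 0 <= s -> s <= t -> t <= T ->
    augmented_filtration P W s `<=` augmented_filtration P W t.
  by move=> _ st _; exact: augmented_filtration_mono.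
split=> [t tT X iX|]; last exact: (continuous_indefinite_integral T_gt0 FtP Ft_mono).
have [gX tX] := is_indefinite_set_integral_generated T_gt0 FtP Ft_mono C_neq0 closedC coneC
  FL2 tT iX.
exact: (generated_L2_C T_gt0 FtP C_neq0 closedC convexC coneC FL2 tT tX gX).
Qed.
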